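(* Let $M_W,L_W\ge 0$, $\rho>0$, $\delta\in(0,1]$ and $N\ge 1$. Assume that $W$ is $(M_W,L_W)$-decomposable, that $m_*$ satisfies a $\rho$-Talagrand inequality, and that $$\mathcal F(\nu|m_* )\ge \delta\,H(\nu|m_* )\qquad\text{for all }\nu\in\mathcal P_2(\mathcal X).$$ Put $\ell_W=L_W/\rho$. Then for all $\varepsilon\in(0,1]$ and all $\nu^N\in\mathcal P_2(\mathcal X^N)$, $$\mathcal F^N(\nu^N|m_* )\ge \delta_N\,H(\nu^N|m_*^{\otimes N})-\Delta_{\mathcal F},$$ where $$\delta_N=(1-\varepsilon)\delta-\Bigl(1+\frac{M_W+\ell_W}{\varepsilon\delta}\Bigr)\frac{2\ell_W}{N},\qquad \Delta_{\mathcal F}=2\Bigl(1+\frac{M_W+\ell_W}{\varepsilon\delta}\Bigr)(M_W+\ell_W d).$$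
   Context: $\mathcal X$ is either $\mathbb T^d$ (flat torus) or $\mathbb R^d$; $\mathcal P_2$ denotes probability measures with finite second moment (all probability measures on the torus). $\langle\cdot,\cdot\rangle$ is integration of a function against a (signed) measure; $[N]=\{1,\dots,N\}$. A kernel $U:\mathcal X\times\mathcal X\to\mathbb R$ is of quadratic growth if $|U(x,y)|\le C(1+|x|^2+|y|^2)$ (on the torus this growth restriction is void). Setting: $V:\mathcal X\to\mathbb R$ and $W:\mathcal X\times\mathcal X\to\mathbb R$ are of class $C^2$, $W$ symmetric of quadratic growth. For $\nu\in\mathcal P_2(\mathcal X)$, $\Pi[\nu](dx)\propto\exp(-V(x)-\langle W(x,\cdot),\nu\rangle)\,dx$ (assumed normalizable to a probability measure), and $m_*\in\mathcal P_2(\mathcal X)$ is a fixed measure with $m_*=\Pi[m_*]$. For $\boldsymbol x=(x^1,\dots,x^N)$, $\mu_{\boldsymbol x}=\frac1N\sum_{i\in[N]}\delta_{x^i}$. Relative entropy: $H(\nu|m)=\int\log\frac{d\nu}{dm}\,d\nu$ ($+\infty$ if $\nu\not\ll m$). Reduced kernel: $W_*(x,y)=W(x,y)-\langle W(x,\cdot),m_*\rangle-\langle W(\cdot,y),m_*\rangle+\langle W,m_*^{\otimes2}\rangle$. Functionals: $\mathcal F(\nu|m_* )=H(\nu|m_* )+\frac12\langle W_*,\nu^{\otimes2}\rangle$ for $\nu\in\mathcal P_2(\mathcal X)$, and $\mathcal F^N(\nu^N|m_* )=H(\nu^N|m_*^{\otimes N})+\frac N2\,\mathbb E_{\boldsymbol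 X\sim\nu^N}[\langle W_*,\mu_{\boldsymbol X}^{\otimes2}\rangle]$ for $\nu^N\in\mathcal P_2(\mathcal X^N)$. A kernel $U$ of quadratic growth is positive if $\langle U,(\nu-\nu')^{\otimes2}\rangle\ge0$ for all $\nu,\nu'\in\mathcal P_2(\mathcal X)$. Double oscillation: $\mathrm{Osc}_2U=\sup_{x,y,z,w}\langle U,(\delta_x-\delta_y)\otimes(\delta_z-\delta_w)\rangle$. $W$ is $(M_W,L_W)$-decomposable if $W=W^+-W^-$ with $W^\pm$ positive symmetric kernels of quadratic growth such that: if $\mathcal X=\mathbb T^d$, $\mathrm{Osc}_2W^++\mathrm{Osc}_2W^-\le4M_W$ and $L_W=0$; if $\mathcal X=\mathbb R^d$, $W^s=W^s_{b}+W^s_{q}$ for $s=+,-$ with symmetric kernels satisfying $\mathrm{Osc}_2W_b^++\mathrm{Osc}_2W_b^-\le4M_W$ and $\|\nabla^2_{1,2}W_q^+\|_{L^\infty}+\|\nabla^2_{1,2}W_q^-\|_{L^\infty}\le L_W$ ($\nabla_{1,2}^2$ is the mixed second derivative matrix, measured in operator norm). $m$ satisfies a $\rho$-Talagrand inequality if $H(\nu|m)\ge\frac\rho2\mathcal W_2^2(\nu,m)$ for all $\nu\in\mathcal P_2(\mathcal X)$, with $\mathcal W_2$ the quadratic Wasserstein distance. *)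

(* Defs.v *)
From HB Require Import structures.
From mathcomp Require Import all_boot all_order all_algebra generic_quotient.
From mathcomp Require Import archimedean.
From mathcomp Require Import all_classical all_reals all_analysis.

Set Implicit Arguments.
Unset Strict Implicit.
Unset Printing Implicit Defensive.

Import Order.TTheory GRing.Theory Num.Theory.
Import numFieldNormedType.Exports.

Local Open Scope classical_set_scope.
Local Open Scope ring_scope.

Section circle.
Context (R : realType).

Definition int_congr (s t : R) : bool := (s - t) \is a Num.int.

Lemma int_congr_refl : reflexive int_congr.
Proof. by move=> s; rewrite /int_congr subrr rpred0. Qed.

Lemma int_congr_sym : symmetric int_congr.
Proof. by move=> s t; rewrite /int_congr -opprB rpredN. Qed.

Lemma int_congr_trans : transitive int_congr.
Proof.
move=> t s u; rewrite /int_congr => hst htu.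
by rewrite -(subrK t s) -addrA rpredD.
Qed.

Canonical int_congr_equiv :=
  EquivRel int_congr int_congr_refl int_congr_sym int_congr_trans.

(* R / Z *)
Definition circle : Type := {eq_quot int_congr_equiv}%qT.

HB.instance Definition _ := Quotient.on circle.
HB.instance Definition _ := Choice.on circle.

Definition circle_proj (s : R) : circle := \pi_circle%qT s.

HB.instance Definition _ := isPointed.Build circle (circle_proj 0).

(* The sigma-algebra that makes the projection a quotient map; it coincides
   with the Borel sigma-algebra of the quotient topology, because the
   fractional part is a Borel section of the projection. *)
Definition circle_measurable : set (set circle) :=
  [set A | measurable (circle_proj @^-1` A)].

Let circle_measurable0 : circle_measurable set0.
Proof. by rewrite /circle_measurable /= preimage_set0. Qed.

Let circle_measurableC A : circle_measurable A -> circle_measurable (~` A).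
Proof. by rewrite /circle_measurable /= preimage_setC; exact: measurableC. Qed.

Let circle_measurable_bigcup (F : (set circle)^nat) :
  (forall i, circle_measurable (F i)) -> circle_measurable (\bigcup_i F i).
Proof.
by rewrite /circle_measurable /= preimage_bigcup; exact: bigcupT_measurable.
Qed.

HB.instance Definition _ := @isMeasurable.Build default_measure_display circle
  circle_measurable circle_measurable0 circle_measurableC
  circle_measurable_bigcup.

Definition circle_lebesgue (A : set circle) : \bar R :=
  lebesgue_measure (circle_proj @^-1` A `&` `[0, 1[).

Let circle_lebesgue0 : circle_lebesgue set0 = 0%E.
Proof. by rewrite /circle_lebesgue preimage_set0 set0I measure0. Qed.

Let circle_lebesgue_ge0 A : (0 <= circle_lebesgue A)%E.
Proof. exact: measure_ge0. Qed.

Let circle_lebesgue_semi_sigma_additive : semi_sigma_additive circle_lebesgue.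
Proof.
move=> F mF tF mUF; rewrite /circle_lebesgue preimage_bigcup.
apply: (@measure_semi_sigma_additive _ _ _
  (mrestr lebesgue_measure (measurable_itv `[0%R, 1%R[)) (fun i => circle_proj @^-1` F i)).
- exact: mF.
- apply/trivIsetP => i j _ _ ij; rewrite -preimage_setI.
  by move/trivIsetP : tF => /(_ _ _ _ _ ij) ->//; rewrite preimage_set0.
- by rewrite -preimage_bigcup; exact: mUF.
Qed.

HB.instance Definition _ := isMeasure.Build _ _ _ circle_lebesgue
  circle_lebesgue0 circle_lebesgue_ge0 circle_lebesgue_semi_sigma_additive.

Let circle_lebesgue_setT : circle_lebesgue setT = 1%E.
Proof.
rewrite /circle_lebesgue preimage_setT setTI.
have := @lebesgue_measure_itv R `[0, 1[%R.
by rewrite /= lte_fin ltr01 oppr0 adde0 => ->.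
Qed.

HB.instance Definition _ :=
  Measure_isProbability.Build _ _ _ circle_lebesgue circle_lebesgue_setT.

End circle.

Section line.
Context (R : realType).

(* [lebesgue_measure] with R carrying its default display, which differs from
   that of [measurableTypeR R] although the measurable sets are the same. *)
Definition line_lebesgue : set R -> \bar R := @lebesgue_measure R.

Let line_lebesgue0 : line_lebesgue set0 = 0%E.
Proof. exact: measure0. Qed.

Let line_lebesgue_ge0 A : (0 <= line_lebesgue A)%E.
Proof. exact: measure_ge0. Qed.

Let line_lebesgue_semi_sigma_additive : semi_sigma_additive line_lebesgue.
Proof. exact: (@measure_semi_sigma_additive _ _ _ (@lebesgue_measure R)). Qed.

HB.instance Definition _ := isMeasure.Build _ _ _ line_lebesgue
  line_lebesgue0 line_lebesgue_ge0 line_lebesgue_semi_sigma_additive.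

Let line_lebesgue_sigma_finite : sigma_finite setT line_lebesgue.
Proof. exact: (sigma_finiteT (@lebesgue_measure R)). Qed.

HB.instance Definition _ := Measure_isSigmaFinite.Build _ _ _ line_lebesgue
  line_lebesgue_sigma_finite.

End line.

Section tuple_power.
Context d (T : measurableType d) (R : realType).
Variable m : {sigma_finite_measure set T -> \bar R}.
Local Open Scope ereal_scope.

Definition tuple_cons n (p : T * n.-tuple T) : n.+1.-tuple T :=
  [tuple of p.1 :: p.2].

Lemma measurable_tuple_cons n : measurable_fun setT (@tuple_cons n).
Proof. exact: (measurable_cons measurable_fst measurable_snd). Qed.

Section step.
Context n (P : {sigma_finite_measure set (n.-tuple T) -> \bar R}).

Definition tuple_power_step : set (n.+1.-tuple T) -> \bar R :=
  pushforward (m \x P) (@tuple_cons n).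

Let step0 : tuple_power_step set0 = 0.
Proof. by rewrite /tuple_power_step /pushforward preimage_set0 measure0. Qed.

Let step_ge0 A : 0 <= tuple_power_step A.
Proof. exact: (measure_ge0 (m \x P)). Qed.

Let step_semi_sigma_additive : semi_sigma_additive tuple_power_step.
Proof.
have mc A : measurable A -> measurable (@tuple_cons n @^-1` A).
  by move=> mA; rewrite -[X in measurable X]setTI; exact: measurable_tuple_cons.
move=> F mF tF mUF; rewrite /tuple_power_step /pushforward preimage_bigcup.
apply: (@measure_semi_sigma_additive _ _ _ (m \x P)
  (fun i => @tuple_cons n @^-1` F i)).
- by move=> i; exact: mc.
- apply/trivIsetP => i j _ _ ij; rewrite -preimage_setI.
  by move/trivIsetP : tF => /(_ _ _ _ _ ij) ->//; rewrite preimage_set0.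
- by rewrite -preimage_bigcup; exact: mc.
Qed.

HB.instance Definition _ := isMeasure.Build _ _ _ tuple_power_step
  step0 step_ge0 step_semi_sigma_additive.

(* Only the probability instance of [m \x P] is canonical in the library. *)
Let step_sigma_finite : sigma_finite setT tuple_power_step.
Proof.
have /sigma_finiteP[F [TF ndF Foo]] := sigma_finiteT m.
have /sigma_finiteP[G [TG ndG Goo]] := sigma_finiteT P.
pose S i := [set t : n.+1.-tuple T | F i (thead t)] `&`
            [set t : n.+1.-tuple T | G i [tuple of behead t]].
have SE i : @tuple_cons n @^-1` S i = F i `*` G i.
  have bK (x : T) (t : n.-tuple T) :
      [tuple of behead [tuple of x :: t]] = t by exact/val_inj.
  by apply/seteqP; split=> -[x t]; rewrite /S /= theadE bK.
exists S => [|i].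
  rewrite predeqE => t; split=> // _.
  have [a _ Fa] : (\bigcup_i F i) (thead t) by rewrite -TF.
  have [b _ Gb] : (\bigcup_i G i) [tuple of behead t] by rewrite -TG.
  exists (maxn a b) => //; split => /=.
    by move: Fa; exact/subsetPset/ndF/leq_maxl.
  by move: Gb; exact/subsetPset/ndG/leq_maxr.
have [mFi Fioo] := Foo i; have [mGi Gioo] := Goo i; split.
  apply: measurableI.
    rewrite -[X in measurable X]setTI.
    exact: (@measurable_tnth _ T n.+1 ord0 measurableT).
  rewrite -[X in measurable X]setTI.
  exact: (@measurable_behead _ T n measurableT).
rewrite /tuple_power_step /pushforward SE product_measure1E//.
by rewrite lte_mul_pinfty// ge0_fin_numE.
Qed.

HB.instance Definition _ := Measure_isSigmaFinite.Build _ _ _ tuple_power_step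
  step_sigma_finite.
End step.

Fixpoint tuple_power n : {sigma_finite_measure set (n.-tuple T) -> \bar R} :=
  match n with
  | 0 => \d_[tuple]
  | n'.+1 => tuple_power_step (tuple_power n')
  end.

Lemma tuple_power_box n (A : 'I_n -> set T) :
  (forall i, measurable (A i)) ->
  tuple_power n [set t | forall i, A i (tnth t i)] = \prod_(i < n) m (A i).
Proof.
elim: n A => [|n IH] A mA.
  rewrite big_ord0 /= diracE mem_set//.
  by case.
rewrite big_ord_recl /= /tuple_power_step /pushforward.
rewrite (_ : _ @^-1` _ =
  A ord0 `*` [set t | forall i, A (lift ord0 i) (tnth t i)]).
  rewrite product_measure1E//; first by congr (_ * _); exact: IH.
  rewrite (_ : mkset _ =
    \bigcap_(i in [set: 'I_n]) ((fun t => tnth t i) @^-1` A (lift ord0 i))).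
    apply: fin_bigcap_measurable => // i _.
    by rewrite -[X in measurable X]setTI; exact: (measurable_tnth i).
  by apply/seteqP; split=> [t h i _|t h i]; [exact: h|exact: (h i)].
apply/seteqP; split=> [[x t] /= h|[x t] /= [h0 h] i].
  by split; [exact: (h ord0)|move=> i; have := h (lift ord0 i); rewrite tnthS].
by case: (unliftP ord0 i) => [j ->|->//]; rewrite tnthS.
Qed.

End tuple_power.

Section integration.
Context d (T : measurableType d) (R : realType).

Definition pairing (U : T -> T -> R) (mu nu : {finite_measure set T -> \bar R})
  : R := \int[(mu \x nu)%E]_p U p.1 p.2.

(* <U, (mu - nu)^{(x)2}> *)
Definition pairing_diff (U : T -> T -> R) (mu nu : probability T R) : R :=
  pairing U mu mu - pairing U mu nu - pairing U nu mu + pairing U nu nu.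

Section empirical.
Context n (x : n.-tuple T).

Definition empirical : set T -> \bar R :=
  mscale (n%:R^-1 : R)%:nng (msum (fun k => \d_(nth point x k)) n).

HB.instance Definition _ := Measure.on empirical.

Let empirical_finite : fin_num_fun empirical.
Proof.
move=> A mA; rewrite /empirical /mscale fin_numM// sum_fin_num.
by apply/allP => y /mapP[k _ ->]; rewrite /= fin_numE /dirac.
Qed.

HB.instance Definition _ :=
  Measure_isFinite.Build _ _ _ empirical empirical_finite.

End empirical.

Definition relative_entropy (nu : probability T R)
    (m : {sigma_finite_measure set T -> \bar R}) : \bar R :=
  if asbool (nu `<< m)
  then (\int[nu]_x lne (Radon_Nikodym (charge_of_finite_measure nu) m x))%E
  else +oo%E.

End integration.

Section smoothness.
Context (R : realType).

Definition class_C1 (E : normedModType R) (f : E -> R) : Prop :=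
  (forall a, differentiable f a) /\ (forall v, continuous ('D_v f)).

Definition class_C2 (E : normedModType R) (f : E -> R) : Prop :=
  class_C1 f /\ (forall v, class_C1 ('D_v f)).

Definition enorm n (v : 'rV[R]_n) : R := Num.sqrt (\sum_(i < n) v 0 i ^+ 2).

Definition operator_norm n (A : 'M[R]_n) : R :=
  sup [set enorm (v *m A^T) | v in [set v : 'rV[R]_n | enorm v <= 1]].

Definition basis_vec n (i : 'I_n) : 'rV[R]_n := delta_mx 0 i.

Section mixed_derivative.
Context n (U : 'rV[R]_n -> 'rV[R]_n -> R).

Definition grad1 (i : 'I_n) (u v : 'rV[R]_n) : R := 'D_(basis_vec i) (U ^~ v) u.

Definition mixed_differentiable : Prop :=
  (forall u v, differentiable (U ^~ v) u) /\
  (forall i u v, differentiable (grad1 i u) v).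

Definition mixed_hessian (u v : 'rV[R]_n) : 'M[R]_n :=
  \matrix_(i, j) 'D_(basis_vec j) (grad1 i u) v.

(* A supremum over all points, the derivative being defined everywhere; for a
   continuous derivative this is the essential supremum. *)
Definition mixed_hessian_Linf : \bar R :=
  ereal_sup [set (operator_norm (mixed_hessian p.1 p.2))%:E
            | p in [set: 'rV[R]_n * 'rV[R]_n]].

End mixed_derivative.
End smoothness.

Inductive geometry := Torus | Euclidean.

Section flat_space.
Context (R : realType).

Definition coord (g : geometry) : measurableType default_measure_display :=
  match g with
  | Torus => circle R
  | Euclidean => R
  end.

Definition coord_proj (g : geometry) : R -> coord g :=
  match g return R -> coord g with
  | Torus => @circle_proj R
  | Euclidean => id
  end.

Definition coord_lebesgue (g : geometry) :
    {sigma_finite_measure set (coord g) -> \bar R} :=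
  match g return {sigma_finite_measure set (coord g) -> \bar R} with
  | Torus => @circle_lebesgue R
  | Euclidean => @line_lebesgue R
  end.

(* The space (R / Z)^d or R^d. *)
Definition flat_space (g : geometry) (d : nat) :
  measurableType (measure_tuple_display default_measure_display) :=
  d.-tuple (coord g).

(* The universal covering map R^d -> flat_space; regularity of a function on
   the space is regularity of its lift. *)
Definition covering (g : geometry) (d : nat) (v : 'rV[R]_d) : flat_space g d :=
  [tuple coord_proj g (v 0 i) | i < d].
End flat_space.

Arguments covering {R} g {d} v.

Section setting.
Context (R : realType) (g : geometry) (d : nat).
Local Notation X := (flat_space R g d).

Definition lebesgue : {sigma_finite_measure set X -> \bar R} :=
  tuple_power (coord_lebesgue R g) d.

(* The quotient metric; for [Euclidean] both sets of lifts are singletons. *)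
Definition space_dist (x y : X) : R :=
  inf [set enorm (u - v) | u in covering g @^-1` [set x]
                         & v in covering g @^-1` [set y]].

Definition modulus (x : X) : R := space_dist x (covering g 0).

Definition P2 (nu : probability X R) : Prop :=
  (\int[nu]_x (modulus x ^+ 2)%:E < +oo)%E.

Definition P2N (N : nat) (nuN : probability (N.-tuple X) R) : Prop :=
  (\int[nuN]_x (\sum_(i < N) modulus (tnth x i) ^+ 2)%:E < +oo)%E.

(* Square of the quadratic Wasserstein distance. *)
Definition W2_square (mu nu : probability X R) : \bar R :=
  ereal_inf [set (\int[pi]_p (space_dist p.1 p.2 ^+ 2)%:E)%E
            | pi in [set pi : probability (X * X)%type R |
                (forall A, measurable A -> pi (A `*` setT) = mu A) /\
                (forall A, measurable A -> pi (setT `*` A) = nu A)]].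

Definition talagrand (rho : R) (m : probability X R) : Prop :=
  forall nu : probability X R, P2 nu ->
    ((rho / 2)%:E * W2_square nu m <= relative_entropy nu m)%E.

Definition C2_potential (V : X -> R) : Prop := class_C2 (V \o covering g).

Definition C2_kernel (U : X -> X -> R) : Prop :=
  class_C2 (fun p : 'rV[R]_d * 'rV[R]_d => U (covering g p.1) (covering g p.2)).

Definition is_kernel (U : X -> X -> R) : Prop :=
  measurable_fun setT (fun p : X * X => U p.1 p.2).

Definition symmetric_kernel (U : X -> X -> R) : Prop :=
  is_kernel U /\ forall x y, U x y = U y x.

(* On the torus [modulus] is bounded and this says that the kernel is bounded:
   automatic for a continuous kernel, and for a merely measurable one exactly
   what makes its pairings with all probability measures meaningful. *)
Definition quadratic_growth (U : X -> X -> R) : Prop :=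
  exists C : R, forall x y,
    `|U x y| <= C * (1 + modulus x ^+ 2 + modulus y ^+ 2).

Definition positive_kernel (U : X -> X -> R) : Prop :=
  forall nu nu' : probability X R, P2 nu -> P2 nu' -> 0 <= pairing_diff U nu nu'.

Definition Osc2 (U : X -> X -> R) : \bar R :=
  ereal_sup [set r | exists x y z w,
    r = (U x z - U x w - U y z + U y w)%:E].

Definition lifted (U : X -> X -> R) (u v : 'rV[R]_d) : R :=
  U (covering g u) (covering g v).

Definition decomposable (M L : R) (W : X -> X -> R) : Prop :=
  exists Wp Wm : X -> X -> R,
  [/\ forall x y, W x y = Wp x y - Wm x y,
      [/\ symmetric_kernel Wp, quadratic_growth Wp & positive_kernel Wp],
      [/\ symmetric_kernel Wm, quadratic_growth Wm & positive_kernel Wm] &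
      match g with
      | Torus => (Osc2 Wp + Osc2 Wm <= (4 * M)%:E)%E /\ L = 0
      | Euclidean =>
          exists Wpb Wpq Wmb Wmq : X -> X -> R,
          [/\ (forall x y, Wp x y = Wpb x y + Wpq x y) /\
              (forall x y, Wm x y = Wmb x y + Wmq x y),
              [/\ symmetric_kernel Wpb, symmetric_kernel Wpq,
                  symmetric_kernel Wmb & symmetric_kernel Wmq],
              (Osc2 Wpb + Osc2 Wmb <= (4 * M)%:E)%E,
              mixed_differentiable (lifted Wpq) /\
              mixed_differentiable (lifted Wmq) &
              (mixed_hessian_Linf (lifted Wpq) + mixed_hessian_Linf (lifted Wmq)
                <= L%:E)%E]
      end].

Definition gibbs_density (V : X -> R) (W : X -> X -> R) (nu : probability X R)
  (x : X) : R := expR (- V x - \int[nu]_y W x y).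

Definition gibbs_mass (V : X -> R) (W : X -> X -> R) (nu : probability X R) :
  \bar R := (\int[lebesgue]_x (gibbs_density V W nu x)%:E)%E.

Definition normalizable (V : X -> R) (W : X -> X -> R) : Prop :=
  forall nu : probability X R, P2 nu -> (0 < gibbs_mass V W nu < +oo)%E.

(* Pi[nu] *)
Definition gibbs (V : X -> R) (W : X -> X -> R) (nu : probability X R)
  (A : set X) : \bar R :=
  ((fine (gibbs_mass V W nu))^-1%:E *
   \int[lebesgue]_(x in A) (gibbs_density V W nu x)%:E)%E.

Definition reduced_kernel (W : X -> X -> R) (m : probability X R) (x y : X) :
  R :=
  W x y - \int[m]_y' W x y' - \int[m]_x' W x' y + pairing W m m.

Definition free_energy (W : X -> X -> R) (m nu : probability X R) : \bar R :=
  (relative_entropy nu m +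
   (2^-1 * pairing (reduced_kernel W m) nu nu)%:E)%E.

Definition free_energyN (N : nat) (W : X -> X -> R) (m : probability X R)
  (nuN : probability (N.-tuple X) R) : \bar R :=
  (relative_entropy nuN (tuple_power m N) +
   (N%:R / 2 *
    \int[nuN]_x pairing (reduced_kernel W m) (empirical R x) (empirical R x))%:E)%E.

End setting.

(* Main.v *)
(* Condition every particle on the particles that follow it. By the chain rule
   the relative entropies of these conditional laws add up to that of nu^N, so by
   convexity their (random) average nubar satisfies N H(nubar | m) <= sum of the
   conditional entropies, and the mean-field hypothesis applies to nubar. The
   measure N (mu_x - nubar) is a sum of martingale differences with values in the
   Hilbert space of the positive kernel K = W_*^+ + W_*^-; its expected squared
   norm is therefore the sum of the conditional variances, with no cross terms.
   Passing from mu_x to nubar in the energy costs, by Cauchy-Schwarz with a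
   parameter eta, this variance and eta times <K, (nubar - m)^2>.
   Both quantities are controlled on the pieces of W^+ + W^-. The bounded piece
   uses Pinsker's inequality. The piece with bounded mixed Hessian uses the
   duality between Lipschitz functions and transport: Talagrand's inequality
   bounds transport by entropy and, tested on small perturbations of m, gives
   Var_m(x_i) <= 2 / rho. Hence <K, (nu - m)^2> <= 2 (M_W + l_W) H(nu | m), and
   eta = eps delta / (M_W + l_W) yields the constants. *)

Require Import Defs.
From HB Require Import structures.
From mathcomp Require Import all_boot all_order all_algebra.
From mathcomp Require Import ring lra.
From mathcomp Require Import all_classical all_reals all_analysis.
From mathcomp Require Import measurable_realfun.

Set Implicit Arguments.
Unset Strict Implicit.
Unset Printing Implicit Defensive.

Import Order.TTheory GRing.Theory Num.Theory.
Import numFieldNormedType.Exports.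

Local Open Scope classical_set_scope.
Local Open Scope ring_scope.

(** * Entropy and densities *)

(** Two obstacles shape the argument. Positivity is assumed only on differences of probability
    measures, whereas Cauchy-Schwarz tests the forms on combinations of atoms and a density whose
    mass is not zero. Reduction closes this gap: the reduced kernel annihilates [m], so a suitable
    multiple of [m] may be added to any such measure to make its mass zero. Moreover, positivity and
    regularity live on different decompositions: the bounded and the quadratic pieces are neither
    positive nor of controlled growth. Positivity is therefore used for the whole kernels, and the
    pieces enter only through their rectangles, which reduction preserves. No Hilbert space is
    built: orthogonality of the increments is a cross term with zero mean in an explicit quadratic
    form. Constants: a rectangle of the bounded piece is at most [4 M], and Pinsker's factor [H / 2]
    turns it into [2 M H]; Talagrand gives [L * (2 H / rho)]. The variance is at most
    [4 M + L * (4 H / rho + 2 * (2 d / rho))], and the normalization [1 / (2 N)] of the energy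
    halves these fours. *)

Section psi.
Context {R : realType}.
Implicit Types u v a : R.

(* Subtracting [u - 1] from [u ln u] changes no entropy of a probability density
   and makes the integrand nonnegative, so that Tonelli applies. *)
Definition psi u : R := u * ln u - u + 1.

(** Supporting line of the convex function [psi] at [v], where its slope is [ln v]; it reduces to
    [ln s <= s - 1] at [s = v / u]. *)
Lemma psi_tangent u v : 0 <= u -> 0 < v -> psi v + ln v * (u - v) <= psi u.
Proof.
rewrite le_eqVlt => /predU1P[<-|u0] v0.
  by rewrite /psi !mul0r; lra.
have h : ln (v / u) <= v / u - 1.
  have := @le_ln1Dx R (v / u - 1); rewrite subrKC; apply.
  by rewrite ltrBDr addNr divr_gt0.
rewrite ln_div ?posrE// in h.
have {h} : u * (ln v - ln u) <= v - u.
  have -> : v - u = u * (v / u - 1) by field; rewrite gt_eqF.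
  by rewrite ler_pM2l.
by rewrite /psi; lra.
Qed.

Lemma psi1 : psi 1 = 0.
Proof. by rewrite /psi ln1 mulr0 add0r addNr. Qed.

Lemma psi_ge0 u : 0 <= u -> 0 <= psi u.
Proof.
move=> u0; have := psi_tangent u0 (@ltr01 R).
by rewrite psi1 ln1 mul0r addr0.
Qed.

(** Pointwise form of the entropy chain rule: with [a] a marginal and [u] a conditional density of
    integral 1, the affine remainder integrates to [psi a]. *)
Lemma psi_scale a u : 0 < a -> 0 <= u ->
  psi (a * u) = a * psi u + (u * (a * ln a) - a + 1).
Proof.
move=> a0; rewrite le_eqVlt => /predU1P[<-|u0].
  by rewrite /psi !(mulr0, mul0r); lra.
by rewrite /psi lnM ?posrE//; lra.
Qed.

Lemma psi_le_sqr u : 0 <= u -> psi u <= (u - 1) ^+ 2.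
Proof.
rewrite le_eqVlt => /predU1P[<-|u0].
  by rewrite /psi !mul0r; lra.
have h : ln u <= u - 1.
  have := @le_ln1Dx R (u - 1); rewrite subrKC; apply.
  by rewrite ltrBDr addNr.
by rewrite /psi; nra.
Qed.

(** Convexity for a running average: the supporting lines at the new mean are used for [u] with
    weight 1 and for [v / n] with weight [n], and their linear parts cancel. For [n = 0] the
    quotient [v / n] is 0 whatever [v] is, so [v = 0] has to be imposed. *)
Lemma psi_mean n u v : 0 <= u -> 0 <= v -> (n = 0%N -> v = 0) ->
  n.+1%:R * psi ((u + v) / n.+1%:R) <= psi u + n%:R * psi (v / n%:R).
Proof.
move=> u0 v0 n0.
(* At mean 0 there is no supporting line, but [u] and [v] both vanish and the two sides agree. *)
have [uv0|uvn0] := eqVneq (u + v) 0.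
  have -> : u = 0 by lra.
  have -> : v = 0 by lra.
  by rewrite addr0 !mul0r /psi !mul0r subr0 add0r !mulr1 -natr1 addrC.
have c0 : 0 < (u + v) / n.+1%:R by rewrite divr_gt0// lt0r uvn0 addr_ge0.
set c := (u + v) / _ in c0 *.
have hu := psi_tangent u0 c0.
have hv : n%:R * (psi c) + ln c * (v - n%:R * c) <= n%:R * psi (v / n%:R).
  case: n n0 @c c0 {hu} => [|n] n0 c c0; first by rewrite n0// !mul0r subr0 mulr0 addr0.
  have := psi_tangent (divr_ge0 v0 (ler0n R n.+1)) c0.
  rewrite -(ler_pM2l (ltr0Sn R n)); apply: le_trans.
  rewrite le_eqVlt; apply/orP; left; apply/eqP; field.
  by rewrite ?natr1 ?nat1r pnatr_eq0.
have cE : u + v = n%:R * c + c.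
  have -> : n%:R * c + c = n.+1%:R * c by rewrite -natr1 mulrDl mul1r.
  by rewrite /c mulrC divfK// pnatr_eq0.
clearbody c.
have e : ln c * (u - c) + ln c * (v - n%:R * c) = 0.
  rewrite -mulrDr; have -> : u - c + (v - n%:R * c) = 0 by clear -cE; lra.
  by rewrite mulr0.
rewrite -natr1 mulrDl mul1r; lra.
Qed.

(** Pointwise source of Pinsker's inequality with its sharp constant: the weight [(2 * u + 4) / 3]
    has integral 2 when [u] is a probability density, so Cauchy-Schwarz bounds the square of the
    integral of [|u - 1|] by twice the entropy. *)
Lemma psi_quadratic u : 0 <= u -> 3 * (u - 1) ^+ 2 <= (2 * u + 4) * psi u.
Proof.
rewrite le_eqVlt => /predU1P[<-|u0].
  by rewrite /psi !mul0r; lra.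
(* the value of [ln t] that would make the claim an equality at [t] *)
pose r (t : R) := (t - 1) * (5 * t + 1) / (2 * t * (t + 2)).
pose D (t : R) := ln t - r t.
have dD (t : R) : 0 < t ->
    is_derive t (1 : R) D ((t - 1) ^+ 3 / (t * (t + 2)) ^+ 2).
  move=> t0.
  have n0 : 2 * t * (t + 2) != 0 by rewrite gt_eqF// mulr_gt0//; nra.
  have dl := is_derive1_ln t0.
  rewrite /D /r; apply: is_derive_eq => /=.
  rewrite !scaler1 /GRing.scale/=; field.
  by rewrite !gt_eqF//; nra.
have D1 : D 1 = 0 by rewrite /D /r ln1 subrr !mul0r subrr.
have itvl (a b t : R) : t \in `]a, b[ -> a < t by rewrite in_itv => /andP[].
have cD a b : 0 < a -> {within `[a, b], continuous D}.
  move=> a0; apply: derivable_within_continuous => t; rewrite in_itv/= => /andP[ta _].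
  by have [] := dD t (lt_le_trans a0 ta).
suff Du : 0 <= D u.
  have -> : (2 * u + 4) * psi u = 3 * (u - 1) ^+ 2 + (2 * u + 4) * u * D u.
    rewrite /psi /D /r; field.
    by rewrite !gt_eqF//; nra.
  by rewrite lerDl !mulr_ge0//; nra.
(* The derivative of [D] has the sign of [t - 1], so [D] is minimal at 1, where it vanishes. *)
have [u1|u1|->] := ltgtP u 1; last by rewrite D1.
  have [t ut] := MVT u1 (fun t ut => dD t (lt_trans u0 (itvl _ _ _ ut))) (cD _ _ u0).
  rewrite D1 sub0r => /eqP; rewrite eqr_oppLR => /eqP ->.
  have t1 : t < 1 by rewrite (itvP ut).
  have t0 : 0 < t by rewrite (lt_trans u0)// (itvP ut).
  rewrite -mulNr mulr_ge0//; last by lra.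
  rewrite -mulNr mulr_ge0// ?invr_ge0 ?sqr_ge0//.
  rewrite (_ : - (t - 1) ^+ 3 = (1 - t) ^+ 3); last by ring.
  by rewrite exprn_ge0//; lra.
have [t ut] := MVT u1 (fun t ut => dD t (lt_trans ltr01 (itvl _ _ _ ut))) (cD _ _ ltr01).
rewrite D1 subr0 => ->.
have t1 : 1 < t by rewrite (itvP ut).
rewrite mulr_ge0//; last by lra.
by rewrite mulr_ge0 ?invr_ge0 ?sqr_ge0// exprn_ge0//; lra.
Qed.

(* The quadratic bound combined with AM-GM; optimizing over [l] after
   integration yields Pinsker's inequality. *)
Lemma psi_pinsker l u : 0 < l -> 0 <= u ->
  `|u - 1| <= l * ((u + 2) / 3) + psi u / (2 * l).
Proof.
move=> l0 u0; have h := psi_quadratic u0; have p0 := psi_ge0 u0.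
have c0 : 0 < (u + 2) / 3 by rewrite divr_gt0//; lra.
have p : psi u >= (u - 1) ^+ 2 / (2 * ((u + 2) / 3)).
  by rewrite ler_pdivrMr; [lra|nra].
have p' : psi u / (2 * l) >= (u - 1) ^+ 2 / (4 * l * ((u + 2) / 3)).
  have -> : (u - 1) ^+ 2 / (4 * l * ((u + 2) / 3)) =
      (u - 1) ^+ 2 / (2 * ((u + 2) / 3)) / (2 * l).
    by field; rewrite !gt_eqF//; lra.
  by rewrite ler_pM2r// invr_gt0; lra.
apply: (@le_trans _ _ (l * ((u + 2) / 3) + (u - 1) ^+ 2 / (4 * l * ((u + 2) / 3))));
  last by rewrite lerD2l.
set c := (u + 2) / 3 in c0 *.
rewrite -[(u - 1) ^+ 2]real_normK ?num_real//; set x := `|u - 1|.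
rewrite -subr_ge0.
have -> : l * c + x ^+ 2 / (4 * l * c) - x = (x - 2 * l * c) ^+ 2 / (4 * l * c).
  by field; rewrite !gt_eqF//; lra.
by rewrite divr_ge0 ?sqr_ge0// !mulr_ge0//; lra.
Qed.

Lemma measurable_psi : measurable_fun [set: R] psi.
Proof.
apply: measurable_funD => //; apply: measurable_funB => //.
exact: measurable_funM.
Qed.

End psi.

(** * Real-valued integrals and their measurability in a parameter *)

Section integration.
Context {d} {T : measurableType d} {R : realType}.
Implicit Types (mu : {measure set T -> \bar R}) (P : probability T R).

Lemma integrableP_norm mu (f : T -> R) : measurable_fun setT f ->
  (\int[mu]_x (`|f x|)%:E < +oo)%E -> mu.-integrable setT (EFin \o f).
Proof. by move=> mf h; apply/integrableP; split => //; exact/measurable_EFinP. Qed.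

Lemma integrable_dominated mu (f g : T -> R) : measurable_fun setT f ->
  (forall x, `|f x| <= g x) -> mu.-integrable setT (EFin \o g) ->
  mu.-integrable setT (EFin \o f).
Proof.
move=> mf fg ig; apply: (le_integrable measurableT _ _ ig).
  exact/measurable_EFinP.
by move=> x _ /=; rewrite lee_fin (le_trans (fg x))// ler_norm.
Qed.

Lemma integrable_measurable mu (f : T -> R) :
  mu.-integrable setT (EFin \o f) -> measurable_fun setT f.
Proof. by move/measurable_int/measurable_EFinP. Qed.

Lemma integral_EFin mu (f : T -> R) : mu.-integrable setT (EFin \o f) ->
  (\int[mu]_x (f x)%:E = (\int[mu]_x f x)%:E)%E.
Proof. by move=> fi; rewrite /Rintegral fineK//; exact: integrable_fin_num. Qed.

Lemma Rintegral_cst_prob P (c : R) : \int[P]_x c = c.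
Proof. have e : P setT = 1%E by exact: probability_setT.
by rewrite Rintegral_cst// [X in fine X]e mulr1. Qed.

Lemma Rintegral_sum mu n (f : 'I_n -> T -> R) :
  (forall i, mu.-integrable setT (EFin \o f i)) ->
  \int[mu]_x (\sum_(i < n) f i x) = \sum_(i < n) \int[mu]_x f i x.
Proof.
move=> fi; rewrite /Rintegral.
under eq_integral do rewrite -sumEFin.
rewrite integral_sum//.
by under eq_bigr do rewrite integral_EFin//; rewrite sumEFin.
Qed.

Lemma integrable_Rsum mu n (f : 'I_n -> T -> R) :
  (forall i, mu.-integrable setT (EFin \o f i)) ->
  mu.-integrable setT (EFin \o (fun x => \sum_(i < n) f i x)).
Proof.
move=> fi; rewrite (_ : _ \o _ = fun x => (\sum_(i < n) (f i x)%:E)%E).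
  by apply: integrable_sum => // i _; exact: fi.
by apply/funext => x /=; rewrite sumEFin.
Qed.

Lemma integrable_D mu (f g : T -> R) : mu.-integrable setT (EFin \o f) ->
  mu.-integrable setT (EFin \o g) ->
  mu.-integrable setT (EFin \o (fun x => f x + g x)).
Proof. by move=> fi gi; have := integrableD measurableT fi gi. Qed.

Lemma integrable_B mu (f g : T -> R) : mu.-integrable setT (EFin \o f) ->
  mu.-integrable setT (EFin \o g) ->
  mu.-integrable setT (EFin \o (fun x => f x - g x)).
Proof. by move=> fi gi; have := integrableB measurableT fi gi. Qed.

Lemma integrable_Z mu c (f : T -> R) : mu.-integrable setT (EFin \o f) ->
  mu.-integrable setT (EFin \o (fun x => c * f x)).
Proof. by move=> fi; have := integrableZl measurableT c fi. Qed.

Lemma integrable_cst P (c : R) : P.-integrable setT (EFin \o cst c).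
Proof. by apply: finite_measure_integrable_cst. Qed.

Lemma integrable_abs mu (f : T -> R) : mu.-integrable setT (EFin \o f) ->
  mu.-integrable setT (EFin \o (fun x => `|f x|)).
Proof. by move=> fi; have := integrable_abse fi. Qed.

(** Holds without integrability, since the integral is this difference by definition; identities
    proved for nonnegative functions pass through it to signed ones. *)
Lemma integral_signed mu (k : T -> R) :
  (\int[mu]_x (k x)%:E =
   \int[mu]_x (Num.max (k x) 0)%:E - \int[mu]_x (Num.max (- k x) 0)%:E)%E.
Proof.
rewrite integralE; congr (_ - _)%E; apply: eq_integral => x _.
  by rewrite funeposE/= EFin_max.
by rewrite funenegE/= EFin_max.
Qed.

End integration.

Section parametric.
Context {d1 d2} {S : measurableType d1} {T : measurableType d2} {R : realType}.
Variable P : {sigma_finite_measure set T -> \bar R}.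

(** Tonelli treats the two parts separately, and [fine] keeps the result measurable even where the
    integrals diverge, so no integrability in [y] has to be tracked. *)
Lemma measurable_Rintegral (F : S -> T -> R) :
  measurable_fun setT (fun p : S * T => F p.1 p.2) ->
  measurable_fun setT (fun s => \int[P]_y F s y).
Proof.
move=> mF; apply: measurableT_comp => //.
under eq_fun do rewrite integral_signed.
apply: emeasurable_funB.
- apply: (@measurable_fun_fubini_tonelli_F _ _ _ _ _ P
    (fun p : S * T => (Num.max (F p.1 p.2) 0)%:E)).
    apply/measurable_EFinP; exact: measurable_maxr.
  by move=> x; rewrite lee_fin le_max lexx orbT.
- apply: (@measurable_fun_fubini_tonelli_F _ _ _ _ _ P
    (fun p : S * T => (Num.max (- F p.1 p.2) 0)%:E)).
    by apply/measurable_EFinP; apply: measurable_maxr => //; exact: measurableT_comp.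
  by move=> x; rewrite lee_fin le_max lexx orbT.
Qed.

Lemma measurable_pairl (F : S -> T -> R) x :
  measurable_fun setT (fun p : S * T => F p.1 p.2) -> measurable_fun setT (F x).
Proof. by move=> mF; exact: (measurableT_comp mF (measurable_pair1 x)). Qed.

Lemma measurable_pairr (F : S -> T -> R) y :
  measurable_fun setT (fun p : S * T => F p.1 p.2) -> measurable_fun setT (F ^~ y).
Proof. by move=> mF; exact: (measurableT_comp mF (measurable_pair2 y)). Qed.

End parametric.

(** * Measures given by a density and by atoms *)

Section density.
Context {d} {T : measurableType d} {R : realType}.
Variables (nu : {finite_measure set T -> \bar R})
  (P : {sigma_finite_measure set T -> \bar R}) (g : T -> R).
Hypotheses (mg : measurable_fun setT g) (g0 : forall x, 0 <= g x).
Hypothesis nuE : forall A, measurable A -> nu A = (\int[P]_(x in A) (g x)%:E)%E.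

Lemma density_dominates : nu `<< P.
Proof.
apply/null_content_dominatesP => A mA PA0; rewrite nuE//.
by rewrite null_set_integral//; apply: measurable_funTS; exact/measurable_EFinP.
Qed.

Lemma density_integrable : P.-integrable setT (EFin \o g).
Proof.
apply/integrableP; split; first exact/measurable_EFinP.
rewrite (eq_integral (fun x => (g x)%:E)); last first.
  by move=> x _ /=; rewrite ger0_norm.
by rewrite -nuE// -ge0_fin_numE// fin_num_measure.
Qed.

Lemma Radon_Nikodym_density :
  ae_eq P setT (Radon_Nikodym (charge_of_finite_measure nu) P) (EFin \o g).
Proof.
have dom := density_dominates.
apply: integral_ae_eq => //.
- exact: Radon_Nikodym_integrable.
- exact/measurable_EFinP.
- move=> A _ mA; rewrite -Radon_Nikodym_integral//; exact: nuE.
Qed.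

Lemma ge0_integral_density (k : T -> \bar R) : measurable_fun setT k ->
  (forall x, 0 <= k x)%E ->
  (\int[nu]_x k x = \int[P]_x (k x * (g x)%:E))%E.
Proof.
move=> mk k0.
rewrite -(Radon_Nikodym_SigmaFinite.change_of_variables density_dominates)//.
apply: ae_eq_integral => //.
- apply: emeasurable_funM => //; apply: measurable_int.
  exact: (Radon_Nikodym_SigmaFinite.f_integrable density_dominates).
- by apply: emeasurable_funM => //; exact/measurable_EFinP.
- apply: ae_eqe_mul2l; apply: ae_eq_trans Radon_Nikodym_density.
  exact: (ae_eq_Radon_Nikodym_SigmaFinite density_dominates).
Qed.

Lemma integral_density (k : T -> R) : measurable_fun setT k ->
  (\int[nu]_x (k x)%:E = \int[P]_x (k x * g x)%:E)%E.
Proof.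
move=> mk; rewrite [LHS]integral_signed [RHS]integral_signed.
rewrite ge0_integral_density; last 2 first.
- by apply/measurable_EFinP; exact: measurable_maxr.
- by move=> x; rewrite lee_fin le_max lexx orbT.
rewrite ge0_integral_density; last 2 first.
- by apply/measurable_EFinP; apply: measurable_maxr => //; exact: measurableT_comp.
- by move=> x; rewrite lee_fin le_max lexx orbT.
by congr (_ - _)%E; apply: eq_integral => x _;
  rewrite -EFinM maxr_pMl// mul0r// mulNr.
Qed.

Lemma Rintegral_density (k : T -> R) : measurable_fun setT k ->
  \int[nu]_x k x = \int[P]_x (k x * g x).
Proof. by move=> mk; rewrite /Rintegral integral_density. Qed.

End density.

Section atoms_and_density.
Context {d} {T : measurableType d} {R : realType}.
Variable m : {measure set T -> \bar R}.

Section density_measure.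
Variable g : T -> R.

Definition density_measure of measurable_fun setT g & (forall x, 0 <= g x) :=
  fun A : set T => (\int[m]_(x in A) (g x)%:E)%E.

Hypotheses (mg : measurable_fun setT g) (g0 : forall x, 0 <= g x).
Local Notation D := (density_measure mg g0).

Let density0 : D set0 = 0%E.
Proof. exact: integral_set0. Qed.

Let density_ge0 A : (0 <= D A)%E.
Proof. by apply: integral_ge0 => x _; rewrite lee_fin. Qed.

Let density_semi_sigma_additive : semi_sigma_additive D.
Proof.
move=> F mF tF mUF; rewrite /density_measure ge0_integral_bigcup//.
- by apply: is_cvg_nneseries => n _ _; apply: integral_ge0 => x _; rewrite lee_fin.
- by apply: measurable_funTS; exact/measurable_EFinP.
- by move=> x _; rewrite lee_fin.
Qed.

HB.instance Definition _ := isMeasure.Build _ _ _ D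
  density0 density_ge0 density_semi_sigma_additive.

End density_measure.
End atoms_and_density.

Section atoms_and_density_probability.
Context {d} {T : measurableType d} {R : realType}.
Variable m : probability T R.

(** The measure [a \sum_i \delta_{t_i} + g m], encoded by its action on nonnegative functions, which
    is the form in which it is integrated later. *)
Definition atoms_density (nu : probability T R) (a : R) n (t : n.-tuple T)
    (g : T -> R) : Prop :=
  forall k : T -> \bar R, measurable_fun setT k -> (forall x, 0 <= k x)%E ->
  (\int[nu]_x k x =
   a%:E * \sum_(i < n) k (tnth t i) + \int[m]_x (k x * (g x)%:E))%E.

Lemma ge0_integral_density_measure (g : T -> R) (mg : measurable_fun setT g)
    (g0 : forall x, 0 <= g x) (k : T -> \bar R) :
  m.-integrable setT (EFin \o g) ->
  measurable_fun setT k -> (forall x, 0 <= k x)%E ->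
  (\int[density_measure m mg g0]_x k x = \int[m]_x (k x * (g x)%:E))%E.
Proof.
move=> gi mk k0.
have fin : fin_num_fun (density_measure m mg g0).
  move=> A mA; apply: integrable_fin_num => //.
  exact: integrableS gi.
pose F := Measure_isFinite.Build _ _ _ (density_measure m mg g0) fin.
pose D : {finite_measure set T -> \bar R} := HB.pack (density_measure m mg g0) F.
exact: (@ge0_integral_density _ _ _ D).
Qed.

Lemma atoms_density_exists a n (t : n.-tuple T) (g : T -> R) :
  0 <= a -> measurable_fun setT g -> (forall x, 0 <= g x) ->
  m.-integrable setT (EFin \o g) -> a * n%:R + \int[m]_x g x = 1 ->
  exists nu : probability T R, atoms_density nu a t g.
Proof.
move=> a0 mg g0 gi tot.
pose D := density_measure m mg g0.
pose A : {measure set T -> \bar R} :=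
  mscale (NngNum a0) (msum (fun k => \d_(nth point t k)) n).
pose mu : {measure set T -> \bar R} := measure_add A D.
have muE (k : T -> \bar R) : measurable_fun setT k -> (forall x, 0 <= k x)%E ->
    (\int[mu]_x k x =
     a%:E * \sum_(i < n) k (tnth t i) + \int[m]_x (k x * (g x)%:E))%E.
  move=> mk k0; rewrite ge0_integral_measure_add//; congr (_ + _)%E.
    rewrite ge0_integral_mscale// ge0_integral_measure_sum//=.
    congr (_ * _)%E; apply: eq_bigr => i _.
    by rewrite integral_dirac// diracT mul1e (tnth_nth point).
  exact: ge0_integral_density_measure.
have mu1 : mu setT = 1%E.
  rewrite -[LHS]mul1e -integral_cst// muE//.
  under [X in (_ + X)%E]eq_integral do rewrite mul1e.
  rewrite (integral_EFin gi) sumEFin -EFinM -EFinD.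
  by rewrite sumr_const card_ord tot.
(* [mu] has mass 1 only by a proof; normalizing packs it as a probability. The factor is [1^-1] and
   the default [m] is never selected. *)
exists (mnormalize mu m) => k mk k0.
rewrite -muE//; apply: eq_measure_integral => B mB _.
suff e : mnormalize mu m B = mu B by exact: e.
transitivity (mu B * (1^-1)%:E)%E; last by rewrite invr1 mule1.
by rewrite /mnormalize mu1 orbF onee_eq0.
Qed.

Section theory.
Variables (nu : probability T R) (a : R) (n : nat) (t : n.-tuple T) (g : T -> R).
Hypotheses (nuE : atoms_density nu a t g) (mg : measurable_fun setT g)
  (g0 : forall x, 0 <= g x).

Lemma atoms_density_integrable (k : T -> R) : measurable_fun setT k ->
  m.-integrable setT (EFin \o (fun x => k x * g x)) ->
  nu.-integrable setT (EFin \o k).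
Proof.
move=> mk kgi; apply: integrableP_norm => //.
rewrite nuE//; last by apply/measurable_EFinP; exact: measurableT_comp.
under eq_integral do rewrite -EFinM -[X in _ * X]ger0_norm// -normrM.
rewrite sumEFin -EFinM; have := integrable_abs kgi => /integral_EFin ->.
by rewrite -EFinD ltry.
Qed.

Lemma atoms_density_Rintegral (k : T -> R) : measurable_fun setT k ->
  m.-integrable setT (EFin \o (fun x => k x * g x)) ->
  \int[nu]_x k x = a * (\sum_(i < n) k (tnth t i)) + \int[m]_x (k x * g x).
Proof.
move=> mk kgi; rewrite {1}/Rintegral integral_signed.
pose kp x := Num.max (k x) 0; pose kn x := Num.max (- k x) 0.
have mkp : measurable_fun setT kp by exact: measurable_maxr.
have mkn : measurable_fun setT kn.
  by apply: measurable_maxr => //; exact: measurableT_comp.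
have kpn x : k x = kp x - kn x.
  by rewrite /kp /kn; case: (ltP (k x) 0); case: (ltP (- k x) 0); lra.
have kpi : m.-integrable setT (EFin \o (fun x => kp x * g x)).
  apply: integrable_dominated (integrable_abs kgi); first exact: measurable_funM.
  move=> x; rewrite !normrM ler_wpM2r// /kp.
  by case: (ltP (k x) 0); rewrite ?normr0.
have kni : m.-integrable setT (EFin \o (fun x => kn x * g x)).
  apply: integrable_dominated (integrable_abs kgi); first exact: measurable_funM.
  move=> x; rewrite !normrM ler_wpM2r// /kn.
  by case: (ltP (- k x) 0); rewrite ?normr0 ?normrN.
rewrite !nuE//; try by [apply/measurable_EFinP|move=> x; rewrite lee_fin le_max lexx orbT].
under eq_integral do rewrite -EFinM.
under [X in (_ - (_ + X))%E]eq_integral do rewrite -EFinM.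
rewrite (integral_EFin kpi) (integral_EFin kni) !sumEFin -!EFinM -!EFinD/=.
under [in RHS]eq_bigr do rewrite kpn.
under [in RHS]eq_Rintegral do rewrite kpn mulrBl.
rewrite RintegralB// sumrB; lra.
Qed.

End theory.
End atoms_and_density_probability.

(** * Relative entropy as an integral of [psi] *)

Section relative_entropy_density.
Context {d} {T : measurableType d} {R : realType}.
Variables (nu : probability T R) (P : {sigma_finite_measure set T -> \bar R}).
Variable (g : T -> R).
Hypotheses (P1 : P setT = 1%E) (mg : measurable_fun setT g) (g0 : forall x, 0 <= g x).
Hypothesis nuE : forall A, measurable A -> nu A = (\int[P]_(x in A) (g x)%:E)%E.

(** Changing variables turns the entropy into the integral of [g ln g], and [g - 1] has integral 0.
    The negative part of [g ln g] is at most 1, so the identity survives an infinite entropy. *)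
Lemma relative_entropyE :
  relative_entropy nu P = (\int[P]_x (psi (g x))%:E)%E.
Proof.
have dom : nu `<< P by exact: (@density_dominates _ _ _ nu P g).
rewrite /relative_entropy asboolT//.
have mlg : measurable_fun setT (fun x => ln (g x)).
  exact: (measurableT_comp (@measurable_ln R) mg).
have RNg := @Radon_Nikodym_density _ _ _ nu P g mg nuE.
set RN := Radon_Nikodym _ _ in RNg *.
have mRN : measurable_fun setT RN.
  by apply: measurable_int; exact: Radon_Nikodym_integrable.
(* [lne] and [ln] disagree at 0, where the former is [-oo] and the latter 0; this set must be null
   for [nu]. *)
have nu_pos : nu [set x | g x <= 0] = 0%E.
  have mA : measurable [set x | g x <= 0].
    rewrite -[X in measurable X]setTI.
    by apply: (@measurable_fun_le _ _ _ setT g (cst 0)).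
  rewrite nuE// (eq_integral (cst 0%E)) ?integral0// => x.
  by rewrite inE/= => gx; congr (_%:E); apply/eqP; rewrite eq_le gx g0.
have -> : (\int[nu]_x lne (RN x) = \int[nu]_x (ln (g x))%:E)%E.
  apply: ae_eq_integral => //.
  - rewrite (_ : (fun x => lne (RN x)) =
        fun x => if (0 < fine (RN x)) then (ln (fine (RN x)))%:E else -oo%E).
      apply: measurable_fun_ifT => //.
      + by apply: measurable_fun_ltr => //; exact: measurableT_comp.
      + apply/measurable_EFinP; apply: (measurableT_comp (@measurable_ln R)).
        exact: measurableT_comp.
    apply/funext => x.
    have := @Radon_Nikodym_fin_num _ _ _ (charge_of_finite_measure nu) P x dom.
    rewrite -/RN; case: (RN x) => // r _.
    case: (ltP 0 r) => r0; first by rewrite lne_EFin//= r0.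
    by rewrite le0_lneNy//= ltNge r0.
  - exact/measurable_EFinP.
  - have RNg' := null_dominates_ae_eq measurableT dom RNg.
    have pos : {ae nu, forall x, 0 < g x}.
      exists [set x | g x <= 0]; split => //.
        rewrite -[X in measurable X]setTI.
        by apply: (@measurable_fun_le _ _ _ setT g (cst 0)).
      by move=> x /= /negP; rewrite -leNgt.
    near=> x => _.
    have gx : 0 < g x by near: x.
    have -> : RN x = (g x)%:E by near: x; move: RNg'; apply: filterS => x; exact.
    by rewrite lne_EFin.
rewrite (@integral_density _ _ _ nu P g)//.
have gi : P.-integrable setT (EFin \o g) by exact: (@density_integrable _ _ _ nu P g).
have g1 : (\int[P]_x (g x)%:E = 1)%E by rewrite -nuE// probability_setT.
rewrite integral_signed.
pose kp x := Num.max (ln (g x) * g x) 0; pose kn x := Num.max (- (ln (g x) * g x)) 0.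
have mgl : measurable_fun setT (fun x => ln (g x) * g x) by exact: measurable_funM.
have mkp : measurable_fun setT kp by exact: measurable_maxr.
have mkn : measurable_fun setT kn.
  by apply: measurable_maxr => //; exact: measurableT_comp.
have kn0 x : 0 <= kn x by rewrite le_max lexx orbT.
have kp0 x : 0 <= kp x by rewrite le_max lexx orbT.
have kn1 x : kn x <= 1.
  rewrite ge_max ler01 andbT.
  have := psi_ge0 (g0 x); have := g0 x; rewrite /psi; lra.
have I1 : (\int[P]_x 1%:E = 1)%E by rewrite integral_cst// mul1e.
have kni : (\int[P]_x (kn x)%:E)%E \is a fin_num.
  rewrite ge0_fin_numE; last by apply: integral_ge0 => x _; rewrite lee_fin.
  apply: (@le_lt_trans _ _ (\int[P]_x 1%:E)%E); last by rewrite I1 ltry.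
  apply: ge0_le_integral => //.
  - by move=> x _; rewrite lee_fin.
  - exact/measurable_EFinP.
  - by move=> x _; rewrite lee_fin.
have mpg : measurable_fun setT (fun x => psi (g x)).
  exact: (measurableT_comp (@measurable_psi R) mg).
(* The relation [psi g = g ln g - g + 1] is rearranged so that only nonnegative functions are added:
   integrals are then additive even when infinite, and the finite negative part is cancelled at the
   end. *)
have : (\int[P]_x (psi (g x))%:E + 1 + \int[P]_x (kn x)%:E =
        \int[P]_x (kp x)%:E + 1)%E.
  rewrite -{1}g1 -I1.
  rewrite -ge0_integralD//; last 4 first.
  - by move=> x _; rewrite lee_fin psi_ge0.
  - exact/measurable_EFinP.
  - by move=> x _; rewrite lee_fin.
  - exact/measurable_EFinP.
  rewrite -ge0_integralD//; last 4 first.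
  - by move=> x _; rewrite -EFinD lee_fin addr_ge0// psi_ge0.
  - by apply/measurable_EFinP; exact: measurable_funD.
  - by move=> x _; rewrite lee_fin.
  - exact/measurable_EFinP.
  rewrite -ge0_integralD//; last 2 first.
  - by move=> x _; rewrite lee_fin.
  - exact/measurable_EFinP.
  apply: eq_integral => x _; rewrite -!EFinD; congr (_%:E).
  rewrite /kn /kp /psi; set u := ln (g x) * g x.
  have -> : g x * ln (g x) = u by rewrite mulrC.
  by case: (ltP u 0); case: (ltP (- u) 0); lra.
rewrite -/kn; move: kni => /fineK <-.
set c := fine _; rewrite -/kp.
have := integral_ge0 P (fun x (_ : setT x) => kp0 x : (0 <= (kp x)%:E)%E).
have : (0 <= \int[P]_x (psi (g x))%:E)%E.
  by apply: integral_ge0 => x _; rewrite lee_fin psi_ge0.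
case: (\int[P]_x (psi (g x))%:E)%E => [a| |]//=;
  case: (\int[P]_x (kp x)%:E)%E => [b| |]//= _ _.
rewrite -!EFinD => -[] e; congr (_%:E); lra.
Unshelve. all: by end_near.
Qed.

End relative_entropy_density.

(** * Bilinear forms of kernels *)

Section product_domination.
Context {d1 d2} {S : measurableType d1} {T : measurableType d2} {R : realType}.
Variables (m1 : {sigma_finite_measure set S -> \bar R})
  (m2 : {sigma_finite_measure set T -> \bar R}).
Variables (F : S -> T -> R) (a : S -> R) (b : T -> R).
Hypotheses (mF : measurable_fun setT (fun p : S * T => F p.1 p.2))
  (Fab : forall x y, `|F x y| <= a x * b y)
  (ai : m1.-integrable setT (EFin \o a)) (bi : m2.-integrable setT (EFin \o b)).

Lemma dominated_integrable2 x : m2.-integrable setT (EFin \o F x).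
Proof.
exact: integrable_dominated (measurable_pairl x mF) (Fab x) (integrable_Z (a x) bi).
Qed.

Lemma dominated_integrable1 y : m1.-integrable setT (EFin \o F ^~ y).
Proof.
apply: integrable_dominated (measurable_pairr y mF) _ (integrable_Z (b y) ai).
by move=> x; rewrite mulrC.
Qed.

Lemma dominated_prod_integrable :
  (m1 \x m2)%E.-integrable setT (EFin \o (fun p : S * T => F p.1 p.2)).
Proof.
have mA : measurable_fun setT (fun p : S * T => `|F p.1 p.2|).
  exact: measurableT_comp.
apply/integrable12ltyP; first exact/measurable_EFinP.
apply: (@le_lt_trans _ _ (\int[m1]_x (`|a x| * \int[m2]_y `|b y|)%:E)%E); last first.
  have := integrable_Z (\int[m2]_y `|b y|) (integrable_abs ai).
  move/integral_EFin => /= e.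
  by under eq_integral do rewrite mulrC; rewrite e ltry.
apply: ge0_le_integral => //.
- by move=> x _; apply: integral_ge0 => y _.
- exact: (measurable_fun_fubini_tonelli_F (fun p : S * T => (`|F p.1 p.2|)%:E)
    (proj2 (measurable_EFinP _ _) mA)).
- apply/measurable_EFinP; apply: measurable_funM => //.
  exact: measurableT_comp (integrable_measurable ai).
- move=> x _ /=; rewrite EFinM -(integral_EFin (integrable_abs bi)).
  rewrite -ge0_integralZl//; last first.
    by apply/measurable_EFinP; exact: measurableT_comp (integrable_measurable bi).
  apply: ge0_le_integral => //.
  + by apply/measurable_EFinP; exact: (@measurable_pairl _ _ _ _ _ (fun x y => `|F x y|) x mA).
  + apply/measurable_EFinP; apply: measurable_funM => //.
    exact: measurableT_comp (integrable_measurable bi).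
  + move=> y _; rewrite -EFinM lee_fin (le_trans (Fab x y))//.
    by rewrite -normrM ler_norm.
Qed.

Lemma dominated_integrable_F :
  m1.-integrable setT (EFin \o (fun x => \int[m2]_y F x y)).
Proof.
have := integrable_fubini_F dominated_prod_integrable.
apply: eq_integrable => // x _.
by rewrite /fubini_F /= integral_EFin//; exact: dominated_integrable2.
Qed.

Lemma dominated_Fubini1 :
  \int[(m1 \x m2)%E]_p F p.1 p.2 = \int[m1]_x \int[m2]_y F x y.
Proof.
rewrite /Rintegral -integral12_prod_meas1; last exact: dominated_prod_integrable.
congr fine; apply: eq_integral => x _.
exact: (integral_EFin (dominated_integrable2 x)).
Qed.

Lemma dominated_Fubini :
  \int[m1]_x \int[m2]_y F x y = \int[m2]_y \int[m1]_x F x y.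
Proof.
rewrite -dominated_Fubini1 /Rintegral.
rewrite -integral21_prod_meas1; last exact: dominated_prod_integrable.
congr fine; apply: eq_integral => y _.
exact: (integral_EFin (dominated_integrable1 y)).
Qed.

End product_domination.

(* [om] stands for the weight 1 on the torus and 1 + |x|^2 on R^d. *)
Section bilinear.
Context {d} {T : measurableType d} {R : realType}.
Variable om : T -> R.
Hypotheses (mom : measurable_fun setT om) (om1 : forall x, 1 <= om x).

Let om0 x : 0 <= om x. Proof. exact: le_trans (om1 x). Qed.

Definition kernel_growth (U : T -> T -> R) : Prop :=
  measurable_fun setT (fun p : T * T => U p.1 p.2) /\
  exists C, forall x y, `|U x y| <= C * (om x + om y).

(** As [om >= 1], a sum of weights is at most twice their product; the product form dominates the
    kernel by a tensor product, which is what Fubini requires. *)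
Lemma kernel_growth_mul U : kernel_growth U ->
  exists2 C, 0 <= C & forall x y, `|U x y| <= C * om x * om y.
Proof.
move=> [_ [C UC]]; exists (2 * C).
  case: (boolP (0 <= C)) => [|]; first lra.
  rewrite -ltNge => C0; have := UC point point; have := normr_ge0 (U point point).
  have := om1 point; nra.
move=> x y; apply: le_trans (UC x y) _.
have C0 : 0 <= C.
  rewrite leNgt; apply/negP => C0.
  have := UC x y; have := normr_ge0 (U x y).
  have := om1 x; have := om1 y; nra.
have -> : 2 * C * om x * om y = C * (2 * om x * om y) by ring.
rewrite ler_wpM2l//.
have := om1 x; have := om1 y; nra.
Qed.

Section measure.
Variable m : {sigma_finite_measure set T -> \bar R}.

Definition om_integrable (q : T -> R) : Prop :=
  measurable_fun setT q /\ m.-integrable setT (EFin \o (fun x => om x * q x)).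

Lemma om_integrableM (C : R) (k q : T -> R) : om_integrable q -> measurable_fun setT k ->
  (forall x, `|k x| <= C * om x) -> m.-integrable setT (EFin \o (fun x => k x * q x)).
Proof.
move=> [mq iq] mk kC.
apply: integrable_dominated (integrable_Z C (integrable_abs iq)).
  exact: measurable_funM.
move=> x; rewrite !normrM (ger0_norm (om0 x)) mulrA ler_wpM2r//.
Qed.

Lemma om_integrable_int q : om_integrable q -> m.-integrable setT (EFin \o q).
Proof.
move=> iq; have := @om_integrableM 1 (cst 1) q iq (measurable_cst _).
have e : (fun x => cst 1 x * q x) = q by apply/funext => x; rewrite mul1r.
by rewrite e; apply => x; rewrite normr1 mul1r.
Qed.

Lemma om_integrableZ (c : R) q : om_integrable q -> om_integrable (fun x => c * q x).
Proof.
move=> [mq iq]; split; first exact: measurable_funM.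
by under eq_fun do rewrite mulrCA; exact: integrable_Z.
Qed.

Lemma om_integrableD p q : om_integrable p -> om_integrable q ->
  om_integrable (fun x => p x + q x).
Proof.
move=> [mp ip] [mq iq]; split; first exact: measurable_funD.
by under eq_fun do rewrite mulrDr; exact: integrable_D.
Qed.

Lemma om_integrable_le (p q : T -> R) : om_integrable q -> measurable_fun setT p ->
  (forall x, `|p x| <= `|q x|) -> om_integrable p.
Proof.
move=> [mq iq] mp pq; split=> //.
apply: integrable_dominated (integrable_abs iq); first exact: measurable_funM.
by move=> x; rewrite !normrM ler_wpM2l.
Qed.

(** The integral of [U x] against the signed measure [q m]; [energy U p q] then pairs [U] with the
    product of [p m] and [q m]. *)
Definition potential (U : T -> T -> R) (q : T -> R) x := \int[m]_y (U x y * q y).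

Definition energy (U : T -> T -> R) (p q : T -> R) := \int[m]_x (potential U q x * p x).

Section kernel.
Variable U : T -> T -> R.
Hypothesis UG : kernel_growth U.

Lemma measurable_kernell x : measurable_fun setT (U x).
Proof. exact: measurable_pairl UG.1. Qed.

Lemma measurable_kernelr y : measurable_fun setT (U ^~ y).
Proof. exact: measurable_pairr UG.1. Qed.

Lemma kernel_intl q x : om_integrable q ->
  m.-integrable setT (EFin \o (fun y => U x y * q y)).
Proof.
move=> iq; have [C _ UC] := kernel_growth_mul UG.
exact: (om_integrableM iq (measurable_kernell x) (UC x)).
Qed.

Lemma kernel_intr q y : om_integrable q ->
  m.-integrable setT (EFin \o (fun x => U x y * q x)).
Proof.
move=> iq; have [C _ UC] := kernel_growth_mul UG.
apply: (@om_integrableM (C * om y)) => //; first exact: measurable_kernelr.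
by move=> x; rewrite mulrAC.
Qed.

Lemma measurable_kernel_density q : measurable_fun setT q ->
  measurable_fun setT (fun p : T * T => U p.1 p.2 * q p.2).
Proof.
move=> mq; apply: measurable_funM; first exact: UG.1.
exact: measurableT_comp mq measurable_snd.
Qed.

Lemma measurable_potential q : measurable_fun setT q ->
  measurable_fun setT (potential U q).
Proof.
move=> mq.
exact: (@measurable_Rintegral _ _ _ _ _ m (fun x y => U x y * q y)
  (measurable_kernel_density mq)).
Qed.

Lemma potential_bound q : om_integrable q ->
  exists C, forall x, `|potential U q x| <= C * om x.
Proof.
move=> iq; have [C C0 UC] := kernel_growth_mul UG.
exists (C * \int[m]_y `|om y * q y|) => x.
apply: le_trans (le_normr_Rintegral measurableT (kernel_intl x iq)) _.
have oi := integrable_abs iq.2.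
rewrite mulrAC -RintegralZl//; apply: le_Rintegral => //.
- exact: (integrable_abs (kernel_intl x iq)).
- exact: integrable_Z oi.
- move=> y _; rewrite !normrM (ger0_norm (om0 y)) mulrA ler_wpM2r//.
Qed.

Lemma potential_int p q : om_integrable p -> om_integrable q ->
  m.-integrable setT (EFin \o (fun x => potential U q x * p x)).
Proof.
move=> ip iq; have [C pC] := potential_bound iq.
exact: (om_integrableM ip (measurable_potential iq.1) pC).
Qed.

Lemma potentialD p q x : om_integrable p -> om_integrable q ->
  potential U (fun y => p y + q y) x = potential U p x + potential U q x.
Proof.
move=> ip iq; rewrite /potential -RintegralD//; try exact: kernel_intl.
by apply: eq_Rintegral => y _; rewrite mulrDr.
Qed.

Lemma potentialZ c q x : om_integrable q ->
  potential U (fun y => c * q y) x = c * potential U q x.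
Proof.
move=> iq; rewrite /potential -RintegralZl//; last exact: kernel_intl.
by apply: eq_Rintegral => y _; rewrite mulrCA.
Qed.

Lemma energyDl p p' q : om_integrable p -> om_integrable p' -> om_integrable q ->
  energy U (fun y => p y + p' y) q = energy U p q + energy U p' q.
Proof.
move=> ip ip' iq; rewrite /energy -RintegralD//; try exact: potential_int.
by apply: eq_Rintegral => y _; rewrite mulrDr.
Qed.

Lemma energyDr p q q' : om_integrable p -> om_integrable q -> om_integrable q' ->
  energy U p (fun y => q y + q' y) = energy U p q + energy U p q'.
Proof.
move=> ip iq iq'; rewrite /energy -RintegralD//; try exact: potential_int.
by apply: eq_Rintegral => y _; rewrite potentialD// mulrDl.
Qed.

Lemma energyZl c p q : om_integrable p -> om_integrable q ->
  energy U (fun y => c * p y) q = c * energy U p q.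
Proof.
move=> ip iq; rewrite /energy -RintegralZl//; last exact: potential_int.
by apply: eq_Rintegral => y _; rewrite mulrCA.
Qed.

Lemma energyZr c p q : om_integrable p -> om_integrable q ->
  energy U p (fun y => c * q y) = c * energy U p q.
Proof.
move=> ip iq; rewrite /energy -RintegralZl//; last exact: potential_int.
by apply: eq_Rintegral => y _; rewrite potentialZ// mulrA.
Qed.

Lemma energyC p q : (forall x y, U x y = U y x) ->
  om_integrable p -> om_integrable q -> energy U p q = energy U q p.
Proof.
move=> Usym ip iq.
have [C C0 UC] := kernel_growth_mul UG.
transitivity (\int[m]_x \int[m]_y (U x y * q y * p x)).
  apply: eq_Rintegral => x _; rewrite -RintegralZr//; exact: kernel_intl.
rewrite (@dominated_Fubini _ _ _ _ _ m m _
    (fun x => C * `|om x * p x|) (fun x => `|om x * q x|)).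
- apply: eq_Rintegral => y _; rewrite -RintegralZr//; last exact: kernel_intl.
  by apply: eq_Rintegral => x _; rewrite mulrAC Usym.
- apply: measurable_funM; first exact: measurable_kernel_density iq.1.
  exact: measurableT_comp ip.1 measurable_fst.
- move=> x y; rewrite !normrM !(ger0_norm (om0 _)).
  apply: (@le_trans _ _ (C * om x * om y * `|q y| * `|p x|)).
    by rewrite !ler_wpM2r.
  by rewrite le_eqVlt; apply/orP; left; apply/eqP; ring.
- by apply: integrable_Z; exact: integrable_abs ip.2.
- by exact: integrable_abs iq.2.
Qed.

End kernel.
End measure.

Lemma pairing_iterated U (mu nu : probability T R) : kernel_growth U ->
  mu.-integrable setT (EFin \o om) -> nu.-integrable setT (EFin \o om) ->
  pairing U mu nu = \int[mu]_x \int[nu]_y U x y.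
Proof.
move=> UG imu inu; have [C C0 UC] := kernel_growth_mul UG.
by apply: (dominated_Fubini1 UG.1 UC _ inu); exact: integrable_Z.
Qed.

End bilinear.

(** * Positivity on atoms plus a density *)

Section quadratic_form.
Context {d} {T : measurableType d} {R : realType}.
Variables (om : T -> R) (m : probability T R).
Hypotheses (mom : measurable_fun setT om) (om1 : forall x, 1 <= om x)
  (omi : m.-integrable setT (EFin \o om)).

Local Notation om_int := (om_integrable om m).
Local Notation pot := (potential m).
Local Notation nrg := (energy m).

(* <U, sigma^{(x)2}> for sigma = \sum_i \delta_{t_i} + q m *)
Definition quad_form (U : T -> T -> R) n (t : n.-tuple T) q : R :=
  \sum_(i < n) \sum_(j < n) U (tnth t i) (tnth t j) +
  2 * (\sum_(i < n) pot U q (tnth t i)) + nrg U q q.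

Definition om_positive (U : T -> T -> R) : Prop :=
  forall nu nu' : probability T R, nu.-integrable setT (EFin \o om) ->
    nu'.-integrable setT (EFin \o om) -> 0 <= pairing_diff U nu nu'.

Lemma om_integrable_cst c : om_int (cst c).
Proof.
split => //; under eq_fun do rewrite mulrC; exact: integrable_Z.
Qed.

Section symmetric_kernel.
Variable U : T -> T -> R.
Hypotheses (UG : kernel_growth om U) (Usym : forall x y, U x y = U y x).

Let om0 x : 0 <= om x. Proof. exact: le_trans (om1 x). Qed.

Lemma atoms_density_om nu a n (t : n.-tuple T) g : atoms_density m nu a t g ->
  (forall x, 0 <= g x) -> om_int g -> nu.-integrable setT (EFin \o om).
Proof. by move=> nuE g0 [mg gi]; exact: (atoms_density_integrable nuE). Qed.

Lemma pairing_atoms_density nu nu' a a' n n' (t : n.-tuple T) (t' : n'.-tuple T)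
    g g' : atoms_density m nu a t g -> atoms_density m nu' a' t' g' ->
  (forall x, 0 <= g x) -> (forall x, 0 <= g' x) -> om_int g -> om_int g' ->
  pairing U nu nu' =
    a * a' * (\sum_(i < n) \sum_(j < n') U (tnth t i) (tnth t' j)) +
    a * (\sum_(i < n) pot U g' (tnth t i)) +
    a' * (\sum_(j < n') pot U g (tnth t' j)) + nrg U g g'.
Proof.
move=> nuE nuE' g0 g0' ig ig'.
rewrite (pairing_iterated om1 UG) ; [|exact: atoms_density_om nuE _ _|
  exact: atoms_density_om nuE' _ _].
pose k x := a' * (\sum_(j < n') U x (tnth t' j)) + pot U g' x.
have -> : \int[nu]_x \int[nu']_y U x y = \int[nu]_x k x.
  apply: eq_Rintegral => x _.
  rewrite (atoms_density_Rintegral nuE' ig'.1)//.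
    exact: measurable_kernell UG _.
  exact: (kernel_intl om1 UG _ ig').
have mk : measurable_fun setT k.
  apply: measurable_funD; last exact: (measurable_potential _ UG ig'.1).
  apply: measurable_funM => //; apply: measurable_sum => j.
  exact: measurable_kernelr UG _.
have i1 : m.-integrable setT
    (EFin \o (fun x => \sum_(j < n') U x (tnth t' j) * g x)).
  by apply: integrable_Rsum => j; exact: (kernel_intr om1 UG _ ig).
have i2 := potential_int om1 UG ig ig'.
have kE x : k x * g x =
    a' * (\sum_(j < n') U x (tnth t' j) * g x) + pot U g' x * g x.
  by rewrite /k mulrDl -mulrA mulr_suml.
rewrite (atoms_density_Rintegral nuE ig.1 mk); last first.
  by under eq_fun do rewrite kE; apply: integrable_D => //; exact: integrable_Z.
under [in X in _ + X]eq_Rintegral do rewrite kE.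
rewrite RintegralD//; last exact: integrable_Z.
rewrite RintegralZl// Rintegral_sum; last first.
  by move=> j; exact: (kernel_intr om1 UG _ ig).
rewrite addrA; congr (_ + a' * _ + _).
  by rewrite /k big_split/= -mulr_sumr mulrDr mulrA.
apply: eq_bigr => j _; apply: eq_Rintegral => x _.
by rewrite Usym.
Qed.

(** A signed measure of mass zero is a positive multiple of a difference of two probabilities: the
    atoms and the positive part of [q] on one side, the negative part on the other. *)
Lemma quad_form_ge0 n (t : n.-tuple T) q : om_positive U -> om_int q ->
  n%:R + \int[m]_x q x = 0 -> 0 <= quad_form U t q.
Proof.
move=> Upos iq tot.
pose qp x := Num.max (q x) 0; pose qn x := Num.max (- q x) 0.
have mqp : measurable_fun setT qp by exact: measurable_maxr iq.1 _.
have mqn : measurable_fun setT qn.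
  by apply: measurable_maxr => //; exact: measurableT_comp iq.1.
have qpn x : q x = qp x + (-1) * qn x.
  by rewrite /qp /qn; case: (ltP (q x) 0); case: (ltP (- q x) 0); lra.
have qp0 x : 0 <= qp x by rewrite /qp le_max lexx orbT.
have qn0 x : 0 <= qn x by rewrite /qn le_max lexx orbT.
have iqp : om_int qp.
  apply: (om_integrable_le mom iq) => // x.
  by rewrite /qp; case: (ltP (q x) 0); rewrite ?normr0.
have iqn : om_int qn.
  apply: (om_integrable_le mom iq) => // x.
  by rewrite /qn; case: (ltP (- q x) 0); rewrite ?normr0 ?normrN.
have iqp' := om_integrable_int om1 iqp.
have iqn' := om_integrable_int om1 iqn.
(* The [+ 1] adds [m] itself to both sides: it cancels in the difference and keeps the common mass
   [s] positive even when there are no atoms and [q] vanishes. *)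
pose s := \int[m]_x qn x + 1.
have s0 : 0 < s by rewrite ltr_wpDl// Rintegral_ge0.
have sp : n%:R + (\int[m]_x qp x + 1) = s.
  have : \int[m]_x q x = \int[m]_x qp x - \int[m]_x qn x.
    rewrite -RintegralB//; apply: eq_Rintegral => x _.
    by rewrite qpn mulN1r.
  by rewrite /s; lra.
pose gp x := s^-1 * (qp x + cst 1 x); pose gn x := s^-1 * (qn x + cst 1 x).
have s'0 : 0 <= s^-1 by rewrite invr_ge0 ltW.
have gp0 x : 0 <= gp x by rewrite mulr_ge0// addr_ge0.
have gn0 x : 0 <= gn x by rewrite mulr_ge0// addr_ge0.
have i1 := om_integrable_cst 1.
have i1' := integrable_cst m 1.
have igp : om_int gp by apply: om_integrableZ => //; exact: om_integrableD.
have ign : om_int gn by apply: om_integrableZ => //; exact: om_integrableD.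
have [nu nuE] : exists nu, atoms_density m nu s^-1 t gp.
  apply: atoms_density_exists => //; [exact: igp.1|exact: (om_integrable_int om1 igp)|].
  rewrite RintegralZl//; last exact: integrable_D.
  rewrite RintegralD// Rintegral_cst_prob -mulrDr sp mulVf//.
  by rewrite gt_eqF.
have [nu' nuE'] : exists nu', atoms_density m nu' 0 [tuple] gn.
  apply: atoms_density_exists => //; [exact: ign.1|exact: (om_integrable_int om1 ign)|].
  rewrite mul0r add0r RintegralZl//; last exact: integrable_D.
  by rewrite RintegralD// Rintegral_cst_prob -/s mulVf// gt_eqF.
have := Upos nu nu' (atoms_density_om nuE gp0 igp) (atoms_density_om nuE' gn0 ign).
rewrite /pairing_diff.
rewrite (pairing_atoms_density nuE nuE)// (pairing_atoms_density nuE nuE')//.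
rewrite (pairing_atoms_density nuE' nuE)// (pairing_atoms_density nuE' nuE')//.
have -> : \sum_(i < n) \sum_(j < 0) U (tnth t i) (tnth [tuple] j) = 0.
  by apply: big1 => i _; rewrite big_ord0.
rewrite !(mul0r, mulr0, big_ord0, addr0, add0r).
have -> : quad_form U t q = s ^+ 2 * (
    s^-1 * s^-1 * (\sum_(i < n) \sum_(j < n) U (tnth t i) (tnth t j)) +
    2 * s^-1 * (\sum_(i < n) (pot U gp (tnth t i) - pot U gn (tnth t i))) +
    (nrg U gp gp - nrg U gp gn - nrg U gn gp + nrg U gn gn)).
  have qE : q = fun x => s * (gp x + (-1) * gn x).
    apply/funext => x; rewrite qpn /gp /gn; field.
    by rewrite gt_eqF.
  clearbody gp gn.
  have igpn : om_int (fun x => gp x + -1 * gn x).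
    by apply: om_integrableD => //; exact: om_integrableZ.
  have ign1 : om_int (fun x => -1 * gn x) by exact: om_integrableZ.
  rewrite /quad_form qE.
  rewrite (energyZl om1 UG)//; last exact: om_integrableZ.
  rewrite (energyZr om1 UG)//.
  rewrite (energyDl om1 UG)// !(energyDr om1 UG)//.
  rewrite !(energyZl om1 UG)// !(energyZr om1 UG)//.
  under [X in _ + 2 * X + _]eq_bigr => i _.
    rewrite (potentialZ om1 UG)// (potentialD om1 UG)//.
    rewrite (potentialZ om1 UG)// mulN1r.
    over.
  rewrite -mulr_sumr; field.
  by rewrite gt_eqF.
move=> h; rewrite mulr_ge0 ?sqr_ge0//; move: h; congr (_ <= _).
by rewrite sumrB; ring.
Qed.

End symmetric_kernel.
End quadratic_form.

(** * The reduced kernel *)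

Section reduced.
Context {d} {T : measurableType d} {R : realType}.
Variables (om : T -> R) (m : probability T R).
Hypotheses (mom : measurable_fun setT om) (om1 : forall x, 1 <= om x)
  (omi : m.-integrable setT (EFin \o om)).

Local Notation om_int := (om_integrable om m).
Local Notation pot := (potential m).
Local Notation nrg := (energy m).

Let om0 x : 0 <= om x. Proof. exact: le_trans (om1 x). Qed.
Let one_int : om_int (cst 1). Proof. exact: om_integrable_cst. Qed.

(* Reduced kernel on an arbitrary space: convertible to [reduced_kernel]. *)
Definition reduce (U : T -> T -> R) (x y : T) : R :=
  U x y - \int[m]_y' U x y' - \int[m]_x' U x' y + pairing U m m.

Section kernel.
Variable U : T -> T -> R.
Hypotheses (UG : kernel_growth om U) (Usym : forall x y, U x y = U y x).

Local Notation mean := (pot U (cst 1)).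

Lemma potential1E x : \int[m]_y U x y = mean x.
Proof. by apply: eq_Rintegral => y _; rewrite mulr1. Qed.

Lemma reduceE x y : reduce U x y = U x y - mean x - mean y + pairing U m m.
Proof.
rewrite /reduce potential1E; congr (_ - _ + _).
by rewrite -potential1E; apply: eq_Rintegral => x' _; rewrite Usym.
Qed.

Lemma reduce_sym x y : reduce U x y = reduce U y x.
Proof. by rewrite !reduceE Usym; congr (_ + _); rewrite addrAC. Qed.

Lemma measurable_mean : measurable_fun setT mean.
Proof. exact: (measurable_potential m UG (proj1 one_int)). Qed.

Lemma reduce_growth : kernel_growth om (reduce U).
Proof.
have [mU [C UC]] := UG; have [C' meanC] := potential_bound om1 UG one_int.
split.
  rewrite (_ : (fun p => _) = fun p : T * T =>
      U p.1 p.2 - mean p.1 - mean p.2 + pairing U m m).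
    apply: measurable_funD => //; apply: measurable_funB.
      apply: measurable_funB => //.
      exact: measurableT_comp measurable_mean measurable_fst.
    exact: measurableT_comp measurable_mean measurable_snd.
  by apply/funext => p; rewrite reduceE.
exists (C + C' + `|pairing U m m|) => x y; rewrite reduceE.
have := UC x y; have := meanC x; have := meanC y.
set u := U x y; set a := mean x; set b := mean y; set c := pairing U m m.
have := ler_normD (u - a - b) c; have := ler_normB (u - a) b; have := ler_normB u a.
have cp : 0 <= `|c| * (om x + om y - 1).
  by rewrite mulr_ge0//; have := om1 x; have := om1 y; lra.
move=> h1 h2 h3 h4 h5 h6.
rewrite !mulrDl; move: cp h4 h5 h6; rewrite mulrBr mulr1 !mulrDr.
clear -h1 h2 h3; lra.
Qed.

Lemma mean_integrable (nu : probability T R) : nu.-integrable setT (EFin \o om) ->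
  nu.-integrable setT (EFin \o mean).
Proof.
move=> inu; have [C' meanC] := potential_bound om1 UG one_int.
exact: integrable_dominated measurable_mean meanC (integrable_Z C' inu).
Qed.

Lemma kernel_integrable_prob (nu : probability T R) x :
  nu.-integrable setT (EFin \o om) -> nu.-integrable setT (EFin \o U x).
Proof.
move=> inu; have [C _ UC] := kernel_growth_mul om1 UG.
apply: integrable_dominated (UC x) (integrable_Z _ inu).
exact: measurable_kernell UG _.
Qed.

Lemma reduce_integral (nu : probability T R) x :
  nu.-integrable setT (EFin \o om) ->
  \int[nu]_y reduce U x y =
  \int[nu]_y U x y - mean x - \int[nu]_y mean y + pairing U m m.
Proof.
move=> inu; under eq_Rintegral do rewrite reduceE.
have i1 := kernel_integrable_prob x inu; have i2 := mean_integrable inu.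
have ic c : nu.-integrable setT (EFin \o fun=> c) := integrable_cst nu c.
have i3 := integrable_B i1 (ic (mean x)).
rewrite RintegralD//; last exact: (integrable_B i3 i2).
by rewrite (RintegralB measurableT i3 i2) RintegralB// !Rintegral_cst_prob.
Qed.

Lemma pairing_self : pairing U m m = \int[m]_x mean x.
Proof.
rewrite (pairing_iterated om1 UG)//; apply: eq_Rintegral => x _.
exact: potential1E.
Qed.

Lemma reduce_mean0 x : pot (reduce U) (cst 1) x = 0.
Proof.
under [LHS]eq_Rintegral do rewrite mulr1.
by rewrite reduce_integral// pairing_self potential1E; lra.
Qed.

Lemma reduce_pairing (nu nu' : probability T R) :
  nu.-integrable setT (EFin \o om) -> nu'.-integrable setT (EFin \o om) ->
  pairing (reduce U) nu nu' =
  pairing U nu nu' - \int[nu]_x mean x - \int[nu']_x mean x + pairing U m m.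
Proof.
move=> inu inu'; rewrite (pairing_iterated om1 reduce_growth)//.
under eq_Rintegral do rewrite reduce_integral//.
have ic c : nu.-integrable setT (EFin \o fun=> c) := integrable_cst nu c.
have i2 := mean_integrable inu.
have i1 : nu.-integrable setT (EFin \o (fun x => \int[nu']_y U x y)).
  have [C _ UC] := kernel_growth_mul om1 UG.
  by apply: (dominated_integrable_F UG.1 UC _ inu'); exact: integrable_Z.
have i3 := integrable_B i1 i2.
rewrite RintegralD//; last exact: (integrable_B i3 (ic _)).
rewrite (RintegralB measurableT i3 (ic _)) RintegralB//.
by rewrite !Rintegral_cst_prob -(pairing_iterated om1 UG inu inu').
Qed.

(** Reduction only adds functions of a single variable and a constant, and these cancel on a
    difference of probability measures. *)
Lemma reduce_positive : om_positive om U -> om_positive om (reduce U).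
Proof.
move=> Upos nu nu' inu inu'; have := Upos nu nu' inu inu'.
by rewrite /pairing_diff !reduce_pairing//; lra.
Qed.

(** The reduced form has [m] in its null space, so adding [c m] does not change it; [c] is chosen to
    bring the total mass to zero. *)
Lemma reduce_quad_form_ge0 n (t : n.-tuple T) q : om_positive om U -> om_int q ->
  0 <= quad_form m (reduce U) t q.
Proof.
move=> Upos iq; pose c := - (n%:R + \int[m]_x q x).
have rG := reduce_growth.
have ic : om_int (fun y => c * cst 1 y) by exact: om_integrableZ.
have iqc : om_int (fun y => q y + c * cst 1 y) by exact: om_integrableD.
have pc x : pot (reduce U) (fun y => q y + c * cst 1 y) x = pot (reduce U) q x.
  rewrite (potentialD om1 rG)// (potentialZ om1 rG)// reduce_mean0.
  by rewrite mulr0 addr0.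
have -> : quad_form m (reduce U) t q =
    quad_form m (reduce U) t (fun y => q y + c * cst 1 y).
  rewrite /quad_form; congr (_ + 2 * _ + _).
    by apply: eq_bigr => i _; rewrite pc.
  rewrite (energyDl om1 rG)// (energyZl om1 rG)//.
  rewrite (energyC om1 rG _ one_int)//; last exact: reduce_sym.
  rewrite [X in _ + c * X](_ : _ = 0) ?mulr0 ?addr0.
    by apply: eq_Rintegral => x _; rewrite pc.
  rewrite /energy -[RHS](Rintegral_cst_prob m 0); apply: eq_Rintegral => x _.
  by rewrite reduce_mean0 mul0r.
apply: (quad_form_ge0 mom om1 omi rG reduce_sym _ (reduce_positive Upos) iqc).
have i1 := integrable_cst m 1.
have iq1 := om_integrable_int om1 iq.
rewrite RintegralD//; last exact: integrable_Z.
by rewrite RintegralZl// Rintegral_cst_prob /c; lra.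
Qed.

End kernel.
End reduced.

(** * Conditioning and decoupling *)

Lemma ge0_integral_lty_ae {d} {T : measurableType d} {R : realType}
    (mu : {measure set T -> \bar R}) (F : T -> \bar R) :
  measurable_fun setT F -> (forall x, 0 <= F x)%E -> (\int[mu]_x F x < +oo)%E ->
  {ae mu, forall x, (F x < +oo)%E}.
Proof.
move=> mF F0 Foo.
have : mu.-integrable setT F.
  apply/integrableP; split => //.
  by rewrite (eq_integral F)// => x _; rewrite gee0_abs.
move=> /(integrable_ae measurableT); apply: filterS => x /(_ I).
by rewrite ge0_fin_numE.
Qed.

(** * Disintegration and the entropy chain rule *)

Section conditional_density.
Context {d1 d2} {S : measurableType d1} {T : measurableType d2} {R : realType}.
Variables (om : T -> R) (m : probability T R)
  (P : {sigma_finite_measure set S -> \bar R}) (f : S -> T -> R).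
Hypotheses (mom : measurable_fun setT om) (om1 : forall x, 1 <= om x)
  (omi : m.-integrable setT (EFin \o om)).
Hypotheses (mf : measurable_fun setT (fun p : S * T => f p.1 p.2))
  (f0 : forall s x, 0 <= f s x)
  (f_total : (\int[P]_s \int[m]_x (f s x)%:E = 1)%E)
  (f_om : (\int[P]_s \int[m]_x (om x * f s x)%:E < +oo)%E)
  (f_psi : (\int[P]_s \int[m]_x (psi (f s x))%:E < +oo)%E).

Let om0 x : 0 <= om x. Proof. exact: le_trans (om1 x). Qed.

Definition marginal s : R := \int[m]_x f s x.

(** A measurable condition that selects the good fibres. With a default value elsewhere,
    [conditional s] is a density of finite weight and entropy for every [s], so later pointwise
    arguments carry no null sets. *)
Definition conditionable s : bool :=
  [&& (0 < \int[m]_x (f s x)%:E)%E, (\int[m]_x (f s x)%:E < +oo)%E,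
      (\int[m]_x (om x * f s x)%:E < +oo)%E &
      (\int[m]_x (psi (f s x))%:E < +oo)%E].

(* The density [f s] vanishes [m]-almost everywhere for [P]-almost every [s] that
   is not [conditionable]; the value 1 there is an arbitrary density. *)
Definition conditional s x : R :=
  if conditionable s then f s x / marginal s else 1.

Definition conditional_entropy s : R := \int[m]_x psi (conditional s x).

Let measurable_sect s : measurable_fun setT (f s).
Proof. exact: measurable_pairl mf. Qed.

Let mtonelli (F : S -> T -> R) :
  measurable_fun setT (fun p : S * T => F p.1 p.2) ->
  (forall s x, 0 <= F s x) ->
  measurable_fun setT (fun s => \int[m]_x (F s x)%:E)%E.
Proof.
move=> mF F0; apply: (measurable_fun_fubini_tonelli_F
  (fun p : S * T => (F p.1 p.2)%:E)); first exact/measurable_EFinP.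
by move=> p; rewrite lee_fin.
Qed.

Let m_om_f : measurable_fun setT (fun p : S * T => om p.2 * f p.1 p.2).
Proof. apply: measurable_funM => //; exact: measurableT_comp mom measurable_snd. Qed.

Let m_psi_f : measurable_fun setT (fun p : S * T => psi (f p.1 p.2)).
Proof. exact: (measurableT_comp (@measurable_psi R) mf). Qed.

Let om_f0 s x : 0 <= om x * f s x. Proof. exact: mulr_ge0. Qed.

Let psi_f0 s x : 0 <= psi (f s x). Proof. exact: psi_ge0. Qed.

Let measurable_conditionable : measurable_fun setT conditionable.
Proof.
apply: measurable_and.
  by apply: measurable_fun_lte => //; exact: mtonelli.
apply: measurable_and.
  by apply: measurable_fun_lte => //; exact: mtonelli.
apply: measurable_and.
  by apply: measurable_fun_lte => //; exact: (@mtonelli (fun s x => om x * f s x)).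
by apply: measurable_fun_lte => //; exact: (@mtonelli (fun s x => psi (f s x))).
Qed.

Lemma measurable_marginal : measurable_fun setT marginal.
Proof. exact: measurable_Rintegral. Qed.

Lemma marginal_ge0 s : 0 <= marginal s.
Proof. exact: Rintegral_ge0. Qed.

Let f_int s : conditionable s -> m.-integrable setT (EFin \o f s).
Proof.
move=> /and4P[_ foo _ _]; apply: integrableP_norm => //.
by under eq_integral do rewrite ger0_norm//.
Qed.

Lemma conditionable_gt0 s : conditionable s -> 0 < marginal s.
Proof.
move=> gs; have /and4P[h _ _ _] := gs.
by move: h; rewrite (integral_EFin (f_int gs)) lte_fin.
Qed.

Lemma conditional_ge0 s x : 0 <= conditional s x.
Proof.
rewrite /conditional; case: ifPn => // _.
by rewrite divr_ge0// marginal_ge0.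
Qed.

Lemma conditionalE s x : conditionable s -> f s x = marginal s * conditional s x.
Proof.
move=> gs; rewrite /conditional gs mulrC divfK// gt_eqF//.
exact: conditionable_gt0.
Qed.

Lemma measurable_conditional :
  measurable_fun setT (fun p : S * T => conditional p.1 p.2).
Proof.
(* The inverse is written as [expR (- ln _)], a composition of measurable functions; the marginal is
   positive on the fibres where it is used. *)
rewrite (_ : (fun p => _) = fun p : S * T =>
    if conditionable p.1 then f p.1 p.2 * expR (- ln (marginal p.1)) else 1).
  apply: measurable_fun_ifT => //.
    exact: measurableT_comp measurable_conditionable measurable_fst.
  apply: measurable_funM => //; apply: measurableT_comp => //.
  apply: measurableT_comp => //.
  apply: (measurableT_comp (@measurable_ln R)).
  exact: measurableT_comp measurable_marginal measurable_fst.
apply/funext => p; rewrite /conditional; case: ifPn => // gs.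
by rewrite expRN lnK// posrE conditionable_gt0.
Qed.

Lemma measurable_conditional_sect s : measurable_fun setT (conditional s).
Proof. exact: measurable_pairl measurable_conditional. Qed.

Lemma conditional_om s : om_integrable om m (conditional s).
Proof.
split; first exact: measurable_conditional_sect.
case: (boolP (conditionable s)) => gs; last first.
  rewrite (_ : _ \o _ = EFin \o om)//.
  by apply/funext => x; rewrite /= /conditional (negbTE gs) mulr1.
have /and4P[_ _ h _] := gs.
have i : m.-integrable setT (EFin \o (fun x => om x * f s x)).
  apply: integrableP_norm; first exact: measurable_funM.
  by under eq_integral do rewrite ger0_norm//.
rewrite (_ : _ \o _ = EFin \o (fun x => (marginal s)^-1 * (om x * f s x))).
  exact: integrable_Z.
apply/funext => x; rewrite /= (conditionalE x gs); congr (_%:E); field.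
by rewrite gt_eqF// conditionable_gt0.
Qed.

Lemma conditional_total s : \int[m]_x conditional s x = 1.
Proof.
case: (boolP (conditionable s)) => gs; last first.
  rewrite -[RHS](Rintegral_cst_prob m 1); apply: eq_Rintegral => x _.
  by rewrite /conditional (negbTE gs).
have -> : \int[m]_x conditional s x = \int[m]_x ((marginal s)^-1 * f s x).
  by apply: eq_Rintegral => x _; rewrite /conditional gs mulrC.
rewrite RintegralZl//; last exact: f_int.
by rewrite mulVf// gt_eqF// conditionable_gt0.
Qed.

Let conditional_int s : m.-integrable setT (EFin \o conditional s).
Proof. exact: (om_integrable_int om1 (conditional_om s)). Qed.

(** The remainder of [psi_scale]; its integral against [m] is [psi (marginal s)]. *)
Let affine s x :=
  conditional s x * (marginal s * ln (marginal s)) + (1 - marginal s).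

Let affine_int s : m.-integrable setT (EFin \o affine s).
Proof.
apply: integrable_D; last exact: integrable_cst.
under eq_fun do rewrite mulrC; exact: integrable_Z.
Qed.

Let psi_f_int s : conditionable s ->
  m.-integrable setT (EFin \o (fun x => psi (f s x))).
Proof.
move=> /and4P[_ _ _ h]; apply: integrableP_norm.
  exact: (measurableT_comp (@measurable_psi R) (measurable_sect s)).
by under eq_integral do rewrite ger0_norm//.
Qed.

Let psi_fE s x : conditionable s ->
  psi (f s x) = marginal s * psi (conditional s x) + affine s x.
Proof.
move=> gs; rewrite (conditionalE x gs) psi_scale ?conditionable_gt0//.
  by rewrite /affine; lra.
exact: conditional_ge0.
Qed.

Lemma conditional_psi_int s :
  m.-integrable setT (EFin \o (fun x => psi (conditional s x))).
Proof.
case: (boolP (conditionable s)) => gs; last first.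
  rewrite (_ : _ \o _ = EFin \o cst 0); first exact: integrable_cst.
  by apply/funext => x; rewrite /= /conditional (negbTE gs) psi1.
rewrite (_ : _ \o _ =
    EFin \o (fun x => (marginal s)^-1 * (psi (f s x) - affine s x))).
  by apply: integrable_Z; apply: integrable_B => //; exact: psi_f_int.
apply/funext => x; rewrite /= (psi_fE x gs) addrK mulKf//.
by rewrite gt_eqF// conditionable_gt0.
Qed.

Lemma conditional_entropy_ge0 s : 0 <= conditional_entropy s.
Proof. by apply: Rintegral_ge0 => x _; exact/psi_ge0/conditional_ge0. Qed.

Lemma measurable_conditional_entropy : measurable_fun setT conditional_entropy.
Proof.
apply: (@measurable_Rintegral _ _ _ _ _ m (fun s x => psi (conditional s x))).
exact: (measurableT_comp (@measurable_psi R) measurable_conditional).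
Qed.

Let dichotomy : {ae P, forall s, conditionable s \/
  ((\int[m]_x (f s x)%:E = 0)%E /\ {ae m, forall x, f s x = 0})}.
Proof.
have a1 : {ae P, forall s, (\int[m]_x (f s x)%:E < +oo)%E}.
  apply: ge0_integral_lty_ae; first exact: mtonelli.
    by move=> s; apply: integral_ge0 => x _; rewrite lee_fin.
  by rewrite f_total ltry.
have a2 : {ae P, forall s, (\int[m]_x (om x * f s x)%:E < +oo)%E}.
  apply: ge0_integral_lty_ae => //; first exact: (@mtonelli (fun s x => om x * f s x)).
  by move=> s; apply: integral_ge0 => x _; rewrite lee_fin.
have a3 : {ae P, forall s, (\int[m]_x (psi (f s x))%:E < +oo)%E}.
  apply: ge0_integral_lty_ae => //; first exact: (@mtonelli (fun s x => psi (f s x))).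
  by move=> s; apply: integral_ge0 => x _; rewrite lee_fin.
move: a1 a2 a3; apply: filterS3 => s h1 h2 h3.
have := integral_ge0 m (fun x (_ : setT x) => f0 s x : (0 <= (f s x)%:E)%E).
rewrite le_eqVlt => /predU1P[e|pos].
  right; split; first exact/esym/e.
  have : (\int[m]_x `|(f s x)%:E| = 0)%E.
    rewrite [RHS]e; apply: eq_integral => x _ /=; by rewrite ger0_norm.
  have mfs : measurable_fun setT (fun x => (f s x)%:E) by exact/measurable_EFinP.
  move/(ae_eq_integral_abs m measurableT mfs).
  by apply: filterS => x /(_ I) [].
by left; rewrite /conditionable pos h1 h2 h3.
Qed.

(** The exceptional null set is independent of [H]; this is what allows a test function that itself
    depends on [s] in the disintegration. *)
Lemma integral_conditional : {ae P, forall s, forall H : T -> R,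
  measurable_fun setT H -> (forall x, 0 <= H x) ->
  (\int[m]_x (H x * f s x)%:E =
   (marginal s)%:E * \int[m]_x (H x * conditional s x)%:E)%E}.
Proof.
move: dichotomy; apply: filterS => s [gs|[e ae0]] H mH H0.
  rewrite -ge0_integralZl//.
  - apply: eq_integral => x _.
    by rewrite -EFinM (conditionalE x gs) mulrCA.
  - apply/measurable_EFinP; apply: measurable_funM => //.
    exact: measurable_conditional_sect.
  - by move=> x _; rewrite lee_fin mulr_ge0// conditional_ge0.
  - by rewrite lee_fin marginal_ge0.
rewrite /marginal /Rintegral e mul0e.
rewrite (@ge0_ae_eq_integral _ _ _ _ _ _ (cst 0%E)) ?integral0//.
- by apply/measurable_EFinP; exact: measurable_funM.
- by move=> x _; rewrite lee_fin mulr_ge0.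
- by apply: filterS ae0 => x fx0 _; rewrite fx0 mulr0.
Qed.

(** [psi_scale] integrated over one fibre. On a null fibre both sides are [psi 0 = 1], the default
    conditional law being multiplied by a zero marginal. *)
Lemma integral_psi_conditional : {ae P, forall s,
  (\int[m]_x (psi (f s x))%:E =
   (psi (marginal s))%:E + (marginal s * conditional_entropy s)%:E)%E}.
Proof.
move: dichotomy; apply: filterS => s [gs|[e ae0]].
  rewrite (integral_EFin (psi_f_int gs)) -EFinD; congr (_%:E).
  under eq_Rintegral do rewrite psi_fE//.
  have pi := conditional_psi_int s.
  rewrite RintegralD//; last exact: integrable_Z.
  rewrite RintegralZl// addrC; congr (_ + _).
  have ic : m.-integrable setT (EFin \o fun=> 1 - marginal s) by exact: integrable_cst.
  rewrite /affine RintegralD//; last first.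
    under eq_fun do rewrite mulrC; exact: integrable_Z.
  rewrite RintegralZr// conditional_total Rintegral_cst_prob.
  by rewrite /psi; lra.
rewrite /marginal /Rintegral e mul0r adde0.
rewrite (@ge0_ae_eq_integral _ _ _ _ _ _ (cst 1%E))//.
- rewrite integral_cst// mul1e /psi mul0r subr0 add0r; exact: probability_setT.
- apply/measurable_EFinP.
  exact: (measurableT_comp (@measurable_psi R) (measurable_sect s)).
- by move=> x _; rewrite lee_fin.
- by apply: filterS ae0 => x fx0 _; rewrite fx0 /psi mul0r subr0 add0r.
Qed.

Lemma marginal_total : (\int[P]_s (marginal s)%:E = 1)%E.
Proof.
rewrite -f_total; apply: ge0_ae_eq_integral => //.
- by apply/measurable_EFinP; exact: measurable_marginal.
- exact: mtonelli.
- by move=> s _; rewrite lee_fin marginal_ge0.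
- by move=> s _; apply: integral_ge0 => x _; rewrite lee_fin.
- move: dichotomy; apply: filterS => s [gs|[e _]] _.
    by rewrite -integral_EFin//; exact: f_int.
  by rewrite /marginal /Rintegral e.
Qed.

Lemma entropy_chain_rule : (\int[P]_s (psi (marginal s))%:E +
    \int[P]_s (marginal s * conditional_entropy s)%:E =
  \int[P]_s \int[m]_x (psi (f s x))%:E)%E.
Proof.
have mpm : measurable_fun setT (fun s => psi (marginal s)).
  exact: (measurableT_comp (@measurable_psi R) measurable_marginal).
have mme : measurable_fun setT (fun s => marginal s * conditional_entropy s).
  by apply: measurable_funM; [exact: measurable_marginal|
    exact: measurable_conditional_entropy].
have pm0 s : 0 <= psi (marginal s) by exact/psi_ge0/marginal_ge0.
have me0 s : 0 <= marginal s * conditional_entropy s.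
  by rewrite mulr_ge0 ?marginal_ge0 ?conditional_entropy_ge0.
rewrite -ge0_integralD//; try by [exact/measurable_EFinP|move=> s _; rewrite lee_fin].
apply: ge0_ae_eq_integral => //.
- by apply: emeasurable_funD; exact/measurable_EFinP.
- exact: (@mtonelli (fun s x => psi (f s x))).
- by move=> s _; rewrite -EFinD lee_fin addr_ge0.
- by move=> s _; apply: integral_ge0 => x _; rewrite lee_fin.
- by move: integral_psi_conditional; apply: filterS => s ->.
Qed.

Lemma integral_disintegration (H : S -> T -> R) :
  measurable_fun setT (fun p : S * T => H p.1 p.2) -> (forall s x, 0 <= H s x) ->
  (\int[P]_s \int[m]_x (H s x * f s x)%:E =
   \int[P]_s ((marginal s)%:E * \int[m]_x (H s x * conditional s x)%:E))%E.
Proof.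
move=> mH H0; have mc := measurable_conditional.
apply: ge0_ae_eq_integral => //.
- apply: (@mtonelli (fun s x => H s x * f s x)); first exact: measurable_funM.
  by move=> s x; rewrite mulr_ge0.
- apply: emeasurable_funM.
    by apply/measurable_EFinP; exact: measurable_marginal.
  apply: (@mtonelli (fun s x => H s x * conditional s x)); first exact: measurable_funM.
  by move=> s x; rewrite mulr_ge0// conditional_ge0.
- by move=> s _; apply: integral_ge0 => x _; rewrite lee_fin mulr_ge0.
- move=> s _; rewrite mule_ge0 ?lee_fin ?marginal_ge0//.
  by apply: integral_ge0 => x _; rewrite lee_fin mulr_ge0// conditional_ge0.
- move: integral_conditional; apply: filterS => s hs _; apply: hs => //.
  exact: measurable_pairl mH.
Qed.

End conditional_density.

Section tuple_integral.
Context {d} {T : measurableType d} {R : realType}.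
Variable m : {sigma_finite_measure set T -> \bar R}.

Lemma measurable_cons_tuple n :
  measurable_fun setT (fun p : n.-tuple T * T => [tuple of p.2 :: p.1]).
Proof.
exact: (measurable_cons measurable_snd measurable_fst).
Qed.

(** The head is integrated innermost, with the tail fixed: hence each particle is conditioned on
    those that follow it. *)
Lemma ge0_integral_tuple_power n (G : n.+1.-tuple T -> \bar R) :
  measurable_fun setT G -> (forall t, 0 <= G t)%E ->
  (\int[tuple_power m n.+1]_s G s =
   \int[tuple_power m n]_t \int[m]_x G [tuple of x :: t])%E.
Proof.
move=> mG G0; rewrite /= ge0_integral_pushforward//; last first.
  exact: measurable_tuple_cons.
rewrite preimage_setT fubini_tonelli2//; last by move=> p; exact: G0.
exact: measurableT_comp mG (@measurable_tuple_cons d T n).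
Qed.

End tuple_integral.

Lemma tuple_power_total {d} {T : measurableType d} {R : realType}
  (m : probability T R) n : tuple_power m n setT = 1%E.
Proof.
have := @tuple_power_box _ T R m n (fun=> setT) (fun=> measurableT).
rewrite (_ : mkset _ = setT); last by apply/seteqP; split.
by move=> ->; apply: big1 => i _; exact: probability_setT.
Qed.

(** * Orthogonality of the increments *)

Section decoupling.
Context {d} {T : measurableType d} {R : realType}.
Variables (om : T -> R) (m : probability T R).
Hypotheses (mom : measurable_fun setT om) (om1 : forall x, 1 <= om x)
  (omi : m.-integrable setT (EFin \o om)).

Local Notation om_int := (om_integrable om m).
Local Notation pot := (potential m).
Local Notation nrg := (energy m).

Let om0 x : 0 <= om x. Proof. exact: le_trans (om1 x). Qed.

Definition entropy_density (g : T -> R) : Prop :=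
  [/\ forall x, 0 <= g x, om_int g, \int[m]_x g x = 1 &
      m.-integrable setT (EFin \o (fun x => psi (g x)))].

Variable K : T -> T -> R.
Hypotheses (KG : kernel_growth om K) (Ksym : forall x y, K x y = K y x).
Hypothesis Kpos : forall n (t : n.-tuple T) q, om_int q -> 0 <= quad_form m K t q.

(** On the diagonal the additive growth bound gives a multiple of [om x]; the product bound would
    only give [om x ^+ 2], beyond the available moments. *)
Lemma energy_diag_int g : om_int g ->
  m.-integrable setT (EFin \o (fun x => K x x * g x)).
Proof.
move=> ig; have [mK [C KC]] := KG.
apply: (@om_integrableM _ _ _ _ om1 _ (2 * C)) => //.
  have mp : measurable_fun setT (fun x : T => (x, x)) by exact: measurable_fun_pair.
  exact: (measurableT_comp mK mp).
move=> x; have -> : 2 * C * om x = C * (om x + om x) by ring.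
exact: KC.
Qed.

Section cons.
Variables (n : nat) (t : n.-tuple T) (g q : T -> R).
Hypotheses (g0 : forall x, 0 <= g x) (ig : om_int g) (g1 : \int[m]_x g x = 1)
  (iq : om_int q).

(** The squared norm of [\delta_x - g m]. *)
Let K_self x := K x x - 2 * pot K g x + nrg K g g.

Let K_cross x := \sum_(j < n) K x (tnth t j) + pot K q x.

(** Expands the form when the increment [\delta_x - g m] is added to [\sum_j \delta_{t_j} + q m].
    The cross term is [K_cross] minus its mean under [g]. *)
Lemma quad_form_cons x :
  quad_form m K [tuple of x :: t] (fun y => (-1) * g y + q y) =
  K_self x + 2 * (K_cross x - \int[m]_y (K_cross y * g y)) +
  quad_form m K t q.
Proof.
have ing : om_int (fun y => -1 * g y) by exact: om_integrableZ.
have -> : \int[m]_y (K_cross y * g y) =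
    \sum_(j < n) pot K g (tnth t j) + nrg K g q.
  under eq_Rintegral do rewrite mulrDl mulr_suml.
  have ij j := kernel_intr om1 KG (tnth t j) ig.
  rewrite RintegralD//; last 2 first.
  - by apply: integrable_Rsum.
  - exact: (potential_int om1 KG ig iq).
  rewrite Rintegral_sum//; congr (_ + _); apply: eq_bigr => j _.
  by apply: eq_Rintegral => y _; rewrite Ksym.
have potE y : pot K (fun y => -1 * g y + q y) y = - pot K g y + pot K q y.
  by rewrite (potentialD om1 KG)// (potentialZ om1 KG)// mulN1r.
have tS i : tnth [tuple of x :: t] (lift ord0 i) = tnth t i by rewrite tnthS.
have atoms : \sum_(i < n.+1) \sum_(j < n.+1)
      K (tnth [tuple of x :: t] i) (tnth [tuple of x :: t] j) =
    K x x + 2 * (\sum_(j < n) K x (tnth t j)) +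
    \sum_(i < n) \sum_(j < n) K (tnth t i) (tnth t j).
  rewrite big_ord_recl tnth0 big_ord_recl tnth0.
  under [X in K x x + X]eq_bigr do rewrite tS.
  under [X in _ + X]eq_bigr => i _.
    rewrite big_ord_recl tnth0 tS Ksym.
    under eq_bigr do rewrite tS.
    over.
  by rewrite big_split/=; ring.
have pots : \sum_(i < n.+1)
      pot K (fun y => -1 * g y + q y) (tnth [tuple of x :: t] i) =
    - pot K g x + pot K q x - \sum_(i < n) pot K g (tnth t i) +
    \sum_(i < n) pot K q (tnth t i).
  rewrite big_ord_recl tnth0 potE.
  under eq_bigr do rewrite tS potE.
  by rewrite big_split/= sumrN !addrA.
rewrite /quad_form atoms pots.
rewrite (energyDl om1 KG) ?(energyDr om1 KG)//; last exact: om_integrableD.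
rewrite !(energyZl om1 KG) ?(energyZr om1 KG)//.
rewrite (energyC om1 KG Ksym iq ig) /K_self /K_cross.
by ring.
Qed.

(** The centred cross term integrates to zero, which is the orthogonality of martingale differences;
    the new increment contributes only its variance. *)
Lemma quad_form_cons_int :
  m.-integrable setT (EFin \o (fun x =>
    quad_form m K [tuple of x :: t] (fun y => (-1) * g y + q y) * g x)) /\
  \int[m]_x (quad_form m K [tuple of x :: t] (fun y => (-1) * g y + q y) * g x) =
  \int[m]_x (K x x * g x) - nrg K g g + quad_form m K t q.
Proof.
have gi := om_integrable_int om1 ig.
have kd := energy_diag_int ig.
have pg := potential_int om1 KG ig ig.
have pq := potential_int om1 KG ig iq.
have kc : m.-integrable setT (EFin \o (fun x => K_cross x * g x)).
  under eq_fun do rewrite /K_cross mulrDl mulr_suml.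
  apply: integrable_D => //; apply: integrable_Rsum => j.
  exact: (kernel_intr om1 KG).
set kappa := \int[m]_y (K_cross y * g y).
pose c := nrg K g g - 2 * kappa + quad_form m K t q.
have E x : quad_form m K [tuple of x :: t] (fun y => (-1) * g y + q y) * g x =
    K x x * g x + (-2) * (pot K g x * g x) + (2 * (K_cross x * g x) + c * g x).
  by rewrite quad_form_cons /K_self /c -/kappa; ring.
have i1 := integrable_Z (-2) pg; have i2 := integrable_Z 2 kc.
have i3 := integrable_Z c gi.
have i4 := integrable_D kd i1; have i5 := integrable_D i2 i3.
split; first by under eq_fun do rewrite E; exact: integrable_D.
under eq_Rintegral do rewrite E.
rewrite (RintegralD measurableT i4 i5) (RintegralD measurableT kd i1).
rewrite (RintegralD measurableT i2 i3) !RintegralZl// g1 /c /kappa.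
by rewrite -/(nrg K g g); ring.
Qed.

End cons.

Lemma measurable_quad_form n (q : n.-tuple T -> T -> R) :
  measurable_fun setT (fun p : n.-tuple T * T => q p.1 p.2) ->
  measurable_fun setT (fun t => quad_form m K t (q t)).
Proof.
move=> mq; have [mK _] := KG.
have mKt i j : measurable_fun setT
    (fun t : n.-tuple T => K (tnth t i) (tnth t j)).
  exact: (measurableT_comp mK
    (measurable_fun_pair (measurable_tnth i) (measurable_tnth j))).
have mpot i : measurable_fun setT (fun t => pot K (q t) (tnth t i)).
  apply: (@measurable_Rintegral _ _ _ _ _ m
    (fun (t : n.-tuple T) y => K (tnth t i) y * q t y)).
  apply: measurable_funM => //.
  exact: (measurableT_comp mK (measurable_fun_pair
    (measurableT_comp (measurable_tnth i) measurable_fst) measurable_snd)).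
have mnrg : measurable_fun setT (fun t => nrg K (q t) (q t)).
  apply: (@measurable_Rintegral _ _ _ _ _ m (fun t x => pot K (q t) x * q t x)).
  apply: measurable_funM => //.
  apply: (@measurable_Rintegral _ _ _ _ _ m
    (fun (p : n.-tuple T * T) y => K p.2 y * q p.1 y)).
  apply: measurable_funM.
    exact: (measurableT_comp mK (measurable_fun_pair
      (measurableT_comp measurable_snd measurable_fst) measurable_snd)).
  exact: (measurableT_comp mq (measurable_fun_pair
    (measurableT_comp measurable_fst measurable_fst) measurable_snd)).
apply: measurable_funD => //; apply: measurable_funD.
  by apply: measurable_sum => i; apply: measurable_sum => j.
by apply: measurable_funM => //; apply: measurable_sum.
Qed.

End decoupling.

(** * Induction on the number of particles *)

Section decoupling_induction.
Context {d} {T : measurableType d} {R : realType}.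
Variables (om : T -> R) (m : probability T R).
Hypotheses (mom : measurable_fun setT om) (om1 : forall x, 1 <= om x)
  (omi : m.-integrable setT (EFin \o om)).

Local Notation om_int := (om_integrable om m).
Local Notation nrg := (energy m).

Let om0 x : 0 <= om x. Proof. exact: le_trans (om1 x). Qed.

Variable K : T -> T -> R.
Hypotheses (KG : kernel_growth om K) (Ksym : forall x y, K x y = K y x).
Hypothesis Kpos : forall n (t : n.-tuple T) q, om_int q -> 0 <= quad_form m K t q.

Variables alpha beta : R.
Hypotheses (alpha0 : 0 <= alpha) (beta0 : 0 <= beta).
Hypothesis variance : forall g, entropy_density om m g ->
  \int[m]_x (K x x * g x) - nrg K g g <= alpha + beta * \int[m]_x psi (g x).

(* [gam t / n] is the density of the average over [i] of the law of the [i]-th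
   particle conditioned on the particles that follow it, and [h] bounds the sum
   of the entropies of these conditional laws. *)
Definition decoupled n (f : n.-tuple T -> R) (gam : n.-tuple T -> T -> R)
    (h : n.-tuple T -> R) : Prop :=
  [/\ [/\ measurable_fun setT (fun p : n.-tuple T * T => gam p.1 p.2),
          forall t x, 0 <= gam t x, forall t, om_int (gam t),
          forall t, \int[m]_x gam t x = n%:R &
          n = 0%N -> forall t x, gam t x = 0],
      [/\ measurable_fun setT h, forall t, 0 <= h t,
          forall t, m.-integrable setT (EFin \o (fun x => psi (gam t x / n%:R))) &
          forall t, n%:R * \int[m]_x psi (gam t x / n%:R) <= h t],
      (\int[tuple_power m n]_t (h t * f t)%:E <=
       \int[tuple_power m n]_t (psi (f t))%:E)%E &
      (\int[tuple_power m n]_t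
         (quad_form m K t (fun y => (-1) * gam t y) * f t)%:E <=
       (n%:R * alpha)%:E +
       beta%:E * \int[tuple_power m n]_t (psi (f t))%:E)%E].

Lemma decoupling0 (f : 0.-tuple T -> R) : (forall t, 0 <= f t) ->
  exists gam h, decoupled f gam h.
Proof.
move=> f0; exists (fun _ _ => 0), (fun=> 0).
have psi0 : (0 <= \int[tuple_power m 0]_t (psi (f t))%:E)%E.
  by apply: integral_ge0 => t _; rewrite lee_fin psi_ge0.
split.
- split=> // t; first exact: om_integrable_cst.
  exact: Rintegral_cst_prob.
- split=> // t; last by rewrite mul0r.
  exact: integrable_cst.
- by under eq_integral do rewrite mul0r; rewrite integral0.
- rewrite (eq_integral (cst 0%E)); last first.
    move=> t _; rewrite /quad_form !big_ord0 /energy.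
    have -> : \int[m]_x (potential m K (fun=> -1 * 0) x * (-1 * 0)) = \int[m]_x 0.
      by apply: eq_Rintegral => x _; rewrite !mulr0.
    by rewrite Rintegral_cst_prob mulr0 !addr0 mul0r.
  by rewrite integral0 mul0r add0e mule_ge0.
Qed.

(** The induction hypothesis is applied to the density of the tail; the conditional density of the
    head is then added to [gam] and its entropy to [h]. *)
Lemma decouplingS n (f : n.+1.-tuple T -> R) :
  (forall f' : n.-tuple T -> R,
    measurable_fun setT f' -> (forall t, 0 <= f' t) ->
    (\int[tuple_power m n]_t (f' t)%:E = 1)%E ->
    (\int[tuple_power m n]_t ((\sum_(i < n) om (tnth t i)) * f' t)%:E < +oo)%E ->
    (\int[tuple_power m n]_t (psi (f' t))%:E < +oo)%E ->
    exists gam h, decoupled f' gam h) ->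
  measurable_fun setT f -> (forall t, 0 <= f t) ->
  (\int[tuple_power m n.+1]_t (f t)%:E = 1)%E ->
  (\int[tuple_power m n.+1]_t ((\sum_(i < n.+1) om (tnth t i)) * f t)%:E < +oo)%E ->
  (\int[tuple_power m n.+1]_t (psi (f t))%:E < +oo)%E ->
  exists gam h, decoupled f gam h.
Proof.
move=> IH mf f0 f1 fom fpsi.
pose fs (t : n.-tuple T) x := f [tuple of x :: t].
have mcons := @measurable_cons_tuple d T n.
have mfs : measurable_fun setT (fun p : n.-tuple T * T => fs p.1 p.2).
  exact: measurableT_comp mf mcons.
have fs0 t x : 0 <= fs t x by exact: f0.
have mpsi : measurable_fun setT (fun t => psi (f t)).
  exact: (measurableT_comp (@measurable_psi R) mf).
have psi_f0 t : 0 <= psi (f t) by exact/psi_ge0/f0.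
have tS x (t : n.-tuple T) i : tnth [tuple of x :: t] (lift ord0 i) = tnth t i.
  by rewrite tnthS.
have mS k : measurable_fun setT (fun t : k.-tuple T => \sum_(i < k) om (tnth t i)).
  apply: measurable_sum => i.
  exact: (measurableT_comp mom (measurable_tnth i)).
have S0 k (t : k.-tuple T) : 0 <= \sum_(i < k) om (tnth t i) by exact: sumr_ge0.
have mSf : measurable_fun setT (fun t => (\sum_(i < n.+1) om (tnth t i)) * f t).
  exact: (measurable_funM (mS n.+1) mf).
have tot : (\int[tuple_power m n]_t \int[m]_x (fs t x)%:E = 1)%E.
  rewrite -f1 ge0_integral_tuple_power//; exact/measurable_EFinP.
have psiE : (\int[tuple_power m n.+1]_t (psi (f t))%:E =
    \int[tuple_power m n]_t \int[m]_x (psi (fs t x))%:E)%E.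
  rewrite ge0_integral_tuple_power//; exact/measurable_EFinP.
have omE : (\int[tuple_power m n]_t \int[m]_x (om x * fs t x)%:E +
    \int[tuple_power m n]_t \int[m]_x ((\sum_(i < n) om (tnth t i)) * fs t x)%:E =
    \int[tuple_power m n.+1]_t ((\sum_(i < n.+1) om (tnth t i)) * f t)%:E)%E.
  rewrite ge0_integral_tuple_power//; last 2 first.
  - exact/measurable_EFinP.
  - by move=> t; rewrite lee_fin mulr_ge0.
  have m1 : measurable_fun setT (fun p : n.-tuple T * T => om p.2 * fs p.1 p.2).
    by apply: measurable_funM => //; exact: measurableT_comp mom measurable_snd.
  have m2 : measurable_fun setT (fun p : n.-tuple T * T =>
      (\sum_(i < n) om (tnth p.1 i)) * fs p.1 p.2).
    by apply: measurable_funM => //; exact: measurableT_comp (mS n) measurable_fst.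
  rewrite -ge0_integralD//; last 4 first.
  - by move=> t _; apply: integral_ge0 => x _; rewrite lee_fin mulr_ge0.
  - apply: (measurable_fun_fubini_tonelli_F
      (fun p : n.-tuple T * T => (om p.2 * fs p.1 p.2)%:E)).
      exact/measurable_EFinP.
    by move=> p; rewrite lee_fin mulr_ge0.
  - by move=> t _; apply: integral_ge0 => x _; rewrite lee_fin mulr_ge0.
  - apply: (measurable_fun_fubini_tonelli_F
      (fun p : n.-tuple T * T => ((\sum_(i < n) om (tnth p.1 i)) * fs p.1 p.2)%:E)).
      exact/measurable_EFinP.
    by move=> p; rewrite lee_fin mulr_ge0.
  apply: eq_integral => t _; rewrite -ge0_integralD//; last 4 first.
  - by move=> x _; rewrite lee_fin mulr_ge0.
  - apply/measurable_EFinP.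
    exact: (@measurable_pairl _ _ _ _ _ (fun t x => om x * fs t x) t m1).
  - by move=> x _; rewrite lee_fin mulr_ge0.
  - apply/measurable_EFinP.
    exact: (@measurable_pairl _ _ _ _ _
      (fun (t : n.-tuple T) x => (\sum_(i < n) om (tnth t i)) * fs t x) t m2).
  apply: eq_integral => x _; rewrite -EFinD -mulrDl big_ord_recl tnth0.
  congr ((_ + _) * _)%:E; apply: eq_bigr => i _; by rewrite tS.
have om_ge0 : (0 <= \int[tuple_power m n]_t \int[m]_x
    ((\sum_(i < n) om (tnth t i)) * fs t x)%:E)%E.
  by apply: integral_ge0 => t _; apply: integral_ge0 => x _; rewrite lee_fin mulr_ge0.
have fs_om : (\int[tuple_power m n]_t \int[m]_x (om x * fs t x)%:E < +oo)%E.
  by apply: le_lt_trans fom; rewrite -omE leeDl.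
have fs_psi : (\int[tuple_power m n]_t \int[m]_x (psi (fs t x))%:E < +oo)%E.
  by rewrite -psiE.
pose mg := marginal m fs; pose cd := conditional om m fs.
pose ce := conditional_entropy om m fs.
have mmg : measurable_fun setT mg by exact: measurable_marginal.
have mg0 t : 0 <= mg t by exact: marginal_ge0.
have mcd : measurable_fun setT (fun p : n.-tuple T * T => cd p.1 p.2).
  exact: measurable_conditional.
have cd0 t x : 0 <= cd t x by exact: conditional_ge0.
have cd_om t : om_int (cd t) by exact: conditional_om.
have cd1 t : \int[m]_x cd t x = 1 by exact: conditional_total.
have cdpsi t : m.-integrable setT (EFin \o (fun x => psi (cd t x))).
  exact: conditional_psi_int.
have mce : measurable_fun setT ce by exact: measurable_conditional_entropy.
have ce0 t : 0 <= ce t by exact: conditional_entropy_ge0.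
have mg1 : (\int[tuple_power m n]_t (mg t)%:E = 1)%E.
  exact: (marginal_total mom om1 mfs fs0 tot fs_om fs_psi).
have chain : (\int[tuple_power m n]_t (psi (mg t))%:E +
    \int[tuple_power m n]_t (mg t * ce t)%:E =
    \int[tuple_power m n.+1]_t (psi (f t))%:E)%E.
  rewrite psiE.
  exact: (entropy_chain_rule mom om1 omi mfs fs0 tot fs_om fs_psi).
have mge0 : (0 <= \int[tuple_power m n]_t (mg t * ce t)%:E)%E.
  by apply: integral_ge0 => t _; rewrite lee_fin mulr_ge0.
have mgpsi : (\int[tuple_power m n]_t (psi (mg t))%:E < +oo)%E.
  by apply: le_lt_trans fpsi; rewrite -chain leeDl.
have disint (H : n.-tuple T -> T -> R) :
    measurable_fun setT (fun p : n.-tuple T * T => H p.1 p.2) ->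
    (forall t x, 0 <= H t x) ->
    (\int[tuple_power m n]_t \int[m]_x (H t x * fs t x)%:E =
     \int[tuple_power m n]_t ((mg t)%:E * \int[m]_x (H t x * cd t x)%:E))%E.
  exact: (integral_disintegration mom om1 mfs fs0 tot fs_om fs_psi).
have mgom : (\int[tuple_power m n]_t
    ((\sum_(i < n) om (tnth t i)) * mg t)%:E < +oo)%E.
  apply: (@le_lt_trans _ _ (\int[tuple_power m n]_t \int[m]_x
      ((\sum_(i < n) om (tnth t i)) * fs t x)%:E)%E); last first.
    by apply: le_lt_trans fom; rewrite -omE leeDr//; apply: integral_ge0 => t _;
      apply: integral_ge0 => x _; rewrite lee_fin mulr_ge0.
  (* The weight of the tail is constant on a fibre, where the conditional density has integral 1. *)
  rewrite (disint (fun t x => \sum_(i < n) om (tnth t i)))//; last first.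
    exact: measurableT_comp (mS n) measurable_fst.
  rewrite le_eqVlt; apply/orP; left; apply/eqP; apply: eq_integral => t _.
  have ci := om_integrable_int om1 (cd_om t).
  rewrite integral_EFin; last exact: integrable_Z.
  by rewrite RintegralZl// cd1 mulr1 -EFinM mulrC.
have [gam [h [[mgam gam0 gam_om gam1 gamn0] [mh h0 psii hE] hle qle]]] :=
  IH mg mmg mg0 mg1 mgom mgpsi.
pose bt (s : n.+1.-tuple T) : n.-tuple T := [tuple of behead s].
have btE x (t : n.-tuple T) : bt [tuple of x :: t] = t by exact/val_inj.
have mbt : measurable_fun setT bt by exact: measurable_behead.
exists (fun s y => cd (bt s) y + gam (bt s) y), (fun s => ce (bt s) + h (bt s)).
have mpair : measurable_fun setT (fun p : n.+1.-tuple T * T => (bt p.1, p.2)).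
  by apply: measurable_fun_pair => //; exact: measurableT_comp mbt measurable_fst.
have mgam' : measurable_fun setT
    (fun p : n.+1.-tuple T * T => cd (bt p.1) p.2 + gam (bt p.1) p.2).
  apply: measurable_funD; first exact: (measurableT_comp mcd mpair).
  exact: (measurableT_comp mgam mpair).
have mean t x : n.+1%:R * psi ((cd t x + gam t x) / n.+1%:R) <=
    psi (cd t x) + n%:R * psi (gam t x / n%:R).
  by apply: psi_mean => // n0; exact: gamn0.
have psi'i t : m.-integrable setT
    (EFin \o (fun x => psi ((cd t x + gam t x) / n.+1%:R))).
  apply: integrable_dominated (integrable_D (cdpsi t) (integrable_Z n%:R (psii t))).
    apply: (measurableT_comp (@measurable_psi R)); apply: measurable_funM => //.
    apply: measurable_funD; first exact: measurable_pairl mcd.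
    exact: measurable_pairl mgam.
  move=> x; apply: le_trans (mean t x).
  rewrite ger0_norm ?psi_ge0 ?divr_ge0 ?addr_ge0//.
  by rewrite ler_peMl ?ler1n// psi_ge0 ?divr_ge0 ?addr_ge0.
split.
- split=> //.
  + by move=> s x; rewrite addr_ge0.
  + by move=> s; exact: om_integrableD.
  + move=> s; rewrite RintegralD//.
    * by rewrite cd1 gam1 -natr1 addrC.
    * exact: (om_integrable_int om1 (cd_om _)).
    * exact: (om_integrable_int om1 (gam_om _)).
- split=> //.
  + by apply: measurable_funD; exact: measurableT_comp mbt.
  + by move=> s; rewrite addr_ge0.
  + move=> s; set t := bt s.
    rewrite -RintegralZl//.
    apply: (@le_trans _ _ (\int[m]_x (psi (cd t x) + n%:R * psi (gam t x / n%:R)))).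
      apply: le_Rintegral => //; first exact: integrable_Z.
      by apply: integrable_D => //; exact: integrable_Z.
    rewrite RintegralD//; last exact: integrable_Z.
    by rewrite RintegralZl// lerD2l.
- rewrite ge0_integral_tuple_power; last 2 first.
  + apply/measurable_EFinP; apply: measurable_funM => //.
    by apply: measurable_funD; exact: measurableT_comp mbt.
  + by move=> t; rewrite lee_fin mulr_ge0// addr_ge0.
  under eq_integral => t _ do under eq_integral => x _ do rewrite !btE -/(fs t x).
  rewrite (disint (fun t x => ce t + h t)); last 2 first.
  + apply: (measurableT_comp (measurable_funD mce mh)); exact: measurable_fst.
  + by move=> t x; rewrite addr_ge0.
  have -> : (\int[tuple_power m n]_t
      ((mg t)%:E * \int[m]_x ((ce t + h t) * cd t x)%:E) =
      \int[tuple_power m n]_t (mg t * ce t)%:E +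
      \int[tuple_power m n]_t (h t * mg t)%:E)%E.
    rewrite -ge0_integralD//; last 4 first.
    * by move=> t _; rewrite lee_fin mulr_ge0.
    * by apply/measurable_EFinP; exact: measurable_funM.
    * by move=> t _; rewrite lee_fin mulr_ge0.
    * by apply/measurable_EFinP; exact: measurable_funM.
    apply: eq_integral => t _.
    have ci := om_integrable_int om1 (cd_om t).
    rewrite integral_EFin; last exact: integrable_Z.
    by rewrite RintegralZl// cd1 mulr1 -EFinM -EFinD mulrDr [mg t * h t]mulrC.
  by rewrite -chain addeC leeD2r.
- pose q t y := -1 * gam t y.
  have qE s : (fun y => -1 * (cd (bt s) y + gam (bt s) y)) =
      (fun y => -1 * cd (bt s) y + q (bt s) y).
    by apply/funext => y; rewrite mulrDr.
  have q_om t : om_int (q t) by exact: om_integrableZ.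
  (* The disintegration is stated for nonnegative integrands; positivity of [K] makes it applicable
     to the quadratic form. *)
  pose Q s := quad_form m K s (fun y => -1 * cd (bt s) y + q (bt s) y).
  have Q0 s : 0 <= Q s.
    by apply: Kpos; apply: om_integrableD => //; exact: om_integrableZ.
  have mq : measurable_fun setT (fun p : n.-tuple T * T => q p.1 p.2).
    exact: measurable_funM.
  have mQ : measurable_fun setT Q.
    apply: (@measurable_quad_form _ _ _ om m K KG n.+1
      (fun s y => -1 * cd (bt s) y + q (bt s) y)).
    apply: measurable_funD; last exact: (measurableT_comp mq mpair).
    by apply: measurable_funM => //; exact: (measurableT_comp mcd mpair).
  have -> : (\int[tuple_power m n.+1]_s (quad_form m K s
      (fun y => -1 * (cd (bt s) y + gam (bt s) y)) * f s)%:E =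
      \int[tuple_power m n.+1]_s (Q s * f s)%:E)%E.
    by apply: eq_integral => s _; rewrite qE.
  rewrite ge0_integral_tuple_power; last 2 first.
  + by apply/measurable_EFinP; exact: measurable_funM.
  + by move=> t; rewrite lee_fin mulr_ge0.
  rewrite (disint (fun t x => Q [tuple of x :: t])); last 2 first.
  + exact: (measurableT_comp mQ mcons).
  + by [].
  pose D t := quad_form m K t (q t).
  have D0 t : 0 <= D t by exact: Kpos.
  have mD : measurable_fun setT D by exact: (@measurable_quad_form _ _ _ om m K KG n q).
  have -> : (\int[tuple_power m n]_t
      ((mg t)%:E * \int[m]_x (Q [tuple of x :: t] * cd t x)%:E) =
      \int[tuple_power m n]_t (mg t * (\int[m]_x (K x x * cd t x) -
        nrg K (cd t) (cd t) + D t))%:E)%E.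
    apply: eq_integral => t _; rewrite EFinM; congr (_ * _)%E.
    have [Qi QE] := quad_form_cons_int om1 KG Ksym t (cd_om t) (cd1 t) (q_om t).
    rewrite -QE -integral_EFin//; apply: eq_integral => x _.
    by rewrite /Q btE.
  (* The variance hypothesis is used fibrewise, for the conditional law of the head, and weighted by
     the marginal; the form [D] of the tail is left to the induction hypothesis. *)
  apply: (@le_trans _ _ (\int[tuple_power m n]_t
      ((alpha * mg t)%:E + ((beta * (mg t * ce t))%:E + (D t * mg t)%:E)))%E).
    apply: ge0_le_integral => //.
    + move=> t _; rewrite lee_fin mulr_ge0//.
      have [_ <-] := quad_form_cons_int om1 KG Ksym t (cd_om t) (cd1 t) (q_om t).
      apply: Rintegral_ge0 => x _; rewrite mulr_ge0//.
      by have := Q0 [tuple of x :: t]; rewrite /Q btE.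
    + have mKx : measurable_fun setT (fun t => \int[m]_x (K x x * cd t x)).
        apply: (@measurable_Rintegral _ _ _ _ _ m (fun t x => K x x * cd t x)).
        apply: measurable_funM => //.
        exact: (measurableT_comp KG.1 (measurable_fun_pair measurable_snd measurable_snd)).
      have mnrg : measurable_fun setT (fun t => nrg K (cd t) (cd t)).
        apply: (@measurable_Rintegral _ _ _ _ _ m
          (fun t x => potential m K (cd t) x * cd t x)).
        apply: measurable_funM => //.
        apply: (@measurable_Rintegral _ _ _ _ _ m
          (fun (p : n.-tuple T * T) y => K p.2 y * cd p.1 y)).
        apply: measurable_funM.
          exact: (measurableT_comp KG.1 (measurable_fun_pair
            (measurableT_comp measurable_snd measurable_fst) measurable_snd)).
        exact: (measurableT_comp mcd (measurable_fun_pair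
          (measurableT_comp measurable_fst measurable_fst) measurable_snd)).
      apply/measurable_EFinP; apply: measurable_funM => //.
      by apply: measurable_funD => //; exact: measurable_funB.
    + apply: emeasurable_funD.
        by apply/measurable_EFinP; exact: measurable_funM.
      apply: emeasurable_funD; apply/measurable_EFinP; last exact: measurable_funM.
      by apply: measurable_funM => //; exact: measurable_funM.
    + move=> t _; rewrite -!EFinD lee_fin.
      have := @variance (cd t) (And4 (cd0 t) (cd_om t) (cd1 t) (cdpsi t)).
      rewrite -/(ce t); move: (_ - _) => v hv.
      rewrite -subr_ge0 (_ : _ - _ = mg t * (alpha + beta * ce t - v)); last by ring.
      by rewrite mulr_ge0// subr_ge0.
  have mamg : measurable_fun setT (fun t => (alpha * mg t)%:E).
    by apply/measurable_EFinP; exact: measurable_funM.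
  have mbce : measurable_fun setT (fun t => (beta * (mg t * ce t))%:E).
    by apply/measurable_EFinP; apply: measurable_funM => //; exact: measurable_funM.
  have mDmg : measurable_fun setT (fun t => (D t * mg t)%:E).
    by apply/measurable_EFinP; exact: measurable_funM.
  have a0 t : (0 <= (alpha * mg t)%:E)%E by rewrite lee_fin mulr_ge0.
  have b0 t : (0 <= (beta * (mg t * ce t))%:E)%E by rewrite lee_fin !mulr_ge0.
  have d0 t : (0 <= (D t * mg t)%:E)%E by rewrite lee_fin mulr_ge0.
  rewrite ge0_integralD//; last 2 first.
  + by move=> t _; rewrite adde_ge0.
  + exact: emeasurable_funD.
  rewrite ge0_integralD//.
  under eq_integral do rewrite EFinM.
  rewrite ge0_integralZl//; [|exact/measurable_EFinP|by move=> t _; rewrite lee_fin].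
  rewrite mg1 mule1.
  under [X in (_ + (X + _))%E]eq_integral do rewrite EFinM.
  rewrite ge0_integralZl//; last 2 first.
  + by apply/measurable_EFinP; exact: measurable_funM.
  + by move=> t _; rewrite lee_fin mulr_ge0.
  rewrite -chain [X in (_ <= _ + X)%E]ge0_muleDr//; last first.
    by apply: integral_ge0 => t _; rewrite lee_fin psi_ge0.
  have := qle; rewrite -/D; set ep := (beta%:E * \int[_]__ (psi _)%:E)%E.
  set eb := (beta%:E * _)%E => hD.
  apply: (@le_trans _ _ (alpha%:E + (eb + ((n%:R * alpha)%:E + ep)))%E).
    by rewrite leeD2l// leeD2l.
  rewrite -natr1 mulrDl mul1r EFinD.
  have AC (a b c e : \bar R) : (a + (b + (c + e)) = c + a + (e + b))%E.
    by rewrite [(b + (c + e))%E]addeCA (addeA a c) (addeC a c) (addeC b e).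
  by rewrite AC.
Qed.

Lemma decoupling n (f : n.-tuple T -> R) :
  measurable_fun setT f -> (forall t, 0 <= f t) ->
  (\int[tuple_power m n]_t (f t)%:E = 1)%E ->
  (\int[tuple_power m n]_t ((\sum_(i < n) om (tnth t i)) * f t)%:E < +oo)%E ->
  (\int[tuple_power m n]_t (psi (f t))%:E < +oo)%E ->
  exists gam h, decoupled f gam h.
Proof.
elim: n f => [f _ f0 _ _ _|n IH f]; first exact: decoupling0.
exact: decouplingS.
Qed.

End decoupling_induction.

(** * From the particle energy to the mean-field energy *)

Section mean_field_bound.
Context {d} {T : measurableType d} {R : realType}.
Variables (om : T -> R) (m : probability T R).
Hypotheses (mom : measurable_fun setT om) (om1 : forall x, 1 <= om x)
  (omi : m.-integrable setT (EFin \o om)).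

Local Notation om_int := (om_integrable om m).
Local Notation pot := (potential m).
Local Notation nrg := (energy m).

Let om0 x : 0 <= om x. Proof. exact: le_trans (om1 x). Qed.

Lemma kernel_growthD U U' : kernel_growth om U -> kernel_growth om U' ->
  kernel_growth om (fun x y => U x y + U' x y).
Proof.
move=> [mU [C UC]] [mU' [C' UC']]; split; first exact: measurable_funD.
exists (C + C') => x y; rewrite mulrDl.
by apply: le_trans (ler_normD _ _) _; rewrite lerD.
Qed.

Lemma potential_kernelD U U' q x : kernel_growth om U -> kernel_growth om U' ->
  om_int q -> pot (fun x y => U x y + U' x y) q x = pot U q x + pot U' q x.
Proof.
move=> UG UG' iq; rewrite /potential -RintegralD//;
  [|exact: (kernel_intl om1 UG)|exact: (kernel_intl om1 UG')].
by apply: eq_Rintegral => y _; rewrite mulrDl.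
Qed.

Lemma energy_kernelD U U' p q : kernel_growth om U -> kernel_growth om U' ->
  om_int p -> om_int q ->
  nrg (fun x y => U x y + U' x y) p q = nrg U p q + nrg U' p q.
Proof.
move=> UG UG' ip iq; rewrite /energy -RintegralD//;
  [|exact: (potential_int om1 UG)|exact: (potential_int om1 UG')].
by apply: eq_Rintegral => y _; rewrite potential_kernelD// mulrDl.
Qed.

Lemma quad_form_kernelD U U' n (t : n.-tuple T) q :
  kernel_growth om U -> kernel_growth om U' -> om_int q ->
  quad_form m (fun x y => U x y + U' x y) t q =
  quad_form m U t q + quad_form m U' t q.
Proof.
move=> UG UG' iq; rewrite /quad_form energy_kernelD//.
under eq_bigr do rewrite big_split/=.
rewrite big_split/=.
under [X in _ + 2 * X + _]eq_bigr do rewrite potential_kernelD//.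
have AC (a b c e x y : R) : a + b + 2 * (c + e) + (x + y) =
  a + 2 * c + x + (b + 2 * e + y) by ring.
by rewrite big_split/= AC.
Qed.

Lemma quad_formZ U n (t : n.-tuple T) s q : kernel_growth om U -> om_int q ->
  quad_form m U t (fun y => s * q y) =
  \sum_(i < n) \sum_(j < n) U (tnth t i) (tnth t j) +
  2 * (s * \sum_(i < n) pot U q (tnth t i)) + s ^+ 2 * nrg U q q.
Proof.
move=> UG iq; rewrite /quad_form.
rewrite (energyZl om1 UG) ?(energyZr om1 UG)//; last exact: om_integrableZ.
under [X in _ + 2 * X + _]eq_bigr do rewrite (potentialZ om1 UG)//.
by rewrite -mulr_sumr expr2 -mulrA.
Qed.

Variables Up Um : T -> T -> R.
Let K x y := Up x y + Um x y.
Hypotheses (UpG : kernel_growth om Up) (UmG : kernel_growth om Um)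
  (Up_sym : forall x y, Up x y = Up y x) (Um_sym : forall x y, Um x y = Um y x)
  (Up_pos : forall n (t : n.-tuple T) q, om_int q -> 0 <= quad_form m Up t q)
  (Um_pos : forall n (t : n.-tuple T) q, om_int q -> 0 <= quad_form m Um t q).

(* Cauchy-Schwarz for two positive forms, in the guise of their positivity at
   \sum_i \delta_{t_i} - q + eta q and \sum_i \delta_{t_i} - q - eta q. *)
Lemma quad_form_gap n (t : n.-tuple T) q eta : 0 < eta -> om_int q ->
  nrg Up q q - nrg Um q q - eta * (nrg Up q q + nrg Um q q) -
    (1 + eta^-1) * quad_form m K t (fun y => (-1) * q y) <=
  \sum_(i < n) \sum_(j < n) (Up (tnth t i) (tnth t j) - Um (tnth t i) (tnth t j)).
Proof.
move=> eta0 iq.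
have iq1 : om_int (fun y => -1 * q y) by exact: om_integrableZ.
have iq2 : om_int (fun y => (eta - 1) * q y) by exact: om_integrableZ.
have iq3 : om_int (fun y => (- eta - 1) * q y) by exact: om_integrableZ.
have := Up_pos t iq2; have := Um_pos t iq3.
have := Up_pos t iq1; have := Um_pos t iq1.
rewrite quad_form_kernelD// !quad_formZ//.
under [X in _ -> _ -> _ -> _ -> _ <= X]eq_bigr do rewrite sumrB.
rewrite sumrB.
set Cp := \sum_(i < n) \sum_(j < n) Up _ _.
set Cm := \sum_(i < n) \sum_(j < n) Um _ _.
set Bp := \sum_(i < n) pot Up _ _; set Bm := \sum_(i < n) pot Um _ _.
set Ap := nrg Up q q; set Am := nrg Um q q.
clearbody Cp Cm Bp Bm Ap Am => Dm0 Dp0 hm hp.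
have em : eta^-1 * eta = 1 by rewrite mulVf// gt_eqF.
have ei : 0 < eta^-1 by rewrite invr_gt0.
rewrite -subr_ge0.
set Dm := Cm + _ + _ in Dm0 *; set Dp := Cp + _ + _ in Dp0 *.
(* The slack is an explicit nonnegative combination: the test measures with [+ eta] for [Up] and
   [- eta] for [Um] produce cross terms of opposite signs, matching those of [Up - Um]. *)
have -> : Cp - Cm - (Ap - Am - eta * (Ap + Am) - (1 + eta^-1) * (Dp + Dm)) =
    eta^-1 * (Dp + 2 * eta * (Bp - Ap) + eta ^+ 2 * Ap) +
    eta^-1 * (Dm - 2 * eta * (Bm - Am) + eta ^+ 2 * Am) + 2 * Dp.
  by rewrite /Dp /Dm; field; rewrite gt_eqF.
rewrite addr_ge0 ?mulr_ge0// addr_ge0// mulr_ge0 ?(ltW ei)//.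
- by move: hp; congr (_ <= _); rewrite /Dp; ring.
- by move: hm; congr (_ <= _); rewrite /Dm; ring.
Qed.

Variables (delta a alpha beta : R).
Hypotheses (delta1 : delta <= 1) (a0 : 0 <= a) (alpha0 : 0 <= alpha) (beta0 : 0 <= beta).
Hypothesis free_energy_bound : forall g, entropy_density om m g ->
  0 <= (1 - delta) * \int[m]_x psi (g x) + 2^-1 * (nrg Up g g - nrg Um g g).
Hypothesis energy_bound : forall g, entropy_density om m g ->
  nrg Up g g + nrg Um g g <= 2 * a * \int[m]_x psi (g x).
Hypothesis variance : forall g, entropy_density om m g ->
  \int[m]_x (K x x * g x) - nrg K g g <= alpha + beta * \int[m]_x psi (g x).

(** [quad_form_gap] is applied at each configuration with [q = gam t], of mass [n], and integrated
    against [f]. The free energy and energy hypotheses apply to the probability density [gam t / n],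
    and [h] converts its entropy into that of [f]. *)
Lemma mean_field_bound n (f : n.-tuple T -> R) eta : (0 < n)%N -> 0 < eta ->
  measurable_fun setT f -> (forall t, 0 <= f t) ->
  (\int[tuple_power m n]_t (f t)%:E = 1)%E ->
  (\int[tuple_power m n]_t ((\sum_(i < n) om (tnth t i)) * f t)%:E < +oo)%E ->
  (\int[tuple_power m n]_t (psi (f t))%:E < +oo)%E ->
  let H := \int[tuple_power m n]_t psi (f t) in
  - (1 - delta + eta * a) * H -
    (1 + eta^-1) / (2 * n%:R) * (n%:R * alpha + beta * H) <=
  n%:R / 2 * \int[tuple_power m n]_t (n%:R^-1 ^+ 2 * (\sum_(i < n) \sum_(j < n)
     (Up (tnth t i) (tnth t j) - Um (tnth t i) (tnth t j))) * f t).
Proof.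
move=> n0 eta0 mf f0 f1 fom fpsi; cbv zeta; set H := \int[_]_t psi (f t).
have nR0 : 0 < n%:R :> R by rewrite ltr0n.
have KG : kernel_growth om K by exact: kernel_growthD.
have Ksym x y : K x y = K y x by rewrite /K Up_sym Um_sym.
have Kpos k (t : k.-tuple T) q : om_int q -> 0 <= quad_form m K t q.
  by move=> iq; rewrite quad_form_kernelD// addr_ge0// ?Up_pos ?Um_pos.
have [gam [h [[mgam gam0 gam_om gam1 _] [mh h0 psii hE] hle qle]]] :=
  decoupling mom om1 omi KG Ksym Kpos alpha0 beta0 variance mf f0 f1 fom fpsi.
set P := tuple_power m n in f1 fom fpsi H hle qle *.
pose D t := quad_form m K t (fun y => (-1) * gam t y).
have mD : measurable_fun setT D.
  by apply: (@measurable_quad_form _ _ _ om m K KG); exact: measurable_funM.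
have D0 t : 0 <= D t by apply: Kpos; exact: om_integrableZ.
have psi_f0 t : 0 <= psi (f t) by exact/psi_ge0/f0.
have ipsi : P.-integrable setT (EFin \o (fun t => psi (f t))).
  apply: integrableP_norm; first exact: (measurableT_comp (@measurable_psi R) mf).
  by under eq_integral do rewrite ger0_norm//.
have HE : (\int[P]_t (psi (f t))%:E = H%:E)%E by exact: integral_EFin.
rewrite HE in hle qle.
have ihf : P.-integrable setT (EFin \o (fun t => h t * f t)).
  apply: integrableP_norm; first exact: measurable_funM.
  under eq_integral do rewrite ger0_norm ?mulr_ge0//.
  by apply: le_lt_trans hle _; rewrite ltry.
have iDf : P.-integrable setT (EFin \o (fun t => D t * f t)).
  apply: integrableP_norm; first exact: measurable_funM.
  under eq_integral do rewrite ger0_norm ?mulr_ge0//.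
  by apply: le_lt_trans qle _; rewrite ltry.
rewrite (integral_EFin ihf) lee_fin in hle.
rewrite (integral_EFin iDf) -EFinM -EFinD lee_fin in qle.
pose V t := \sum_(i < n) \sum_(j < n)
  (Up (tnth t i) (tnth t j) - Um (tnth t i) (tnth t j)).
have iV : P.-integrable setT (EFin \o (fun t => (2 * n%:R)^-1 * V t * f t)).
  have [mU [C UC]] := UpG; have [mU' [C' UC']] := UmG.
  have iom : P.-integrable setT
      (EFin \o (fun t => (\sum_(i < n) om (tnth t i)) * f t)).
    apply: integrableP_norm.
      apply: measurable_funM => //; apply: measurable_sum => i.
      exact: (measurableT_comp mom (measurable_tnth i)).
    by under eq_integral do rewrite ger0_norm ?mulr_ge0 ?sumr_ge0//.
  apply: integrable_dominated (integrable_Z (C + C') iom).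
    apply: measurable_funM => //; apply: measurable_funM => //.
    apply: measurable_sum => i; apply: measurable_sum => j.
    have mij := measurable_fun_pair (@measurable_tnth _ T n i) (measurable_tnth j).
    apply: measurable_funB; first exact: (measurableT_comp mU mij).
    exact: (measurableT_comp mU' mij).
  move=> t; rewrite normrM (ger0_norm (f0 t)) mulrA ler_wpM2r//.
  rewrite normrM gtr0_norm ?invr_gt0 ?mulr_gt0// mulrC ler_pdivrMr ?mulr_gt0//.
  apply: (@le_trans _ _ (\sum_(i < n) \sum_(j < n)
      (C + C') * (om (tnth t i) + om (tnth t j)))).
    apply: le_trans (ler_norm_sum _ _ _) _; apply: ler_sum => i _.
    apply: le_trans (ler_norm_sum _ _ _) _; apply: ler_sum => j _.
    by apply: le_trans (ler_normB _ _) _; rewrite mulrDl lerD.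
  under eq_bigr do rewrite -mulr_sumr big_split/= sumr_const card_ord -mulr_natl.
  rewrite -mulr_sumr big_split/= -mulr_sumr sumr_const card_ord.
  set S := \sum_(i < n) _; have AC (c k : R) : c * (k * S + k * S) = c * S * (2 * k).
    by clear; ring.
  by rewrite -[S *+ n]mulr_natl ?mulr1 AC.
(* The interaction is [V t / (2 * n)]. [c1] collects the free energy deficit and the Cauchy-Schwarz
   loss; [c2] is the factor of the variance in [quad_form_gap] after this division. *)
pose c1 := 1 - delta + eta * a; pose c2 := (1 + eta^-1) / (2 * n%:R).
have c10 : 0 <= c1 by rewrite addr_ge0 ?subr_ge0// mulr_ge0// ltW.
have c20 : 0 <= c2.
  by rewrite divr_ge0 ?mulr_ge0 ?addr_ge0 ?invr_ge0// ltW.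
have pointwise t : - c1 * (h t * f t) + - c2 * (D t * f t) <=
    (2 * n%:R)^-1 * V t * f t.
  rewrite !mulrA -mulrDl ler_wpM2r//.
  pose gb x := gam t x / n%:R.
  have gbE x : gam t x = n%:R * gb x by rewrite mulrC divfK// gt_eqF.
  have igb : om_int gb.
    rewrite /gb; have := om_integrableZ n%:R^-1 (gam_om t).
    by congr om_integrable; apply/funext => x; rewrite mulrC.
  have gd : entropy_density om m gb.
    split; [by move=> x; rewrite divr_ge0|by []| |exact: psii].
    rewrite RintegralZr//; last exact: (om_integrable_int om1 (gam_om t)).
    by rewrite gam1 divff// gt_eqF.
  have nE U : kernel_growth om U -> nrg U (gam t) (gam t) = n%:R ^+ 2 * nrg U gb gb.
    move=> UG; rewrite (_ : gam t = fun x => n%:R * gb x); last exact/funext.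
    rewrite (energyZl om1 UG) ?(energyZr om1 UG)//; last exact: om_integrableZ.
    by rewrite mulrA.
  have := quad_form_gap t eta0 (gam_om t); rewrite -/(D t) -/(V t) !nE//.
  have := energy_bound gd; have := free_energy_bound gd; have := hE t.
  rewrite -/gb; set Ap := nrg Up gb gb; set Am := nrg Um gb gb.
  set s := \int[m]_x psi (gb x) => hs hF hEn hg.
  have nm : (2 * n%:R) * (2 * n%:R)^-1 = 1 :> R.
    by rewrite divff// gt_eqF// mulr_gt0.
  rewrite [leRHS]mulrC ler_pdivlMr ?mulr_gt0//; apply: le_trans hg.
  have -> : (- c1 * h t + - c2 * D t) * (2 * n%:R) =
      - (2 * n%:R) * (c1 * h t) - (1 + eta^-1) * D t.
    by rewrite /c2; field; rewrite !gt_eqF.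
  rewrite lerD2r -subr_ge0.
  (* The difference is a sum of three nonnegative slacks: in the free energy bound, in the energy
     bound and in the convexity bound on the entropy of the average. *)
  have -> : n%:R ^+ 2 * Ap - n%:R ^+ 2 * Am -
      eta * (n%:R ^+ 2 * Ap + n%:R ^+ 2 * Am) - - (2 * n%:R) * (c1 * h t) =
      2 * n%:R ^+ 2 * ((1 - delta) * s + 2^-1 * (Ap - Am)) +
      eta * n%:R ^+ 2 * (2 * a * s - (Ap + Am)) +
      2 * n%:R * (c1 * (h t - n%:R * s)).
    by rewrite /c1; field.
  have e0 := ltW eta0.
  by rewrite !addr_ge0// !mulr_ge0// ?subr_ge0// ?sqr_ge0.
have -> : n%:R / 2 * \int[P]_t (n%:R^-1 ^+ 2 * V t * f t) =
    \int[P]_t ((2 * n%:R)^-1 * V t * f t).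
  have VE t : n%:R^-1 ^+ 2 * V t * f t = 2 / n%:R * ((2 * n%:R)^-1 * V t * f t).
    by field; rewrite gt_eqF.
  under eq_Rintegral do rewrite VE.
  by rewrite RintegralZl// mulrA; set I := Rintegral _ _ _; field; rewrite gt_eqF.
have := le_Rintegral measurableT
  (integrable_D (integrable_Z (- c1) ihf) (integrable_Z (- c2) iDf)) iV
  (fun t _ => pointwise t).
rewrite RintegralD//; try exact: integrable_Z.
rewrite !RintegralZl//; apply: le_trans.
rewrite -/c1 -/c2 !mulNr -opprD -opprD lerN2.
by rewrite lerD// ler_wpM2l.
Qed.

End mean_field_bound.

(** * Oscillation bounds *)

Section oscillation.
Context {d} {T : measurableType d} {R : realType}.
Variables (om : T -> R) (m : probability T R).
Hypotheses (mom : measurable_fun setT om) (om1 : forall x, 1 <= om x)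
  (omi : m.-integrable setT (EFin \o om)).

Local Notation om_int := (om_integrable om m).
Local Notation pot := (potential m).
Local Notation nrg := (energy m).
Local Notation Ent g := (\int[m]_x psi (g x)).

Let om0 x : 0 <= om x. Proof. exact: le_trans (om1 x). Qed.

(* <U, (\delta_x - \delta_y) (x) (\delta_z - \delta_w)> *)
Definition rect (U : T -> T -> R) x y z w : R := U x z - U x w - U y z + U y w.

Section density.
Variable g : T -> R.
Hypothesis gd : entropy_density om m g.

Let g0 x : 0 <= g x. Proof. by case: gd. Qed.
Let g_om : om_int g. Proof. by case: gd. Qed.
Let g1 : \int[m]_x g x = 1. Proof. by case: gd. Qed.
Let g_psi : m.-integrable setT (EFin \o (fun x => psi (g x))). Proof. by case: gd. Qed.
Let g_int : m.-integrable setT (EFin \o g). Proof. exact: (om_integrable_int om1 g_om). Qed.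

Lemma entropy_ge0 : 0 <= Ent g.
Proof. by apply: Rintegral_ge0 => x _; exact: psi_ge0. Qed.

Lemma centered_om : om_int (fun x => g x + cst (-1) x).
Proof. by apply: om_integrableD => //; exact: om_integrable_cst. Qed.

Lemma centered_total : \int[m]_x (g x + cst (-1) x) = 0.
Proof.
rewrite RintegralD//; last exact: integrable_cst.
by rewrite g1 Rintegral_cst_prob addrN.
Qed.

(** [psi_pinsker] is integrated, the weight [(u + 2) / 3] having integral 1, and the optimal [l] is
    the square root of half the entropy. *)
Lemma pinsker : 2^-1 * \int[m]_x `|g x + cst (-1) x| <= Num.sqrt (Ent g / 2).
Proof.
have H0 := entropy_ge0.
set I := \int[m]_x `|_|.
have ci := om_integrable_int om1 centered_om.
have bnd l : 0 < l -> I <= l + Ent g / (2 * l).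
  move=> l0.
  have i1 : m.-integrable setT (EFin \o (fun x => g x + cst 2 x)).
    by apply: integrable_D => //; exact: integrable_cst.
  have i2 := integrable_Z (l / 3) i1; have i3 := integrable_Z (2 * l)^-1 g_psi.
  apply: (@le_trans _ _
      (\int[m]_x (l / 3 * (g x + cst 2 x) + (2 * l)^-1 * psi (g x)))).
    apply: le_Rintegral => //; [exact: integrable_abs|exact: integrable_D|].
    move=> x _; have := psi_pinsker l0 (g0 x); congr (_ <= _).
    by rewrite [in RHS]mulrC; congr (_ + _); rewrite /=; lra.
  rewrite RintegralD// !RintegralZl// RintegralD//; last exact: integrable_cst.
  rewrite g1 Rintegral_cst_prob le_eqVlt; apply/orP; left; apply/eqP; field.
  by rewrite gt_eqF.
(* For zero entropy the optimal [l] would be 0, which is excluded; there [l] tends to 0. *)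
move: H0; rewrite le_eqVlt => /predU1P[H0|H0].
  rewrite -H0 mul0r sqrtr0 -(mulr0 2^-1) ler_wpM2l//.
  apply/ler_addgt0Pl => e e0; rewrite addr0.
  by have := bnd e e0; rewrite -H0 mul0r addr0.
set l := Num.sqrt _.
have l0 : 0 < l by rewrite sqrtr_gt0 divr_gt0.
have HE : Ent g = 2 * l ^+ 2 by rewrite sqr_sqrtr ?divr_ge0 ?ltW//; field.
have := bnd l l0; rewrite HE.
have -> : l + 2 * l ^+ 2 / (2 * l) = 2 * l by field; rewrite gt_eqF.
lra.
Qed.

Lemma pinsker_oscillation (k : T -> R) (c : R) : measurable_fun setT k ->
  (forall x y, k x - k y <= c) ->
  \int[m]_x (k x * (g x + cst (-1) x)) <= c * Num.sqrt (Ent g / 2).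
Proof.
move=> mk kc; pose lo := inf (range k).
have c0 : 0 <= c by have := kc point point; rewrite subrr.
have lb : has_lbound (range k).
  by exists (k point - c) => _ [x _ <-]; have := kc point x; lra.
have lo_le x : lo <= k x by apply: ge_inf => //; exists x.
have le_lo x : k x <= lo + c.
  rewrite -lerBlDr; apply: lb_le_inf; first by exists (k point); exists point.
  by move=> _ [y _ <-]; have := kc x y; lra.
have ci := om_integrable_int om1 centered_om.
have iab := integrable_abs ci.
have ik : m.-integrable setT (EFin \o (fun x => k x * (g x + cst (-1) x))).
  apply: (@om_integrableM _ _ _ _ om1 _ (`|lo| + c)) => //; first exact: centered_om.
  move=> x; apply: (@le_trans _ _ (`|lo| + c)).
    have h1 := lo_le x; have h2 := le_lo x; have h3 := ler_norm lo.
    have h4 : - lo <= `|lo| by rewrite -normrN ler_norm.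
    by rewrite ler_norml; apply/andP; split; lra.
  by rewrite ler_peMr// addr_ge0.
(* Since [g - 1] has mass zero, [k] may be shifted to take values between 0 and [c]; the product is
   then at most [c] times the positive part [(|v| + v) / 2] of [v = g - 1]. *)
have -> : \int[m]_x (k x * (g x + cst (-1) x)) =
    \int[m]_x (k x * (g x + cst (-1) x) + (- lo) * (g x + cst (-1) x)).
  rewrite RintegralD//; last exact: integrable_Z.
  by rewrite RintegralZl// centered_total mulr0 addr0.
apply: (@le_trans _ _ (\int[m]_x (c / 2 * `|g x + cst (-1) x| +
    c / 2 * (g x + cst (-1) x)))).
  apply: le_Rintegral => //.
  - by apply: integrable_D => //; exact: integrable_Z.
  - by apply: integrable_D; exact: integrable_Z.
  move=> x _; rewrite -mulrDl -mulrDr.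
  have a0 : 0 <= k x - lo by rewrite subr_ge0.
  have ac : k x - lo <= c by have := le_lo x; lra.
  move: (k x - lo) (g x + _) a0 ac => u v u0 uc.
  by case: (ger0P v) => v0; nra.
rewrite RintegralD//; try exact: integrable_Z.
rewrite !RintegralZl// centered_total mulr0 addr0 -mulrA.
by rewrite ler_wpM2l// pinsker.
Qed.

(** The duality bound is used once per variable. For fixed [x] and [y], the function [A x - A y] has
    constant [c * r x y], so the potential of [g - 1] has constant [c * s]; integrating this
    potential against [g - 1] gives the second factor [s]. Constant [r] is the oscillation case, a
    distance the transport case. *)
Lemma rect_energy (A : T -> T -> R) (r : T -> T -> R) c s : kernel_growth om A ->
  0 <= c -> 0 <= s -> (forall x y, 0 <= r x y) ->
  (forall x y z w, rect A x y z w <= c * r x y * r z w) ->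
  (forall (k : T -> R) (C c' : R), measurable_fun setT k -> (forall x, `|k x| <= C * om x) ->
     0 <= c' -> (forall x y, k x - k y <= c' * r x y) ->
     \int[m]_x (k x * (g x + cst (-1) x)) <= c' * s) ->
  nrg A (fun x => g x + cst (-1) x) (fun x => g x + cst (-1) x) <= c * s ^+ 2.
Proof.
move=> AG c0 s0 r0 Ar ks.
set q := fun x => _.
have iq : om_int q by exact: centered_om.
have [C C0 AC] := kernel_growth_mul om1 AG.
have [C' potC] := potential_bound om1 AG iq.
have mA := measurable_kernell AG.
have step x y : pot A q x - pot A q y <= c * s * r x y.
  rewrite /potential -RintegralB//; [|exact: (kernel_intl om1 AG)..].
  rewrite mulrAC; under eq_Rintegral do rewrite -mulrBl.
  apply: (ks _ (C * om x + C * om y)).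
  - exact: measurable_funB.
  - move=> z; apply: le_trans (ler_normB _ _) _.
    by rewrite mulrDl lerD.
  - by rewrite mulr_ge0.
  - move=> z w; apply: le_trans (Ar x y z w).
    by rewrite /rect; lra.
have := ks _ C' (c * s) (measurable_potential m AG iq.1) potC
  (mulr_ge0 c0 s0) step.
by rewrite -mulrA -expr2.
Qed.

End density.

(** Against a measure of mass zero, terms depending on one variable vanish, so a kernel may be
    anchored at any point [o]. *)
Lemma energy_rect (U : T -> T -> R) (q : T -> R) o : kernel_growth om U -> om_int q ->
  \int[m]_x q x = 0 ->
  nrg (fun x y => rect U x o y o) q q = nrg U q q.
Proof.
move=> UG iq q0; have qi := om_integrable_int om1 iq.
have pE x : pot (fun x y => rect U x o y o) q x = pot U q x - pot U q o.
  have i1 := kernel_intl om1 UG x iq; have i2 := kernel_intl om1 UG o iq.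
  have i3 := integrable_Z (- U x o + U o o) qi.
  rewrite /potential -RintegralB//.
  transitivity (\int[m]_y ((U x y * q y - U o y * q y) + (- U x o + U o o) * q y)).
    by apply: eq_Rintegral => y _; rewrite /rect; ring.
  rewrite (RintegralD measurableT (integrable_B i1 i2) i3).
  by rewrite RintegralZl// q0 mulr0 addr0.
have ip := potential_int om1 UG iq iq.
rewrite /energy; under eq_Rintegral do rewrite pE mulrBl.
rewrite RintegralB//; last exact: integrable_Z.
by rewrite RintegralZl// q0 mulr0 subr0.
Qed.

Lemma rect_growth (U : T -> T -> R) o : kernel_growth om U ->
  kernel_growth om (fun x y => rect U x o y o).
Proof.
move=> UG; have [mU [C UC]] := UG; split.
  apply: measurable_funD => //; apply: measurable_funB.
    apply: measurable_funB => //.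
    exact: (measurableT_comp (measurable_kernelr UG o) measurable_fst).
  exact: (measurableT_comp (measurable_kernell UG o) measurable_snd).
exists (C * 2 + C * om o * 2) => x y; rewrite /rect.
have h1 := UC x y; have h2 := UC x o; have h3 := UC o y; have h4 := UC o o.
have := ler_normD (U x y - U x o - U o y) (U o o).
have := ler_normB (U x y - U x o) (U o y); have := ler_normB (U x y) (U x o).
have Co : 0 <= C * om o * (om x + om y - 2).
  have C0 : 0 <= C * (om o + om o) by apply: le_trans h4.
  by rewrite mulr_ge0//; [lra|have := om1 x; have := om1 y; lra].
lra.
Qed.

(** [B] and [Q] come with no growth bound, so their energies might diverge. Anchoring at [o] repairs
    this: the anchored [B] is bounded, and the anchored [Q] is the difference between the anchored
    [K] and it. Replacing [g] by [g - 1] is harmless because [K] annihilates [m]. *)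
Lemma energy_decomposition (K B Q : T -> T -> R) (M L rho : R) (r : T -> T -> R) g :
  kernel_growth om K ->
  (forall x y, K x y = K y x) -> (forall x, pot K (cst 1) x = 0) ->
  measurable_fun setT (fun p : T * T => B p.1 p.2) ->
  measurable_fun setT (fun p : T * T => Q p.1 p.2) ->
  (forall x y z w, rect K x y z w = rect B x y z w + rect Q x y z w) ->
  0 <= L -> 0 < rho -> (forall x y, 0 <= r x y) ->
  (forall x y z w, rect B x y z w <= 4 * M) ->
  (forall x y z w, rect Q x y z w <= L * r x y * r z w) ->
  entropy_density om m g ->
  (forall (k : T -> R) (C c : R), measurable_fun setT k -> (forall x, `|k x| <= C * om x) ->
     0 <= c -> (forall x y, k x - k y <= c * r x y) ->
     \int[m]_x (k x * (g x + cst (-1) x)) <= c * Num.sqrt (2 * Ent g / rho)) ->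
  nrg K g g <= 2 * (M + L / rho) * Ent g.
Proof.
move=> KG Ksym K1 mB mQ KBQ L0 rho0 r0 B4 QL gd T1.
pose q x := g x + cst (-1) x.
have [_ ig _ _] := gd.
have iq : om_int q by exact: centered_om.
have i1 : om_int (cst (-1)) by exact: om_integrable_cst.
have pm1 x : pot K (cst (-1)) x = 0.
  have := potentialZ om1 KG (-1) x (om_integrable_cst omi 1).
  rewrite K1 mulr0 => <-.
  by apply: eq_Rintegral => y _; rewrite /= mulr1.
have qE : nrg K q q = nrg K g g.
  rewrite (energyDl om1 KG)// !(energyDr om1 KG)//.
  have z p : nrg K p (cst (-1)) = 0.
    rewrite /energy -[RHS](Rintegral_cst_prob m 0); apply: eq_Rintegral => x _.
    by rewrite pm1 mul0r.
  by rewrite !z (energyC om1 KG Ksym i1 ig) z !addr0.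
have q0 : \int[m]_x q x = 0 by exact: centered_total gd.
have o : T := point.
pose Bo x y := rect B x o y o; pose Qo x y := rect Q x o y o.
have mrect (A : T -> T -> R) : measurable_fun setT (fun p : T * T => A p.1 p.2) ->
    measurable_fun setT (fun p : T * T => rect A p.1 o p.2 o).
  move=> mA; apply: measurable_funD => //; apply: measurable_funB.
    apply: measurable_funB => //.
    exact: (measurableT_comp (measurable_pairr o mA) measurable_fst).
  exact: (measurableT_comp (measurable_pairl o mA) measurable_snd).
have M0 : 0 <= M by have := B4 o o o o; rewrite /rect; lra.
have BoG : kernel_growth om Bo.
  split; first exact: mrect.
  exists (4 * M) => x y; rewrite ler_norml; apply/andP; split; last first.
    by apply: le_trans (B4 _ _ _ _) _; have := om1 x; have := om1 y; nra.
  (* Exchanging the first two corners changes the sign of a rectangle, so the one-sided bound is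
     two-sided. *)
  have := B4 o x y o; rewrite /Bo /rect; have := om1 x; have := om1 y; nra.
have KoE x y : rect K x o y o = Bo x y + Qo x y by exact: KBQ.
have KoG := rect_growth o KG.
have QoG : kernel_growth om Qo.
  split; first exact: mrect.
  have [_ [C1 h1]] := KoG; have [_ [C2 h2]] := BoG.
  exists (C1 + C2) => x y; have -> : Qo x y = rect K x o y o - Bo x y.
    by rewrite KoE addrC addKr.
  by apply: le_trans (ler_normB _ _) _; rewrite mulrDl lerD.
have E0 : 0 <= Ent g := entropy_ge0 gd.
rewrite -qE -(energy_rect o KG iq q0).
have -> : (fun x y => rect K x o y o) = (fun x y => Bo x y + Qo x y).
  by apply/funext => x; apply/funext => y.
rewrite (energy_kernelD om1 BoG QoG)//.
have hB : nrg Bo q q <= 4 * M * Num.sqrt (Ent g / 2) ^+ 2.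
  apply: (rect_energy gd (r := fun _ _ => 1)) => //; first by rewrite mulr_ge0.
    move=> x y z w; rewrite !mulr1; apply: le_trans (B4 x y z w).
    by rewrite /rect /Bo /rect; clear; lra.
  move=> k C c' mk _ _ kc; apply: pinsker_oscillation => // x y.
  by have := kc x y; rewrite mulr1.
have hQ : nrg Qo q q <= L * Num.sqrt (2 * Ent g / rho) ^+ 2.
  apply: (rect_energy gd (r := r)) => //.
  move=> x y z w; apply: le_trans (QL x y z w).
  by rewrite /rect /Qo /rect; clear; lra.
apply: le_trans (lerD hB hQ) _.
rewrite !sqr_sqrtr ?divr_ge0 ?mulr_ge0// ?(ltW rho0)//.
rewrite le_eqVlt; apply/orP; left; apply/eqP; field.
by rewrite gt_eqF.
Qed.

(* The variance of [g] in the Hilbert norm of [K] is at most its second moment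
   about [e]. *)
Lemma variance_bound (K : T -> T -> R) (zeta : T -> R) (C : R) e (g : T -> R) (A : R) :
  kernel_growth om K ->
  (forall x y, K x y = K y x) ->
  (forall n (t : n.-tuple T) q, om_int q -> 0 <= quad_form m K t q) ->
  measurable_fun setT zeta -> (forall x, `|zeta x| <= C * om x) ->
  (forall x, rect K x e x e <= zeta x) -> entropy_density om m g ->
  \int[m]_x (zeta x * g x) <= A ->
  \int[m]_x (K x x * g x) - nrg K g g <= A.
Proof.
move=> KG Ksym Kpos mz zC Kz gd; apply: le_trans.
have [g0 ig g1 _] := gd.
have img : om_int (fun y => -1 * g y) by exact: om_integrableZ.
(* Positivity at [\delta_e - g m] bounds the energy of [g] from below by [2 * pot K g e - K e e]. *)
have := Kpos _ [tuple e] _ img.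
rewrite (quad_formZ om1 _ _ KG ig) !big_ord_recl !big_ord0 !tnth0 !addr0.
rewrite sqrrN expr1n mul1r => pos.
have kd := energy_diag_int om1 KG ig.
have ke := kernel_intl om1 KG e ig.
have gi := om_integrable_int om1 ig.
have i1 := integrable_Z (-2) ke; have i2 := integrable_Z (K e e) gi.
apply: (@le_trans _ _ (\int[m]_x (K x x * g x + (-2) * (K e x * g x) + K e e * g x))).
  rewrite RintegralD//; last exact: integrable_D.
  rewrite RintegralD// !RintegralZl// g1 -/(pot K g e); lra.
apply: le_Rintegral => //.
- by apply: integrable_D => //; exact: integrable_D.
- exact: (om_integrableM om1 ig mz zC).
- move=> x _; rewrite (_ : _ + _ = (K x x - 2 * K e x + K e e) * g x); last by ring.
  rewrite ler_wpM2r//.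
  by apply: le_trans (Kz x); rewrite /rect (Ksym x e); lra.
Qed.

End oscillation.

(** * Couplings *)

Section coupling.
Context {d} {T : measurableType d} {R : realType}.
Variables (mu nu : probability T R) (pi : probability (T * T)%type R).
Hypotheses (pi1 : forall A, measurable A -> pi (A `*` setT) = mu A)
  (pi2 : forall A, measurable A -> pi (setT `*` A) = nu A).

Lemma ge0_coupling_fst (k : T -> \bar R) : measurable_fun setT k ->
  (forall x, 0 <= k x)%E -> (\int[pi]_p k p.1 = \int[mu]_x k x)%E.
Proof.
move=> mk k0; have := @ge0_integral_pushforward _ _ _ _ R fst measurable_fst pi
  setT k measurableT mk (fun x _ => k0 x).
rewrite preimage_setT => <-; apply: eq_measure_integral => A mA _.
transitivity (pi (A `*` setT)); last exact: pi1.
by rewrite /pushforward; congr (pi _); apply/seteqP; split => -[x y] // [].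
Qed.

Lemma ge0_coupling_snd (k : T -> \bar R) : measurable_fun setT k ->
  (forall x, 0 <= k x)%E -> (\int[pi]_p k p.2 = \int[nu]_x k x)%E.
Proof.
move=> mk k0; have := @ge0_integral_pushforward _ _ _ _ R snd measurable_snd pi
  setT k measurableT mk (fun x _ => k0 x).
rewrite preimage_setT => <-; apply: eq_measure_integral => A mA _.
transitivity (pi (setT `*` A)); last exact: pi2.
by rewrite /pushforward; congr (pi _); apply/seteqP; split => -[x y] // [].
Qed.

Let coupling_proj (p : T * T -> T) (la : probability T R) (k : T -> R) :
  measurable_fun setT p ->
  (forall k : T -> \bar R, measurable_fun setT k ->
    (forall x, 0 <= k x)%E -> (\int[pi]_q k (p q) = \int[la]_x k x)%E) ->
  la.-integrable setT (EFin \o k) ->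
  pi.-integrable setT (EFin \o (fun q => k (p q))) /\
  \int[pi]_q k (p q) = \int[la]_x k x.
Proof.
move=> mp kE ki; have mk := integrable_measurable ki.
have mnk : measurable_fun setT (fun x => `|k x|%:E).
  by apply/measurable_EFinP; exact: measurableT_comp.
have mkp : measurable_fun setT (fun q => k (p q)) by exact: measurableT_comp mk mp.
split.
  apply: integrableP_norm => //.
  rewrite (kE (fun x => `|k x|%:E)) => //.
  by rewrite (integral_EFin (integrable_abs ki)) ltry.
rewrite /Rintegral integral_signed [in RHS]integral_signed.
rewrite (kE (fun x => (Num.max (k x) 0)%:E)); last 2 first.
- by apply/measurable_EFinP; exact: measurable_maxr.
- by move=> x; rewrite lee_fin le_max lexx orbT.
rewrite (kE (fun x => (Num.max (- k x) 0)%:E))//.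
- by apply/measurable_EFinP; apply: measurable_maxr => //; exact: measurableT_comp.
- by move=> x; rewrite lee_fin le_max lexx orbT.
Qed.

Lemma coupling_fst k : mu.-integrable setT (EFin \o k) ->
  pi.-integrable setT (EFin \o (fun p => k p.1)) /\
  \int[pi]_p k p.1 = \int[mu]_x k x.
Proof. exact: coupling_proj measurable_fst ge0_coupling_fst. Qed.

Lemma coupling_snd k : nu.-integrable setT (EFin \o k) ->
  pi.-integrable setT (EFin \o (fun p => k p.2)) /\
  \int[pi]_p k p.2 = \int[nu]_x k x.
Proof. exact: coupling_proj measurable_snd ge0_coupling_snd. Qed.

Variable r : T -> T -> R.
Hypotheses (mr : measurable_fun setT (fun p : T * T => r p.1 p.2))
  (r0 : forall x y, 0 <= r x y).

(** The easy half of Kantorovich duality, followed by Jensen from the mean of [r] to its quadratic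
    mean. *)
Lemma coupling_lipschitz k c V : mu.-integrable setT (EFin \o k) ->
  nu.-integrable setT (EFin \o k) ->
  0 <= c -> (forall x y, k x - k y <= c * r x y) ->
  (\int[pi]_p (r p.1 p.2 ^+ 2)%:E <= V%:E)%E ->
  \int[mu]_x k x - \int[nu]_x k x <= c * Num.sqrt V.
Proof.
move=> k1 k2 c0 kr rV.
have [p1 <-] := coupling_fst k1; have [p2 <-] := coupling_snd k2.
have mr2 : measurable_fun setT (fun p : T * T => r p.1 p.2 ^+ 2).
  exact: measurable_funM.
have ir2 : pi.-integrable setT (EFin \o (fun p => r p.1 p.2 ^+ 2)).
  apply: integrableP_norm => //.
  under eq_integral do rewrite ger0_norm ?sqr_ge0//.
  by apply: le_lt_trans rV _; rewrite ltry.
have i1 : pi.-integrable setT (EFin \o fun=> 1 : R) := integrable_cst pi 1.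
have ir : pi.-integrable setT (EFin \o (fun p => r p.1 p.2)).
  apply: integrable_dominated (integrable_D i1 ir2) => // p.
  by rewrite ger0_norm//; have := r0 p.1 p.2; nra.
rewrite (integral_EFin ir2) lee_fin in rV.
pose I := \int[pi]_p r p.1 p.2.
have I0 : 0 <= I by exact: Rintegral_ge0.
(* The variance of [r] under the coupling is nonnegative. *)
have IV : I ^+ 2 <= V.
  apply: le_trans rV; rewrite -subr_ge0.
  have -> : \int[pi]_x r x.1 x.2 ^+ 2 - I ^+ 2 =
      \int[pi]_p (r p.1 p.2 ^+ 2 + (- 2 * I) * r p.1 p.2 + I ^+ 2 * 1).
    have i3 := integrable_Z (- 2 * I) ir; have i4 := integrable_Z (I ^+ 2) i1.
    rewrite (RintegralD measurableT (integrable_D ir2 i3) i4).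
    rewrite (RintegralD measurableT ir2 i3) !RintegralZl//.
    by rewrite Rintegral_cst_prob -/I; ring.
  apply: Rintegral_ge0 => p _.
  have -> : r p.1 p.2 ^+ 2 + - 2 * I * r p.1 p.2 + I ^+ 2 * 1 =
    (r p.1 p.2 - I) ^+ 2 by ring.
  exact: sqr_ge0.
rewrite -RintegralB//; apply: (@le_trans _ _ (c * I)).
  rewrite -RintegralZl//; apply: le_Rintegral => //.
  - exact: integrable_B.
  - exact: integrable_Z.
rewrite ler_wpM2l//.
by rewrite -(ler_pXn2r (ltn0Sn 1)) ?nnegrE ?sqrtr_ge0// sqr_sqrtr// (le_trans _ IV)// sqr_ge0.
Qed.

Lemma coupling_second_moment D V : mu.-integrable setT (EFin \o D) ->
  nu.-integrable setT (EFin \o D) ->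
  (forall x y, D x <= 2 * r x y ^+ 2 + 2 * D y) ->
  (\int[pi]_p (r p.1 p.2 ^+ 2)%:E <= V%:E)%E ->
  \int[mu]_x D x <= 2 * V + 2 * \int[nu]_x D x.
Proof.
move=> D1 D2 Dr rV.
have [p1 <-] := coupling_fst D1; have [p2 <-] := coupling_snd D2.
have mr2 : measurable_fun setT (fun p : T * T => r p.1 p.2 ^+ 2).
  exact: measurable_funM.
have ir2 : pi.-integrable setT (EFin \o (fun p => r p.1 p.2 ^+ 2)).
  apply: integrableP_norm => //.
  under eq_integral do rewrite ger0_norm ?sqr_ge0//.
  by apply: le_lt_trans rV _; rewrite ltry.
rewrite (integral_EFin ir2) lee_fin in rV.
apply: (@le_trans _ _ (\int[pi]_p (2 * r p.1 p.2 ^+ 2 + 2 * D p.2))).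
  apply: le_Rintegral => //; apply: integrable_D; exact: integrable_Z.
rewrite RintegralD//; try exact: integrable_Z.
by rewrite !RintegralZl// lerD2r ler_wpM2l.
Qed.

End coupling.

(** * Empirical measures and probabilities with a density *)

Section empirical_pairing.
Context {d} {T : measurableType d} {R : realType}.
Variables (om : T -> R).
Hypotheses (mom : measurable_fun setT om) (om1 : forall x, 1 <= om x).
Variables (n : nat) (t : n.-tuple T).

Lemma ge0_integral_empirical (k : T -> \bar R) : measurable_fun setT k ->
  (forall x, 0 <= k x)%E ->
  (\int[empirical R t]_x k x = (n%:R^-1)%:E * \sum_(i < n) k (tnth t i))%E.
Proof.
move=> mk k0; rewrite ge0_integral_mscale// ge0_integral_measure_sum//=.
congr (_ * _)%E; apply: eq_bigr => i _.
by rewrite integral_dirac// diracT mul1e (tnth_nth point).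
Qed.

Lemma integrable_empirical (k : T -> R) : measurable_fun setT k ->
  (empirical R t).-integrable setT (EFin \o k).
Proof.
move=> mk; apply: integrableP_norm => //.
rewrite ge0_integral_empirical//; last first.
  by apply/measurable_EFinP; exact: measurableT_comp.
by rewrite sumEFin -EFinM ltry.
Qed.

Lemma Rintegral_empirical (k : T -> R) : measurable_fun setT k ->
  \int[empirical R t]_x k x = n%:R^-1 * \sum_(i < n) k (tnth t i).
Proof.
move=> mk; rewrite /Rintegral integral_signed.
rewrite ge0_integral_empirical; last 2 first.
- by apply/measurable_EFinP; exact: measurable_maxr.
- by move=> x; rewrite lee_fin le_max lexx orbT.
rewrite ge0_integral_empirical; last 2 first.
- by apply/measurable_EFinP; apply: measurable_maxr => //; exact: measurableT_comp.
- by move=> x; rewrite lee_fin le_max lexx orbT.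
rewrite !sumEFin -!EFinM -EFinB/= -mulrBr -sumrB; congr (_ * _).
apply: eq_bigr => i _; move: (k _) => u.
by case: (ltP u 0); case: (ltP (- u) 0); lra.
Qed.

Lemma pairing_empirical U : kernel_growth om U ->
  pairing U (empirical R t) (empirical R t) =
  n%:R^-1 ^+ 2 * \sum_(i < n) \sum_(j < n) U (tnth t i) (tnth t j).
Proof.
move=> UG; have [C C0 UC] := kernel_growth_mul om1 UG.
have iom := integrable_empirical mom.
rewrite /pairing (dominated_Fubini1 UG.1 UC (integrable_Z C iom) iom).
under eq_Rintegral => x _.
  rewrite Rintegral_empirical; last exact: measurable_kernell UG x.
  over.
rewrite Rintegral_empirical.
  by rewrite -mulr_sumr mulrA.
apply: measurable_funM => //; apply: measurable_sum => j.
exact: measurable_kernelr UG _.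
Qed.

End empirical_pairing.

Section density_probability.
Context {d} {T : measurableType d} {R : realType}.
Variables (om : T -> R) (m : probability T R).
Hypotheses (mom : measurable_fun setT om) (om1 : forall x, 1 <= om x).

Let om0 x : 0 <= om x. Proof. exact: le_trans (om1 x). Qed.

(** Bridge from densities to probability measures, on which the hypotheses of finite second moment
    type are stated. *)
Lemma entropy_density_prob g : entropy_density om m g ->
  exists nu : probability T R,
  [/\ atoms_density m nu 0 [tuple] g, nu.-integrable setT (EFin \o om),
      relative_entropy nu m = (\int[m]_x psi (g x))%:E &
      forall (k : T -> R) (C : R), measurable_fun setT k -> (forall x, `|k x| <= C * om x) ->
        nu.-integrable setT (EFin \o k) /\
        \int[nu]_x k x = \int[m]_x (k x * g x)].
Proof.
move=> [g0 ig g1 gpsi]; have [mg omg] := ig; have gi := om_integrable_int om1 ig.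
have [nu nuE] := @atoms_density_exists _ _ _ m 0 0 [tuple] g (lexx _) mg g0 gi
  (etrans (congr1 (fun z => z + _) (mul0r _)) (etrans (add0r _) g1)).
exists nu; split => //.
- exact: atoms_density_om nuE g0 ig.
- rewrite -integral_EFin//; apply: relative_entropyE => //.
    exact: probability_setT.
  move=> A mA; have := nuE (EFin \o \1_A); rewrite big_ord0 mule0 add0e => nuA.
  have e : nu A = (\int[nu]_x (EFin \o \1_A) x)%E by rewrite integral_indic// setIT.
  rewrite e nuA//.
  + rewrite [RHS]integral_mkcond; apply: eq_integral => x _ /=.
    rewrite -EFinM patchE indicE; case: (x \in A); rewrite ?mul1r ?mul0r//.
  + by apply/measurable_EFinP; exact: measurable_indic.
  + by move=> x; rewrite /= lee_fin.
- move=> k C mk kC; have kgi := om_integrableM om1 ig mk kC.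
  split; first exact: (atoms_density_integrable nuE g0 mk kgi).
  by rewrite (atoms_density_Rintegral nuE mg mk kgi) mul0r add0r.
Qed.

End density_probability.

(** * Mixed derivatives *)

Section euclidean_norm.
Context {R : realType}.

Lemma enorm_ge0 n (v : 'rV[R]_n) : 0 <= enorm v.
Proof. exact: sqrtr_ge0. Qed.

Lemma enorm_sqr n (v : 'rV[R]_n) : enorm v ^+ 2 = \sum_(i < n) v 0 i ^+ 2.
Proof. by rewrite sqr_sqrtr// sumr_ge0// => i _; rewrite sqr_ge0. Qed.

(** Cauchy-Schwarz, from the weighted inequality [2 a b <= (B / A) a^2 + (A / B) b^2]; vanishing
    bounds are treated apart. *)
Lemma sum_mul_le n (a b : 'I_n -> R) A B : 0 <= A -> 0 <= B ->
  \sum_(i < n) a i ^+ 2 <= A ^+ 2 -> \sum_(i < n) b i ^+ 2 <= B ^+ 2 ->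
  \sum_(i < n) a i * b i <= A * B.
Proof.
move=> A0 B0 aA bB.
have zero (c c' : 'I_n -> R) : \sum_(i < n) c i ^+ 2 <= 0 ->
    \sum_(i < n) c i * c' i = 0.
  move=> h; apply: big1 => i _.
  have /eqP : \sum_(i < n) c i ^+ 2 = 0.
    by apply/eqP; rewrite eq_le h sumr_ge0// => j _; rewrite sqr_ge0.
  rewrite psumr_eq0; last by move=> j _; rewrite sqr_ge0.
  by move=> /allP /(_ i (mem_index_enum _)); rewrite sqrf_eq0 => /eqP ->; rewrite mul0r.
have [A1|A1] := eqVneq A 0.
  by rewrite A1 mul0r zero// (le_trans aA)// A1 expr0n.
have [B1|B1] := eqVneq B 0.
  under eq_bigr do rewrite mulrC.
  by rewrite B1 mulr0 zero// (le_trans bB)// B1 expr0n.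
have Ap : 0 < A by rewrite lt0r A1.
have Bp : 0 < B by rewrite lt0r B1.
apply: (@le_trans _ _ (\sum_(i < n) (B / (2 * A) * a i ^+ 2 + A / (2 * B) * b i ^+ 2))).
  apply: ler_sum => i _; rewrite -subr_ge0.
  have -> : B / (2 * A) * a i ^+ 2 + A / (2 * B) * b i ^+ 2 - a i * b i =
      (B * a i - A * b i) ^+ 2 / (2 * A * B) by field; rewrite A1 B1.
  by rewrite divr_ge0 ?sqr_ge0// !mulr_ge0.
rewrite big_split/= -!mulr_sumr.
have -> : A * B = B / (2 * A) * A ^+ 2 + A / (2 * B) * B ^+ 2.
  by field; rewrite A1 B1.
by rewrite lerD// ler_wpM2l// divr_ge0// mulr_ge0.
Qed.

Lemma enorm_dot n (u v : 'rV[R]_n) : \sum_(i < n) u 0 i * v 0 i <= enorm u * enorm v.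
Proof. by apply: sum_mul_le; rewrite ?enorm_ge0// enorm_sqr. Qed.

Lemma enormZ n c (v : 'rV[R]_n) : 0 <= c -> enorm (c *: v) = c * enorm v.
Proof.
move=> c0; rewrite /enorm.
under eq_bigr do rewrite mxE exprMn.
by rewrite -mulr_sumr sqrtrM ?sqr_ge0// sqrtr_sqr ger0_norm.
Qed.

Lemma operator_norm_le n (A : 'M[R]_n) (v : 'rV[R]_n) :
  enorm (v *m A^T) <= operator_norm A * enorm v.
Proof.
(* The Frobenius norm bounds the set whose [sup] defines the operator norm, so that this [sup] is an
   actual upper bound. *)
pose F := Num.sqrt (\sum_(j < n) \sum_(i < n) A j i ^+ 2).
have bnd (u : 'rV[R]_n) : enorm u <= 1 -> enorm (u *m A^T) <= F.
  move=> u1; rewrite ler_wsqrtr//; apply: ler_sum => j _.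
  have rj0 : 0 <= \sum_(i < n) A j i ^+ 2.
    by rewrite sumr_ge0// => i _; rewrite sqr_ge0.
  set s := \sum_(i < n) _ in rj0 *.
  have h (e : R) : e ^+ 2 = 1 -> e * (u *m A^T) 0 j <= Num.sqrt s.
    move=> e1; rewrite mxE mulr_sumr -[leRHS]mul1r.
    under eq_bigr do rewrite mulrA mxE.
    apply: sum_mul_le => //; rewrite ?sqrtr_ge0//; last by rewrite sqr_sqrtr.
    under eq_bigr do rewrite exprMn e1 mul1r.
    by rewrite -enorm_sqr ler_pXn2r// ?nnegrE ?enorm_ge0.
  have := h 1 (expr1n _ _); have := h (-1) (etrans (sqrrN 1) (expr1n _ _)).
  rewrite mul1r mulN1r => h1 h2.
  rewrite -[leRHS](sqr_sqrtr rj0) -[leLHS]real_normK ?num_real//.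
  rewrite ler_pXn2r ?nnegrE ?sqrtr_ge0// ler_norml h2 andbT; lra.
have [v0|v0] := eqVneq (enorm v) 0.
  have vE : v = 0.
    apply/rowP => i; rewrite mxE; apply/eqP; rewrite -sqrf_eq0.
    have : \sum_(i < n) v 0 i ^+ 2 = 0 by rewrite -enorm_sqr v0 expr0n.
    move/eqP; rewrite psumr_eq0; last by move=> j _; rewrite sqr_ge0.
    by move=> /allP /(_ i (mem_index_enum _)).
  rewrite v0 mulr0 vE mul0mx /enorm big1 ?sqrtr0// => i _.
  by rewrite mxE expr0n.
have vp : 0 < enorm v by rewrite lt0r v0 enorm_ge0.
rewrite -ler_pdivrMr// mulrC -enormZ ?invr_ge0 ?enorm_ge0// scalemxAl.
apply: ub_le_sup; first by exists F => _ [u /= u1 <-]; exact: bnd.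
exists ((enorm v)^-1 *: v) => //=.
by rewrite enormZ ?invr_ge0 ?enorm_ge0// mulVf.
Qed.

Lemma operator_norm_ge0 n (A : 'M[R]_n) : 0 <= operator_norm A.
Proof.
(* In dimension 0 there is no unit vector to test; the supremum is taken over the single value 0. *)
case: n A => [|n] A.
  rewrite /operator_norm (_ : [set _ | _ in _] = [set 0]) ?sup1//.
  apply/seteqP; split => [_ [v _ <-]|_ ->].
    by rewrite /enorm big_ord0 sqrtr0.
  by exists 0; rewrite /= /enorm big_ord0 sqrtr0.
have := operator_norm_le A (delta_mx 0 0).
have -> : enorm (delta_mx 0 0 : 'rV[R]_n.+1) = 1.
  rewrite /enorm (bigD1 0)//= mxE eqxx expr1n big1 ?addr0 ?sqrtr1// => i i0.
  by rewrite mxE (negbTE i0) andbF expr0n.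
by rewrite mulr1; apply: le_trans; exact: enorm_ge0.
Qed.

Lemma operator_norm_bilinear n (A : 'M[R]_n) (u v : 'rV[R]_n) :
  \sum_(i < n) \sum_(j < n) u 0 i * A i j * v 0 j <=
  operator_norm A * enorm u * enorm v.
Proof.
have -> : \sum_(i < n) \sum_(j < n) u 0 i * A i j * v 0 j =
    \sum_(i < n) u 0 i * (v *m A^T) 0 i.
  apply: eq_bigr => i _; rewrite mxE mulr_sumr; apply: eq_bigr => j _.
  by rewrite mxE; ring.
apply: le_trans (enorm_dot _ _) _.
rewrite mulrAC mulrC ler_wpM2r ?enorm_ge0//.
exact: operator_norm_le.
Qed.

End euclidean_norm.

Section mixed_mean_value.
Context {R : realType} {n : nat}.
Local Notation E := 'rV[R]_n.

Lemma is_derive_line (f : E -> R) (y h : E) (s : R) :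
  differentiable f (y + s *: h) ->
  is_derive s (1 : R) (fun s => f (y + s *: h)) ('D_h f (y + s *: h)).
Proof.
move=> df; have dv := @diff_derivable _ _ _ f _ h df.
have e : (fun t : R => t^-1 *: (((fun s => f (y + s *: h)) \o shift s) (t *: (1 : R)) -
      f (y + s *: h))) =
    (fun t => t^-1 *: ((f \o shift (y + s *: h)) (t *: h) - f (y + s *: h))).
  apply/funext => t /=; congr (_ *: (f _ - _)).
  by rewrite [t *: 1]mulr1 scalerDl addrCA.
by split; rewrite /derivable /derive e.
Qed.

Lemma derive_basis (f : E -> R) (a h : E) : differentiable f a ->
  'D_h f a = \sum_(i < n) h 0 i * 'D_(basis_vec R i) f a.
Proof.
move=> df; rewrite deriveE// {1}(row_sum_delta h) linear_sum.
by apply: eq_bigr => i _; rewrite linearZ/= deriveE.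
Qed.

(** A rectangle is a double increment. [mixed_differentiable] gives no continuity of the
    derivatives, so the mean value theorem along each segment replaces integration; the second one
    is applied at the intermediate point [u] found by the first. *)
Lemma rect_mixed_hessian (U : E -> E -> R) L : mixed_differentiable U ->
  (mixed_hessian_Linf U <= L%:E)%E ->
  forall x y z w, U x z - U x w - U y z + U y w <= L * enorm (x - y) * enorm (z - w).
Proof.
move=> [dU dG] UL x y z w.
pose h := x - y; pose k := z - w.
pose phi s := U (y + s *: h) z - U (y + s *: h) w.
pose dphi s := \sum_(i < n) h 0 i *
  (grad1 U i (y + s *: h) z - grad1 U i (y + s *: h) w).
have phi_derive s : is_derive s (1 : R) phi (dphi s).
  have d1 := is_derive_line (dU (y + s *: h) z).
  have d2 := is_derive_line (dU (y + s *: h) w).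
  apply: (is_derive_eq (is_deriveB d1 d2)).
  rewrite !derive_basis// -sumrB; apply: eq_bigr => i _.
  by rewrite -mulrBr.
have cphi : {within `[0, 1], continuous phi}.
  by apply: derivable_within_continuous => s _; have [] := phi_derive s.
have [s _] := MVT_segment ler01 (fun s _ => phi_derive s) cphi.
have -> : phi 1 - phi 0 = U x z - U x w - U y z + U y w.
  by rewrite /phi !scale1r !scale0r !addr0 /h subrKC; ring.
move=> ->; rewrite subr0 mulr1; set u := y + s *: h.
pose psi r := \sum_(i < n) h 0 i * grad1 U i u (w + r *: k).
pose dpsi r := \sum_(i < n) \sum_(j < n)
  h 0 i * mixed_hessian U u (w + r *: k) i j * k 0 j.
have psi_derive r : is_derive r (1 : R) psi (dpsi r).
  have di i : is_derive r (1 : R) (fun r => h 0 i * grad1 U i u (w + r *: k))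
      (h 0 i * 'D_k (grad1 U i u) (w + r *: k)).
    have d := is_derive_line (dG i u (w + r *: k)).
    by have := is_deriveZ (h 0 i) d.
  have := is_derive_sum (fun i => di i).
  have -> : \sum_(i < n) (fun r => h 0 i * grad1 U i u (w + r *: k)) = psi.
    by apply/funext => t; rewrite fct_sumE.
  move=> dsum; apply: (is_derive_eq dsum); apply: eq_bigr => i _.
  rewrite derive_basis// mulr_sumr; apply: eq_bigr => j _.
  have -> : mixed_hessian U u (w + r *: k) i j =
    'D_(basis_vec R j) (grad1 U i u) (w + r *: k) by rewrite mxE.
  by rewrite mulrA mulrAC.
have cpsi : {within `[0, 1], continuous psi}.
  by apply: derivable_within_continuous => r _; have [] := psi_derive r.
have [r _] := MVT_segment ler01 (fun r _ => psi_derive r) cpsi.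
have -> : psi 1 - psi 0 = dphi s.
  rewrite /psi /dphi -sumrB; apply: eq_bigr => i _.
  by rewrite scale1r scale0r addr0 /k subrKC -mulrBr.
move=> ->; rewrite subr0 mulr1.
apply: le_trans (operator_norm_bilinear _ _ _) _.
rewrite ler_wpM2r ?enorm_ge0// ler_wpM2r ?enorm_ge0//.
rewrite -lee_fin; apply: le_trans UL; apply: ereal_sup_ubound.
by exists (u, w + r *: k).
Qed.

Lemma mixed_hessian_Linf_ge0 (U : E -> E -> R) : (0 <= mixed_hessian_Linf U)%E.
Proof.
apply: (@le_trans _ _ (operator_norm (mixed_hessian U 0 0))%:E).
  by rewrite lee_fin operator_norm_ge0.
by apply: ereal_sup_ubound; exists (0, 0).
Qed.

End mixed_mean_value.

(** * The bound on an abstract weighted space *)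

Section reduction.
Context {R : realType} {g : geometry} {d : nat}.
Local Notation X := (flat_space R g d).
Variables (om : X -> R) (m : probability X R).
Hypotheses (mom : measurable_fun setT om) (om1 : forall x, 1 <= om x)
  (omi : m.-integrable setT (EFin \o om)).
Hypothesis om_P2 : forall nu : probability X R,
  nu.-integrable setT (EFin \o om) -> P2 nu.
Variables W Wp Wm : X -> X -> R.
Hypotheses (WE : forall x y, W x y = Wp x y - Wm x y)
  (WpG : kernel_growth om Wp) (WmG : kernel_growth om Wm)
  (Wp_sym : forall x y, Wp x y = Wp y x) (Wm_sym : forall x y, Wm x y = Wm y x)
  (Wp_pos : positive_kernel Wp) (Wm_pos : positive_kernel Wm).

Let om0 x : 0 <= om x. Proof. exact: le_trans (om1 x). Qed.

Let Up := reduce m Wp.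
Let Um := reduce m Wm.

Let UpG : kernel_growth om Up. Proof. exact: reduce_growth. Qed.
Let UmG : kernel_growth om Um. Proof. exact: reduce_growth. Qed.
Let Up_sym x y : Up x y = Up y x. Proof. exact: reduce_sym. Qed.
Let Um_sym x y : Um x y = Um y x. Proof. exact: reduce_sym. Qed.

Let positive_om U : positive_kernel U -> om_positive om U.
Proof. by move=> Upos nu nu' inu inu'; apply: Upos; exact: om_P2. Qed.

Let Up_pos n (t : n.-tuple X) q : om_integrable om m q -> 0 <= quad_form m Up t q.
Proof. by move=> iq; apply: (reduce_quad_form_ge0 mom om1) => //; exact: positive_om. Qed.

Let Um_pos n (t : n.-tuple X) q : om_integrable om m q -> 0 <= quad_form m Um t q.
Proof. by move=> iq; apply: (reduce_quad_form_ge0 mom om1) => //; exact: positive_om. Qed.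

Let W_growth : kernel_growth om W.
Proof.
have [mp [C pC]] := WpG; have [mm [C' mC]] := WmG; split.
  by under eq_fun do rewrite WE; exact: measurable_funB.
exists (C + C') => x y; rewrite WE mulrDl.
by apply: le_trans (ler_normB _ _) _; rewrite lerD.
Qed.

Let W_sym x y : W x y = W y x. Proof. by rewrite !WE Wp_sym Wm_sym. Qed.

Let reduce_W x y : reduce m W x y = Up x y - Um x y.
Proof.
have meanE z : potential m W (cst 1) z =
    potential m Wp (cst 1) z - potential m Wm (cst 1) z.
  have i1 := om_integrable_cst omi 1.
  have ip := kernel_intl om1 WpG z i1; have im := kernel_intl om1 WmG z i1.
  rewrite /potential -RintegralB//; apply: eq_Rintegral => y' _.
  by rewrite WE mulrBl.
have selfE : pairing W m m = pairing Wp m m - pairing Wm m m.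
  rewrite !(pairing_self om1 omi)//.
  have ip := mean_integrable om1 omi WpG omi.
  have im := mean_integrable om1 omi WmG omi.
  by rewrite -RintegralB//; apply: eq_Rintegral => x' _; rewrite meanE.
rewrite /Up /Um !reduceE// !meanE selfE WE.
by ring.
Qed.

Let reduce_W_growth : kernel_growth om (reduce m W).
Proof. exact: reduce_growth. Qed.

Variables (delta eta a alpha beta : R).
Hypotheses (delta01 : 0 < delta <= 1) (eta0 : 0 < eta) (a0 : 0 <= a)
  (alpha0 : 0 <= alpha) (beta0 : 0 <= beta).
Hypothesis hF : forall nu : probability X R, P2 nu ->
  (delta%:E * relative_entropy nu m <= free_energy W m nu)%E.
Hypothesis energy_bound : forall f, entropy_density om m f ->
  energy m (fun x y => Up x y + Um x y) f f <= 2 * a * \int[m]_x psi (f x).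
Hypothesis variance : forall f, entropy_density om m f ->
  \int[m]_x ((Up x x + Um x x) * f x) - energy m (fun x y => Up x y + Um x y) f f <=
  alpha + beta * \int[m]_x psi (f x).

(** [hF] tested on the probability of density [f]; the coefficient [1 - delta] appears once [delta]
    times the entropy is moved to the right. *)
Let free_energy_density f : entropy_density om m f ->
  0 <= (1 - delta) * \int[m]_x psi (f x) +
       2^-1 * (energy m Up f f - energy m Um f f).
Proof.
move=> fd; have [f0 fi _ _] := fd.
have [nu [nuE nuom nuH _]] := entropy_density_prob mom om1 fd.
have := hF (om_P2 nuom); rewrite /free_energy nuH.
rewrite -[pairing _ _ _]/(pairing (reduce m W) nu nu).
have rsym x y : reduce m W x y = reduce m W y x by exact: reduce_sym.
rewrite (pairing_atoms_density mom om1 reduce_W_growth rsym nuE nuE)//.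
rewrite !mul0r !add0r -EFinM -EFinD lee_fin.
have -> : energy m (reduce m W) f f = energy m Up f f - energy m Um f f.
  have e := energy_kernelD om1 reduce_W_growth UmG fi fi.
  have UpE : (fun x y => reduce m W x y + Um x y) = Up.
    by apply/funext => x; apply/funext => y; rewrite reduce_W subrK.
  by rewrite UpE in e; rewrite e addrK.
move: (energy m Up f f) (energy m Um f f) (\int[m]_x psi (f x)) => A B E h.
by move: h; rewrite -subr_ge0; congr (0 <= _); ring.
Qed.

Let energy_bound_sum f : entropy_density om m f ->
  energy m Up f f + energy m Um f f <= 2 * a * \int[m]_x psi (f x).
Proof.
move=> fd; have [_ fi _ _] := fd; have := energy_bound fd.
by have -> := energy_kernelD om1 UpG UmG fi fi.
Qed.

(** [mean_field_bound] plus the entropy of [nuN]: the coefficient [1 - (1 - delta + eta * a)] leaves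
    [delta - eta * a], and the variance cost [beta] lowers it by a term of order [1 / n]. *)
Lemma free_energyN_lower n (nuN : probability (n.-tuple X) R) : (0 < n)%N ->
  (\int[nuN]_t (\sum_(i < n) om (tnth t i))%:E < +oo)%E ->
  ((delta - eta * a - (1 + eta^-1) * (beta / (2 * n%:R)))%:E *
     relative_entropy nuN (tuple_power m n) - ((1 + eta^-1) * (alpha / 2))%:E
   <= free_energyN W m nuN)%E.
Proof.
move=> n0 nu_om; rewrite /free_energyN.
set F := (n%:R / 2 * _)%:E.
have Pr := tuple_power_total m n.
set P := tuple_power m n in Pr F *.
(* Without absolute continuity, as with infinite entropy below, the right-hand side is [+oo],
   because the energy term is a real number. *)
have [dom|ndom] := pselect (nuN `<< P); last first.
  by rewrite /relative_entropy asboolF// addye// leey.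
(* This version of the derivative is finite and nonnegative at every point, as [mean_field_bound]
   requires of its density. *)
pose fe := Radon_Nikodym_SigmaFinite.f nuN P.
pose f t := fine (fe t).
have feE t : fe t = (f t)%:E.
  by rewrite fineK//; exact: Radon_Nikodym_SigmaFinite.f_fin_num.
have f0 t : 0 <= f t by rewrite fine_ge0//; exact: Radon_Nikodym_SigmaFinite.f_ge0.
have mfe : measurable_fun setT fe.
  by apply: measurable_int; exact: (Radon_Nikodym_SigmaFinite.f_integrable dom).
have mf : measurable_fun setT f by exact: measurableT_comp.
have nuE A : measurable A -> nuN A = (\int[P]_(x in A) (f x)%:E)%E.
  move=> mA; rewrite (Radon_Nikodym_SigmaFinite.f_integral dom)//.
  by apply: eq_integral => x _; rewrite -feE.
have HE := @relative_entropyE _ _ _ nuN P f Pr mf f0 nuE.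
have psi0 t : 0 <= psi (f t) by exact/psi_ge0/f0.
have [psioo|psioo] := ltP (\int[P]_t (psi (f t))%:E)%E +oo%E; last first.
  by move: psioo; rewrite leye_eq => /eqP psioo; rewrite HE psioo addye// leey.
have f1 : (\int[P]_t (f t)%:E = 1)%E by rewrite -nuE// probability_setT.
have mS : measurable_fun setT (fun t : n.-tuple X => \sum_(i < n) om (tnth t i)).
  by apply: measurable_sum => i; exact: (measurableT_comp mom (measurable_tnth i)).
have fom : (\int[P]_t ((\sum_(i < n) om (tnth t i)) * f t)%:E < +oo)%E.
  by rewrite -(@integral_density _ _ _ nuN P f mf f0 nuE _ mS).
have [delta_gt0 delta1] := andP delta01.
have := mean_field_bound mom om1 omi UpG UmG Up_sym Um_sym Up_pos Um_pos
  delta1 a0 alpha0 beta0 free_energy_density energy_bound_sum variance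
  n0 eta0 mf f0 f1 fom psioo.
cbv zeta.
have mpsi : measurable_fun setT (fun t => psi (f t)).
  exact: (measurableT_comp (@measurable_psi R) mf).
have ipsi : P.-integrable setT (EFin \o (fun t => psi (f t))).
  apply: integrableP_norm => //.
  by under eq_integral do rewrite ger0_norm//.
rewrite HE (integral_EFin ipsi) -/P; set H := \int[P]_t psi (f t).
have -> : F = (n%:R / 2 * \int[P]_t (n%:R^-1 ^+ 2 * (\sum_(i < n) \sum_(j < n)
    (Up (tnth t i) (tnth t j) - Um (tnth t i) (tnth t j))) * f t))%:E.
  rewrite /F; congr (_%:E); congr (_ * _).
  have pE t : pairing (reduced_kernel W m) (empirical R t) (empirical R t) =
      n%:R^-1 ^+ 2 * \sum_(i < n) \sum_(j < n)
        (Up (tnth t i) (tnth t j) - Um (tnth t i) (tnth t j)).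
    rewrite (pairing_empirical mom om1 t reduce_W_growth); congr (_ * _).
    by apply: eq_bigr => i _; apply: eq_bigr => j _; rewrite reduce_W.
  under eq_Rintegral do rewrite pE.
  rewrite (@Rintegral_density _ _ _ nuN P f mf f0 nuE)//.
  apply: measurable_funM => //; apply: measurable_sum => i; apply: measurable_sum => j.
  have mij := measurable_fun_pair (@measurable_tnth _ X n i) (measurable_tnth j).
  apply: measurable_funB; first exact: (measurableT_comp UpG.1 mij).
  exact: (measurableT_comp UmG.1 mij).
set I := n%:R / 2 * _ => hI; rewrite -EFinM -EFinB -EFinD lee_fin.
have nn : n%:R != 0 :> R by rewrite pnatr_eq0 -lt0n.
rewrite -lerBlDl; apply: le_trans hI.
rewrite le_eqVlt; apply/orP; left; apply/eqP; field.
by rewrite nn gt_eqF.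
Qed.

End reduction.

(** * Euclidean space *)

Section euclidean_space.
Context {R : realType} {d : nat}.
Local Notation X := (flat_space R Euclidean d).
Implicit Types x y : X.

Definition coords x : 'rV[R]_d := \row_i (tnth x i : R).

Lemma coordsK x : covering Euclidean (coords x) = x.
Proof. by apply: eq_from_tnth => i; rewrite tnth_mktuple mxE. Qed.

Lemma coveringK : cancel (@covering R Euclidean d) coords.
Proof. by move=> v; apply/rowP => i; rewrite mxE tnth_mktuple. Qed.

Lemma space_distE x y : space_dist x y = enorm (coords x - coords y).
Proof.
rewrite /space_dist (_ : [set _ | _ in _ & _ in _] = [set enorm (coords x - coords y)]).
  exact: inf1.
apply/seteqP; split => [_ [u /= <-] [v /= <-] <-|_ ->] /=.
  by rewrite !coveringK.
by exists (coords x); rewrite /= ?coordsK//; exists (coords y); rewrite /= ?coordsK.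
Qed.

Lemma space_dist_ge0 x y : 0 <= space_dist x y.
Proof. by rewrite space_distE enorm_ge0. Qed.

Lemma space_dist_sqr x y :
  space_dist x y ^+ 2 = \sum_(i < d) ((tnth x i : R) - (tnth y i : R)) ^+ 2.
Proof.
by rewrite space_distE enorm_sqr; apply: eq_bigr => i _; rewrite !mxE.
Qed.

Lemma modulus_sqr x : modulus x ^+ 2 = \sum_(i < d) (tnth x i : R) ^+ 2.
Proof.
rewrite space_dist_sqr; apply: eq_bigr => i _.
by rewrite tnth_mktuple mxE subr0.
Qed.

Definition moment_weight x : R := 1 + modulus x ^+ 2.

Lemma moment_weight_ge1 x : 1 <= moment_weight x.
Proof. by rewrite lerDl sqr_ge0. Qed.

Lemma measurable_coord (i : 'I_d) : measurable_fun setT (fun x : X => (tnth x i : R)).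
Proof. exact: (measurable_tnth i). Qed.

Lemma measurable_moment_weight : measurable_fun setT moment_weight.
Proof.
apply: measurable_funD => //.
under eq_fun do rewrite modulus_sqr.
apply: measurable_sum => i; apply: measurable_funX; exact: measurable_coord.
Qed.

Lemma measurable_space_dist :
  measurable_fun setT (fun p : X * X => space_dist p.1 p.2).
Proof.
rewrite (_ : (fun p => _) = fun p : X * X => Num.sqrt
    (\sum_(i < d) ((tnth p.1 i : R) - (tnth p.2 i : R)) ^+ 2)).
  apply: (measurableT_comp (continuous_measurable_fun (@sqrt_continuous R))).
  apply: measurable_sum => i; apply: measurable_funX; apply: measurable_funB.
    exact: measurableT_comp (measurable_coord i) measurable_fst.
  exact: measurableT_comp (measurable_coord i) measurable_snd.
apply/funext => p; rewrite -space_dist_sqr sqrtr_sqr ger0_norm//.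
exact: space_dist_ge0.
Qed.

Lemma quadratic_growth_weight U : symmetric_kernel U -> quadratic_growth U ->
  kernel_growth moment_weight U.
Proof.
move=> [mU _] [C UC]; split => //; exists `|C| => x y.
apply: le_trans (UC x y) _; rewrite /moment_weight.
have a0 := sqr_ge0 (modulus x); have b0 := sqr_ge0 (modulus y).
move: (modulus x ^+ 2) (modulus y ^+ 2) a0 b0 => a b a0 b0.
have := ler_norm C; have := normr_ge0 C; nra.
Qed.

Lemma P2_weight (nu : probability X R) :
  P2 nu <-> nu.-integrable setT (EFin \o moment_weight).
Proof.
have mm : measurable_fun setT (fun x : X => modulus x ^+ 2).
  under eq_fun do rewrite modulus_sqr.
  by apply: measurable_sum => i; apply: measurable_funX; exact: measurable_coord.
split=> [h|h].
  apply: integrable_D; first exact: integrable_cst.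
  apply: integrableP_norm => //.
  by under eq_integral do rewrite ger0_norm ?sqr_ge0//.
have i1 : nu.-integrable setT (EFin \o (fun x => modulus x ^+ 2)).
  apply: integrable_dominated h => // x.
  by rewrite ger0_norm ?sqr_ge0// lerDr.
by rewrite /P2 (integral_EFin i1) ltry.
Qed.

Lemma coord_le_weight (i : 'I_d) x : `|(tnth x i : R)| <= moment_weight x.
Proof.
rewrite /moment_weight modulus_sqr.
apply: (@le_trans _ _ (1 + (tnth x i : R) ^+ 2)).
  move: (tnth x i : R) => u; have := normr_ge0 u.
  rewrite -[u ^+ 2]real_normK ?num_real//; nra.
by rewrite lerD2l (bigD1 i)//= lerDl sumr_ge0// => j _; rewrite sqr_ge0.
Qed.

Lemma coord_sqr_le_weight (i : 'I_d) x : (tnth x i : R) ^+ 2 <= moment_weight x.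
Proof.
rewrite /moment_weight modulus_sqr (bigD1 i)//= addrCA lerDl addr_ge0//.
by rewrite sumr_ge0// => j _; rewrite sqr_ge0.
Qed.

Lemma coord_lipschitz (i : 'I_d) x y : (tnth x i : R) - (tnth y i : R) <= space_dist x y.
Proof.
apply: le_trans (ler_norm _) _.
rewrite -(ler_pXn2r (ltn0Sn 1)) ?nnegrE ?space_dist_ge0// real_normK ?num_real//.
rewrite space_dist_sqr (bigD1 i)//= lerDl sumr_ge0// => j _.
by rewrite sqr_ge0.
Qed.

Lemma space_dist_sqr_triangle x y e :
  space_dist x e ^+ 2 <= 2 * space_dist x y ^+ 2 + 2 * space_dist y e ^+ 2.
Proof.
rewrite !space_dist_sqr !mulr_sumr -big_split/=; apply: ler_sum => i _.
move: (tnth x i : R) (tnth y i : R) (tnth e i : R) => a b c.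
by rewrite -subr_ge0 (_ : _ - _ = (a - 2 * b + c) ^+ 2) ?sqr_ge0//; ring.
Qed.

Lemma rect_Linf (U : X -> X -> R) L : mixed_differentiable (lifted U) ->
  (mixed_hessian_Linf (lifted U) <= L%:E)%E ->
  forall x y z w, rect U x y z w <= L * space_dist x y * space_dist z w.
Proof.
move=> dU UL x y z w.
have := rect_mixed_hessian dU UL (coords x) (coords y) (coords z) (coords w).
by rewrite /lifted !coordsK -!space_distE.
Qed.

End euclidean_space.

(** * Truncation and passage to the limit *)

Section truncation.
Context {R : realType}.

Definition truncate (K u : R) : R := Num.max (- K) (Num.min K u).

Lemma truncate_bounds K u : 0 <= K -> - K <= truncate K u <= K.
Proof.
move=> K0; rewrite /truncate; apply/andP; split; first by rewrite le_max lexx.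
by rewrite ge_max ge_min lexx andbT; lra.
Qed.

Lemma truncate_norm_le K u : 0 <= K -> `|truncate K u| <= `|u|.
Proof.
move=> K0; rewrite /truncate.
case: (leP K u) => h1; [rewrite max_r; last lra|].
  by rewrite !ger0_norm//; lra.
by case: (leP (- K) u) => h2 //; rewrite !ler0_norm; lra.
Qed.

Lemma truncate_id K u : `|u| <= K -> truncate K u = u.
Proof. by rewrite ler_norml => /andP[h1 h2]; rewrite /truncate min_r// max_r. Qed.

(** [truncate K] is the projection onto the interval from [- K] to [K]: the residual points
    outwards, away from every [c] in the interval. *)
Lemma truncate_mono K u c : 0 <= K -> - K <= c <= K ->
  0 <= (truncate K u - c) * (u - truncate K u).
Proof.
move=> K0 /andP[c1 c2]; rewrite /truncate.
case: (leP K u) => h1; [rewrite max_r; last lra|].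
  by rewrite mulr_ge0; lra.
case: (leP (- K) u) => h2; first by rewrite subrr mulr0.
by rewrite -mulrNN mulr_ge0; lra.
Qed.

Lemma measurable_truncate K : measurable_fun setT (truncate K).
Proof. by apply: measurable_maxr => //; exact: measurable_minr. Qed.

Lemma truncate_cvg u : (fun n : nat => truncate n%:R u) @ \oo --> u.
Proof.
apply: cvg_near_cst; near=> n; apply: truncate_id.
near: n; exists (Num.truncn `|u|).+1 => // n /= h.
apply: ltW; apply: lt_le_trans (truncnS_gt _) _.
by rewrite ler_nat.
Unshelve. all: by end_near.
Qed.

End truncation.

Section truncated_variance.
Context {d} {T : measurableType d} {R : realType}.
Variables (m : probability T R) (u : T -> R) (B : R).
Hypotheses (mu : measurable_fun setT u)
  (iu : m.-integrable setT (EFin \o u))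
  (iu2 : m.-integrable setT (EFin \o (fun x => u x ^+ 2))).

Let tau n x := truncate n%:R (u x).

Let mtau n : measurable_fun setT (tau n).
Proof. exact: (measurableT_comp (measurable_truncate _) mu). Qed.

Let Rcvg (f : nat -> T -> R) (f' h : T -> R) : (forall n, measurable_fun setT (f n)) ->
  (forall x, f ^~ x @ \oo --> f' x) -> (forall n x, `|f n x| <= h x) ->
  m.-integrable setT (EFin \o h) -> measurable_fun setT f' ->
  (fun n => \int[m]_x f n x) @ \oo --> \int[m]_x f' x.
Proof.
move=> mf ff' fh ih mf'.
have h0 x : 0 <= h x by exact: le_trans (fh 0%N x).
have if' : m.-integrable setT (EFin \o f').
  apply: integrable_dominated ih => // x.
  have fn : (fun n => `|f n x|) @ \oo --> `|f' x| by apply: cvg_norm; exact: ff'.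
  by apply: (ler_cvg_to fn (cvg_cst (h x))); near=> n.
have := @dominated_cvg _ _ R m setT measurableT (fun n => EFin \o f n) (EFin \o f')
  (EFin \o h) (fun n => proj2 (measurable_EFinP _ _) (mf n)).
have ptw x : setT x -> (fun n => (EFin \o f n) x) @ \oo --> (EFin \o f') x.
  by move=> _; apply/fine_cvgP; split; [near=> n|exact: ff'].
move=> /(_ ptw (fun _ _ => isT) ih (fun n x _ => fh n x)).
rewrite (integral_EFin if') => /fine_cvgP[_]; apply.
Unshelve. all: by end_near.
Qed.

Lemma truncated_variance_limit :
  (forall n, \int[m]_x (tau n x ^+ 2) - (\int[m]_x tau n x) ^+ 2 <= B) ->
  \int[m]_x (u x ^+ 2) - (\int[m]_x u x) ^+ 2 <= B.
Proof.
move=> hB.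
have c1 : (fun n => \int[m]_x tau n x) @ \oo --> \int[m]_x u x.
  apply: (Rcvg mtau _ _ (integrable_abs iu) mu).
    by move=> x; exact: truncate_cvg.
  by move=> n x; exact: truncate_norm_le.
have c2 : (fun n => \int[m]_x (tau n x ^+ 2)) @ \oo --> \int[m]_x (u x ^+ 2).
  apply: (Rcvg (f := fun n x => tau n x ^+ 2) _ _ _ iu2).
  - by move=> n; exact: measurable_funX.
  - by move=> x; apply: cvgM; exact: truncate_cvg.
  - move=> n x; rewrite normrX -[leRHS]real_normK ?num_real//.
    by rewrite ler_pXn2r ?nnegrE// truncate_norm_le.
  - exact: measurable_funX.
have c3 : (fun n => \int[m]_x (tau n x ^+ 2) - (\int[m]_x tau n x) ^+ 2) @ \oo -->
    \int[m]_x (u x ^+ 2) - (\int[m]_x u x) ^+ 2.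
  exact: (cvgB c2 (cvgM c1 c1)).
by apply: (ler_cvg_to c3 (cvg_cst B)); near=> n; exact: hB.
Unshelve. all: by end_near.
Qed.

End truncated_variance.

(** Removes the slack of near-optimal couplings. By subadditivity of the square root, a slack
    [del ^+ 2] costs at most [c * del], which is below [e] for [del = e / (c + 1)]. *)
Lemma le_sqrt_limit {R : realType} (A c V : R) : 0 <= c -> 0 <= V ->
  (forall e, 0 < e -> A <= c * Num.sqrt (V + e)) -> A <= c * Num.sqrt V.
Proof.
move=> c0 V0 h; apply/ler_addgt0Pl => e e0.
pose del := e / (c + 1).
have del0 : 0 < del by rewrite divr_gt0//; lra.
have := h (del ^+ 2) (exprn_gt0 2 del0); move/le_trans; apply.
have s0 := sqrtr_ge0 V.
have : Num.sqrt (V + del ^+ 2) <= Num.sqrt V + del.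
  have sd0 : 0 <= Num.sqrt V + del by rewrite addr_ge0// ltW.
  rewrite -[leRHS](ger0_norm sd0) -sqrtr_sqr ler_wsqrtr//.
  rewrite sqrrD sqr_sqrtr// lerD2r lerDl mulrn_wge0// mulr_ge0//.
  exact: ltW.
move=> /(ler_wpM2l c0) /le_trans; apply.
rewrite mulrDr addrC lerD2r.
rewrite /del mulrA ler_pdivrMr; last lra.
by have := ltW e0; nra.
Qed.

(** * Consequences of Talagrand's inequality *)

Section talagrand_consequences.
Context {R : realType} {d : nat}.
Local Notation X := (flat_space R Euclidean d).
Variables (m : probability X R) (rho : R).
Hypotheses (rho0 : 0 < rho) (mP2 : P2 m) (mT : talagrand rho m).

Local Notation om := (@moment_weight R d).
Local Notation Ent f := (\int[m]_x psi (f x)).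

Let mom := @measurable_moment_weight R d.
Let om1 := @moment_weight_ge1 R d.
Let omi : m.-integrable setT (EFin \o om). Proof. exact/P2_weight. Qed.

Let bounded_by_weight (mu : probability X R) (k : X -> R) C :
  mu.-integrable setT (EFin \o om) -> measurable_fun setT k ->
  (forall x, `|k x| <= C * om x) -> mu.-integrable setT (EFin \o k).
Proof. by move=> imu mk kC; exact: integrable_dominated mk kC (integrable_Z C imu). Qed.

(** The infimum that defines [W2_square] is only approached, hence the slack [e]. If every coupling
    cost more than the stated value, so would the infimum, against Talagrand's inequality. *)
Lemma talagrand_coupling (nu : probability X R) H e : P2 nu ->
  relative_entropy nu m = H%:E -> 0 < e ->
  exists pi : probability (X * X)%type R,
  [/\ forall A, measurable A -> pi (A `*` setT) = nu A,
      forall A, measurable A -> pi (setT `*` A) = m A &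
      (\int[pi]_p (space_dist p.1 p.2 ^+ 2)%:E <= (2 * H / rho + e)%:E)%E].
Proof.
move=> nuP2 nuH e0; have := mT nuP2; rewrite nuH => h.
apply: contrapT => hn.
suff : ((2 * H / rho + e)%:E <= W2_square nu m)%E.
  move=> h2; have : ((rho / 2 * (2 * H / rho + e))%:E <= H%:E)%E.
    by apply: le_trans h; rewrite EFinM lee_pmul2l// lte_fin divr_gt0.
  rewrite lee_fin; have -> : rho / 2 * (2 * H / rho + e) = H + rho * e / 2.
    by field; rewrite gt_eqF.
  by rewrite gerDl leNgt divr_gt0// mulr_gt0.
apply: le_ereal_inf_tmp => _ [pi [pi1 pi2] <-].
rewrite leNgt; apply/negP => hlt; apply: hn; exists pi; split => //.
exact: ltW.
Qed.

Lemma talagrand_lipschitz f (k : X -> R) C c : entropy_density om m f ->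
  measurable_fun setT k -> (forall x, `|k x| <= C * om x) -> 0 <= c ->
  (forall x y, k x - k y <= c * space_dist x y) ->
  \int[m]_x (k x * (f x + cst (-1) x)) <= c * Num.sqrt (2 * Ent f / rho).
Proof.
move=> fd mk kC c0 kL; have [f0 fi _ _] := fd.
have [nu [_ nuom nuH nuI]] := entropy_density_prob mom om1 fd.
have [ik kE] := nuI k C mk kC.
have ikm := bounded_by_weight omi mk kC.
have ikf := om_integrableM om1 fi mk kC.
have -> : \int[m]_x (k x * (f x + cst (-1) x)) = \int[nu]_x k x - \int[m]_x k x.
  rewrite kE -RintegralB//; apply: eq_Rintegral => x _.
  by rewrite mulrDr mulrN1.
have E0 := entropy_ge0 fd.
apply: le_sqrt_limit => //; first by rewrite divr_ge0 ?mulr_ge0// ltW.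
move=> e e0.
have [pi [pi1 pi2 piV]] := talagrand_coupling (proj2 (P2_weight nu) nuom) nuH e0.
exact: (coupling_lipschitz pi1 pi2 (@measurable_space_dist R d)
  (@space_dist_ge0 R d) ik ikm c0 kL piV).
Qed.

(** The quadratic triangle inequality along a near-optimal coupling: the transport cost [2 H / rho]
    is doubled, which gives [4 / rho]. *)
Lemma talagrand_second_moment f e : entropy_density om m f ->
  \int[m]_x (space_dist x e ^+ 2 * f x) <=
  4 / rho * Ent f + 2 * \int[m]_x (space_dist x e ^+ 2).
Proof.
move=> fd; have [f0 fi _ _] := fd.
have [nu [_ nuom nuH nuI]] := entropy_density_prob mom om1 fd.
have mD : measurable_fun setT (fun x => space_dist x e ^+ 2).
  apply: measurable_funX; apply: (@measurable_pairr _ _ X X R (@space_dist R Euclidean d)).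
  exact: measurable_space_dist.
have DC x : `|space_dist x e ^+ 2| <= (2 + 2 * modulus e ^+ 2) * om x.
  rewrite ger0_norm ?sqr_ge0//; apply: le_trans (space_dist_sqr_triangle x (covering _ 0) e) _.
  rewrite -/(modulus x) -/(moment_weight x) /moment_weight.
  have -> : space_dist (covering Euclidean 0) e ^+ 2 = modulus e ^+ 2.
    rewrite modulus_sqr space_dist_sqr; apply: eq_bigr => i _.
    by rewrite tnth_mktuple mxE sub0r sqrrN.
  have := sqr_ge0 (modulus x); have := sqr_ge0 (modulus e); nra.
have [iD <-] := nuI _ _ mD DC.
have iDm := bounded_by_weight omi mD DC.
apply/ler_addgt0Pl => eps eps0.
(* The slack is halved since the triangle inequality doubles the transport cost. *)
have eps2 : 0 < eps / 2 by rewrite divr_gt0.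
have [pi [pi1 pi2 piV]] := talagrand_coupling (proj2 (P2_weight nu) nuom) nuH eps2.
have := coupling_second_moment pi1 pi2 (@measurable_space_dist R d)
  iD iDm (fun x y => space_dist_sqr_triangle x y e) piV.
move/le_trans; apply.
by rewrite le_eqVlt; apply/orP; left; apply/eqP; field; rewrite gt_eqF.
Qed.

(* Talagrand's inequality is tested on the density 1 + F / (2K), F the centered
   truncation of a coordinate; there H <= chi^2 gives Var F <= 2 / rho. *)
Lemma talagrand_truncated_variance (i : 'I_d) K : 0 < K ->
  \int[m]_x (truncate K (tnth x i : R) ^+ 2) -
  (\int[m]_x truncate K (tnth x i : R)) ^+ 2 <= 2 / rho.
Proof.
move=> K0; pose u (x : X) : R := tnth x i; pose phi x := truncate K (u x).
have mu : measurable_fun setT u by exact: measurable_coord.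
have mphi : measurable_fun setT phi.
  exact: (measurableT_comp (measurable_truncate K) mu).
have phiK x : - K <= phi x <= K by apply: truncate_bounds; exact: ltW.
have iphi : m.-integrable setT (EFin \o phi).
  apply: integrable_dominated (integrable_cst m K) => // x.
  by rewrite ler_norml phiK.
pose c := \int[m]_x phi x.
have cK : - K <= c <= K.
  have iK r : m.-integrable setT (EFin \o fun=> r) := integrable_cst m r.
  apply/andP; split.
    rewrite -[leLHS](Rintegral_cst_prob m (- K)).
    by apply: le_Rintegral => // x _; case/andP: (phiK x).
  rewrite -[leRHS](Rintegral_cst_prob m K).
  by apply: le_Rintegral => // x _; case/andP: (phiK x).
pose F x := phi x - c.
have mF : measurable_fun setT F by exact: measurable_funB.
have F2K x : `|F x| <= 2 * K.
  have := phiK x; move: cK; rewrite /F ler_norml => /andP[c1 c2] /andP[p1 p2].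
  by apply/andP; split; lra.
have iF : m.-integrable setT (EFin \o F).
  by apply: integrable_B => //; exact: integrable_cst.
have F0 : \int[m]_x F x = 0.
  rewrite RintegralB//; last exact: integrable_cst.
  by rewrite Rintegral_cst_prob subrr.
have mF2 : measurable_fun setT (fun x => F x ^+ 2) by exact: measurable_funX.
have iF2 : m.-integrable setT (EFin \o (fun x => F x ^+ 2)).
  apply: integrable_dominated (integrable_cst m ((2 * K) ^+ 2)) => // x.
  by rewrite normrX ler_pXn2r ?nnegrE ?mulr_ge0// ltW.
pose V := \int[m]_x (F x ^+ 2).
have V0 : 0 <= V by apply: Rintegral_ge0 => x _; rewrite sqr_ge0.
have -> : \int[m]_x (truncate K (tnth x i : R) ^+ 2) -
    (\int[m]_x truncate K (tnth x i : R)) ^+ 2 = V.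
  have E x : phi x ^+ 2 = F x ^+ 2 + (2 * c * F x + cst (c ^+ 2) x).
    by rewrite /F /=; ring.
  rewrite (_ : \int[m]_x _ = \int[m]_x (F x ^+ 2 + (2 * c * F x + cst (c ^+ 2) x))).
    have i1 := integrable_Z (2 * c) iF; have i2 := integrable_cst m (c ^+ 2).
    rewrite (RintegralD measurableT iF2 (integrable_D i1 i2)).
    rewrite (RintegralD measurableT i1 i2) RintegralZl// F0 mulr0 add0r.
    by rewrite Rintegral_cst_prob addrK.
  by apply: eq_Rintegral => x _; rewrite E.
pose t := (2 * K)^-1.
have t0 : 0 < t by rewrite invr_gt0 mulr_gt0.
have tF x : `|t * F x| <= 1.
  by rewrite normrM gtr0_norm// mulrC ler_pdivrMr ?mulr_gt0// mul1r.
pose g x := 1 + t * F x.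
have g0 x : 0 <= g x.
  by have := tF x; rewrite /g ler_norml => /andP[h _]; lra.
have mg : measurable_fun setT g by apply: measurable_funD => //; exact: measurable_funM.
have ig : om_integrable om m g.
  split => //; apply: integrable_dominated (integrable_Z 2 omi).
    exact: measurable_funM.
  move=> x; have w0 : 0 <= om x by apply: le_trans (om1 x).
  rewrite normrM (ger0_norm w0) mulrC ler_wpM2r//.
  by apply: le_trans (ler_normD _ _) _; rewrite normr1 lerD2l.
have itF := integrable_Z t iF.
have g1 : \int[m]_x g x = 1.
  have i1 : m.-integrable setT (EFin \o fun=> 1 : R) := integrable_cst m 1.
  by rewrite RintegralD// RintegralZl// F0 mulr0 addr0 Rintegral_cst_prob.
have psig x : psi (g x) <= t ^+ 2 * F x ^+ 2.
  by apply: le_trans (psi_le_sqr (g0 x)) _; rewrite /g addrC addrA addNr add0r exprMn.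
have it2 := integrable_Z (t ^+ 2) iF2.
have ipsi : m.-integrable setT (EFin \o (fun x => psi (g x))).
  apply: integrable_dominated it2; first exact: (measurableT_comp (@measurable_psi R) mg).
  by move=> x; rewrite ger0_norm ?psi_ge0.
have gd : entropy_density om m g by [].
have EntV : Ent g <= t ^+ 2 * V.
  by rewrite /V -RintegralZl//; apply: le_Rintegral.
have u_om x : `|u x| <= 1 * om x by rewrite mul1r; exact: coord_le_weight.
have uL x y : u x - u y <= 1 * space_dist x y by rewrite mul1r; exact: coord_lipschitz.
have h := talagrand_lipschitz gd mu u_om ler01 uL.
have iu := bounded_by_weight omi mu u_om.
have iuF : m.-integrable setT (EFin \o (fun x => u x * (t * F x))).
  apply: integrable_dominated (integrable_abs iu).
    by apply: measurable_funM => //; exact: measurable_funM.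
  by move=> x; rewrite normrM ler_piMr.
(* The test function is the untruncated coordinate, which is 1-Lipschitz; by [truncate_mono] its
   covariance with the truncation is at least the variance of the truncation. *)
have tV : t * V <= \int[m]_x (u x * (g x + cst (-1) x)).
  rewrite /V -RintegralZl//.
  rewrite (_ : \int[m]_x (u x * _) = \int[m]_x (u x * (t * F x) - c * (t * F x))).
    apply: le_Rintegral => //.
    - exact: integrable_Z.
    - by apply: integrable_B => //; exact: integrable_Z.
    move=> x _; rewrite -subr_ge0.
    have -> : u x * (t * F x) - c * (t * F x) - t * F x ^+ 2 =
        t * ((truncate K (u x) - c) * (u x - truncate K (u x))).
      by rewrite /F /phi; ring.
    apply: mulr_ge0; [exact: ltW|exact: (truncate_mono (u x) (ltW K0) cK)].
  rewrite RintegralB//; last exact: integrable_Z.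
  rewrite [X in _ - X]RintegralZl// RintegralZl// F0 !mulr0 subr0.
  by apply: eq_Rintegral => x _; rewrite /g /= addrC addrA addNr add0r.
rewrite mul1r in h.
have E0 := entropy_ge0 gd.
(* [t * V] is a lower bound for a transported 1-Lipschitz mean, so its square is at most
   [2 H / rho], while [H <= t^2 V]. The scale [t] cancels and leaves [V^2 <= 2 V / rho]. *)
have : (t * V) ^+ 2 <= 2 * (t ^+ 2 * V) / rho.
  have tV0 : 0 <= t * V by rewrite mulr_ge0// ltW.
  apply: (@le_trans _ _ (2 * Ent g / rho)); last first.
    by rewrite ler_pM2r ?invr_gt0// ler_pM2l.
  have s0 : 0 <= 2 * Ent g / rho by rewrite divr_ge0 ?mulr_ge0// ltW.
  rewrite -[leRHS](sqr_sqrtr s0) ler_pXn2r ?nnegrE ?sqrtr_ge0//.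
  exact: le_trans tV h.
rewrite exprMn => h2.
have {h2} : V ^+ 2 <= 2 * V / rho.
  rewrite -(ler_pM2l (exprn_gt0 2 t0)); apply: le_trans h2 _.
  by rewrite le_eqVlt; apply/orP; left; apply/eqP; ring.
move: V0; rewrite le_eqVlt => /predU1P[<- _|V0]; first by rewrite divr_ge0// ltW.
rewrite expr2 -[2 * V]mulrC -mulrA ler_pM2l//.
Qed.

Lemma talagrand_coord_variance (i : 'I_d) :
  \int[m]_x ((tnth x i : R) ^+ 2) - (\int[m]_x (tnth x i : R)) ^+ 2 <= 2 / rho.
Proof.
have mu := @measurable_coord R d i.
have iu : m.-integrable setT (EFin \o (fun x : X => tnth x i : R)).
  by apply: (bounded_by_weight (C := 1)) => // x; rewrite mul1r coord_le_weight.
have iu2 : m.-integrable setT (EFin \o (fun x : X => (tnth x i : R) ^+ 2)).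
  apply: (bounded_by_weight (C := 1)) => //; first exact: measurable_funX.
  by move=> x; rewrite ger0_norm ?sqr_ge0// mul1r coord_sqr_le_weight.
(* The level 0 of the sequence is treated apart, as the truncated bound requires a positive level;
   that truncation is identically 0. *)
apply: (truncated_variance_limit mu iu iu2) => -[|n].
  have z x : truncate 0 (tnth x i : R) = 0.
    have := truncate_bounds (tnth x i : R) (lexx (0 : R)); rewrite oppr0 => h.
    by apply/eqP; rewrite eq_le andbC.
  have -> : \int[m]_x (truncate 0 (tnth x i : R) ^+ 2) = 0.
    rewrite -[RHS](Rintegral_cst_prob m 0); apply: eq_Rintegral => x _.
    by rewrite z expr0n.
  by rewrite sub0r; apply: (@le_trans _ _ 0); rewrite ?oppr_le0 ?sqr_ge0// divr_ge0// ltW.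
exact: talagrand_truncated_variance.
Qed.

Definition barycenter : X := covering Euclidean (\row_i \int[m]_x (tnth x i : R)).

(** About the barycenter the second moment splits into the [d] coordinate variances; this is where
    the dimension enters the constants. *)
Lemma talagrand_variance :
  \int[m]_x (space_dist x barycenter ^+ 2) <= 2 / rho * d%:R.
Proof.
have mu i := @measurable_coord R d i.
have iu i : m.-integrable setT (EFin \o (fun x : X => tnth x i : R)).
  by apply: (bounded_by_weight (C := 1)) => // x; rewrite mul1r coord_le_weight.
have iu2 i : m.-integrable setT (EFin \o (fun x : X => (tnth x i : R) ^+ 2)).
  apply: (bounded_by_weight (C := 1)) => //; first exact: measurable_funX.
  by move=> x; rewrite ger0_norm ?sqr_ge0// mul1r coord_sqr_le_weight.
pose e i : R := \int[m]_x (tnth x i : R).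
have ei i : m.-integrable setT (EFin \o fun=> e i ^+ 2) := integrable_cst m (e i ^+ 2).
under eq_Rintegral do rewrite space_dist_sqr.
have E i x : ((tnth x i : R) - (tnth barycenter i : R)) ^+ 2 =
    (tnth x i : R) ^+ 2 + ((- 2 * e i) * (tnth x i : R) + e i ^+ 2).
  by rewrite tnth_mktuple mxE -/(e i) /=; ring.
have ia i := integrable_Z (- 2 * e i) (iu i).
rewrite Rintegral_sum; last first.
  by move=> i; under eq_fun do rewrite E; apply: integrable_D => //; exact: integrable_D.
apply: (@le_trans _ _ (\sum_(i < d) 2 / rho)); last first.
  by rewrite sumr_const card_ord mulr_natr.
apply: ler_sum => i _; under eq_Rintegral do rewrite E.
rewrite (RintegralD measurableT (iu2 i) (integrable_D (ia i) (ei i))).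
rewrite (RintegralD measurableT (ia i) (ei i)) RintegralZl// Rintegral_cst_prob.
have := talagrand_coord_variance i; rewrite -/(e i); congr (_ <= _).
by ring.
Qed.

End talagrand_consequences.

(** * The two geometries *)

Section torus.
Context {R : realType} {d : nat}.
Local Notation X := (flat_space R Torus d).
Implicit Types x : X.

Lemma circle_representative (s : circle R) : exists2 r : R, circle_proj r = s & 0 <= r <= 1.
Proof.
pose r := repr s; exists (r - (Num.floor r)%:~R).
  rewrite -[RHS]reprK -/r; apply/eqmodP.
  rewrite /= /int_congr addrAC subrr sub0r rpredN.
  exact: intr_int.
by have := floor_itv r; rewrite intrD => /andP[h1 h2]; apply/andP; split; lra.
Qed.

Lemma torus_representative x :
  exists2 u : 'rV[R]_d, covering Torus u = x & enorm u <= Num.sqrt d%:R.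
Proof.
have /choice[r hr] : forall i : 'I_d, exists r : R,
    circle_proj r = tnth x i /\ 0 <= r <= 1.
  by move=> i; have [r h1 h2] := circle_representative (tnth x i); exists r.
exists (\row_i r i).
  by apply: eq_from_tnth => i; rewrite tnth_mktuple mxE; case: (hr i).
rewrite ler_wsqrtr//; apply: (@le_trans _ _ (\sum_(i < d) 1)); last first.
  by rewrite sumr_const card_ord.
apply: ler_sum => i _; rewrite mxE; case: (hr i) => _ /andP[h1 h2].
by rewrite expr_le1.
Qed.

Lemma torus_modulus x : 0 <= modulus x <= Num.sqrt d%:R.
Proof.
have [u ux hu] := torus_representative x.
have lb : lbound [set enorm (u - v) | u in covering Torus @^-1` [set x]
    & v in covering Torus @^-1` [set covering Torus (0 : 'rV[R]_d)]] 0.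
  by move=> _ [a _] [b _] <-; exact: enorm_ge0.
have mem : [set enorm (u - v) | u in covering Torus @^-1` [set x]
    & v in covering Torus @^-1` [set covering Torus (0 : 'rV[R]_d)]] (enorm u).
  by exists u => //; exists 0 => //; rewrite subr0.
apply/andP; split; first by apply: lb_le_inf => //; exists (enorm u).
by apply: le_trans hu; apply: ge_inf => //; exists 0.
Qed.

Lemma torus_modulus_sqr x : modulus x ^+ 2 <= d%:R.
Proof.
have /andP[h0 h1] := torus_modulus x.
rewrite -[leRHS](@sqr_sqrtr R)//.
by rewrite ler_pXn2r ?nnegrE ?sqrtr_ge0.
Qed.

Lemma torus_P2 (nu : probability X R) : P2 nu.
Proof.
have dE : (\int[nu]_x (d%:R)%:E = (d%:R)%:E :> \bar R)%E.
  by rewrite integral_EFin ?Rintegral_cst_prob//; exact: (integrable_cst nu d%:R).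
apply: (@le_lt_trans _ _ (\int[nu]_x (d%:R)%:E)%E); last by rewrite dE ltry.
rewrite !ge0_integralTE//; last by move=> x; rewrite lee_fin sqr_ge0.
apply: ereal_sup_le => _ [h hle <-]; exists h => // x.
by apply: le_trans (hle x) _; rewrite lee_fin torus_modulus_sqr.
Qed.

Lemma torus_growth (U : X -> X -> R) : symmetric_kernel U -> quadratic_growth U ->
  kernel_growth (cst 1) U.
Proof.
move=> [mU _] [C UC]; split => //; exists (`|C| * (1 + 2 * d%:R)) => x y /=.
apply: le_trans (UC x y) _.
have hx := torus_modulus_sqr x; have hy := torus_modulus_sqr y.
have x0 := sqr_ge0 (modulus x); have y0 := sqr_ge0 (modulus y).
move: (modulus x ^+ 2) (modulus y ^+ 2) (d%:R : R) hx hy x0 y0 => a b e ae be a0 b0.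
have C1 := ler_norm C; have C0 := normr_ge0 C.
apply: (@le_trans _ _ (`|C| * (1 + a + b))); first by rewrite ler_wpM2r//; lra.
rewrite -mulrA ler_wpM2l//; lra.
Qed.

End torus.

Section rectangles.
Context {R : realType} {g : geometry} {d : nat}.
Local Notation X := (flat_space R g d).

Lemma Osc2_rect (U U' : X -> X -> R) M : (Osc2 U + Osc2 U' <= M%:E)%E ->
  forall x y z w, rect (fun x y => U x y + U' x y) x y z w <= M.
Proof.
move=> UM x y z w; rewrite -lee_fin; apply: le_trans UM.
have -> : rect (fun x y => U x y + U' x y) x y z w =
  (U x z - U x w - U y z + U y w) + (U' x z - U' x w - U' y z + U' y w).
  by rewrite /rect; ring.
by rewrite EFinD leeD//; apply: ereal_sup_ubound; exists x, y, z, w.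
Qed.

End rectangles.

Lemma rect_reduce {d} {T : measurableType d} {R : realType}
    (m : probability T R) (U : T -> T -> R) x y z w :
  (forall x y, U x y = U y x) -> rect (reduce m U) x y z w = rect U x y z w.
Proof. by move=> Usym; rewrite /rect !reduceE//; ring. Qed.

(** * Assembly of the constants for a general weight, distance and centre *)

Section main.
Context {R : realType} {g : geometry} {d : nat}.
Local Notation X := (flat_space R g d).
Variables (om : X -> R) (m : probability X R).
Hypotheses (mom : measurable_fun setT om) (om1 : forall x, 1 <= om x)
  (omi : m.-integrable setT (EFin \o om)).
Hypothesis om_P2 : forall nu : probability X R,
  nu.-integrable setT (EFin \o om) -> P2 nu.
Variables (W Wp Wm B Q : X -> X -> R) (r : X -> X -> R) (MW LW rho : R).
Hypotheses (WE : forall x y, W x y = Wp x y - Wm x y)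
  (WpG : kernel_growth om Wp) (WmG : kernel_growth om Wm)
  (Wp_sym : forall x y, Wp x y = Wp y x) (Wm_sym : forall x y, Wm x y = Wm y x)
  (Wp_pos : positive_kernel Wp) (Wm_pos : positive_kernel Wm).
Hypotheses (MW0 : 0 <= MW) (LW0 : 0 <= LW) (rho0 : 0 < rho).
Hypotheses (mB : measurable_fun setT (fun p : X * X => B p.1 p.2))
  (mQ : measurable_fun setT (fun p : X * X => Q p.1 p.2))
  (BQ : forall x y, Wp x y + Wm x y = B x y + Q x y)
  (B_rect : forall x y z w, rect B x y z w <= 4 * MW)
  (Q_rect : forall x y z w, rect Q x y z w <= LW * r x y * r z w)
  (r0 : forall x y, 0 <= r x y).
Hypothesis lipschitz : forall f, entropy_density om m f ->
  forall (k : X -> R) (C c : R), measurable_fun setT k ->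
  (forall x, `|k x| <= C * om x) -> 0 <= c -> (forall x y, k x - k y <= c * r x y) ->
  \int[m]_x (k x * (f x + cst (-1) x)) <= c * Num.sqrt (2 * \int[m]_x psi (f x) / rho).
Variables (e : X) (zeta : X -> R) (Cz : R).
Hypotheses (mzeta : measurable_fun setT zeta) (zeta_om : forall x, `|zeta x| <= Cz * om x)
  (zeta_rect : forall x, 4 * MW + LW * r x e * r x e <= zeta x).
Hypothesis zeta_int : forall f, entropy_density om m f ->
  \int[m]_x (zeta x * f x) <= (4 * MW + 4 * (LW / rho) * d%:R) +
    4 * (LW / rho) * \int[m]_x psi (f x).
Variables (delta eps : R).
Hypotheses (delta01 : 0 < delta <= 1) (eps01 : 0 < eps <= 1).
Hypothesis hF : forall nu : probability X R, P2 nu ->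
  (delta%:E * relative_entropy nu m <= free_energy W m nu)%E.

Let K x y := reduce m Wp x y + reduce m Wm x y.
Let a := MW + LW / rho.

Let KG : kernel_growth om K.
Proof. by apply: kernel_growthD; exact: reduce_growth. Qed.

Let Ksym x y : K x y = K y x.
Proof. by rewrite /K (reduce_sym m Wp_sym) (reduce_sym m Wm_sym). Qed.

Let Krect x y z w : rect K x y z w = rect B x y z w + rect Q x y z w.
Proof.
have -> : rect K x y z w = rect (reduce m Wp) x y z w + rect (reduce m Wm) x y z w.
  by rewrite /K /rect; ring.
rewrite !rect_reduce//.
have BQ' u v : Wp u v = B u v + Q u v - Wm u v by rewrite -BQ addrK.
by rewrite /rect !BQ'; ring.
Qed.

Let positive_om U : positive_kernel U -> om_positive om U.
Proof. by move=> Upos nu nu' inu inu'; apply: Upos; exact: om_P2. Qed.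

Let Kpos n (t : n.-tuple X) q : om_integrable om m q -> 0 <= quad_form m K t q.
Proof.
move=> iq; rewrite (quad_form_kernelD om1)//; try exact: reduce_growth.
by rewrite addr_ge0//; apply: (reduce_quad_form_ge0 mom om1) => //; exact: positive_om.
Qed.

Let energyK f : entropy_density om m f ->
  energy m K f f <= 2 * a * \int[m]_x psi (f x).
Proof.
move=> fd.
have K1 x : potential m K (cst 1) x = 0.
  have i1 := om_integrable_cst omi 1.
  rewrite (potential_kernelD om1)//; try exact: reduce_growth.
  by rewrite !(reduce_mean0 om1 omi)// addr0.
exact: (energy_decomposition om1 omi KG Ksym K1 mB mQ Krect LW0 rho0 r0
  B_rect Q_rect fd (lipschitz fd)).
Qed.

Let varianceK f : entropy_density om m f ->
  \int[m]_x (K x x * f x) - energy m K f f <=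
  (4 * MW + 4 * (LW / rho) * d%:R) + 4 * (LW / rho) * \int[m]_x psi (f x).
Proof.
move=> fd; apply: (variance_bound om1 (C := Cz) (e := e) KG Ksym Kpos mzeta zeta_om _ fd).
  move=> x; apply: le_trans (zeta_rect x); rewrite Krect.
  exact: lerD (B_rect _ _ _ _) (Q_rect _ _ _ _).
exact: zeta_int.
Qed.

Lemma free_energyN_bound n (nuN : probability (n.-tuple X) R) : (0 < n)%N ->
  (\int[nuN]_t (\sum_(i < n) om (tnth t i))%:E < +oo)%E ->
  ((((1 - eps) * delta - (1 + a / (eps * delta)) * (2 * (LW / rho) / n%:R))%:E *
      relative_entropy nuN (tuple_power m n) -
    (2 * (1 + a / (eps * delta)) * (MW + LW / rho * d%:R))%:E)
   <= free_energyN W m nuN)%E.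
Proof.
move=> n0 nu_om.
have l0 : 0 <= LW / rho by rewrite divr_ge0// ltW.
have a0 : 0 <= a by exact: addr_ge0.
have [d0 d1] := andP delta01; have [e0 e1] := andP eps01.
have ed0 : 0 < eps * delta by rewrite mulr_gt0.
have nn : n%:R != 0 :> R by rewrite pnatr_eq0 -lt0n.
pose alpha := 4 * MW + 4 * (LW / rho) * d%:R; pose beta := 4 * (LW / rho).
have alpha0 : 0 <= alpha.
  by apply: addr_ge0; [exact: mulr_ge0|do 2 (apply: mulr_ge0 => //)].
have beta0 : 0 <= beta by exact: mulr_ge0.
(* The bound is kept for every [a'] above [a], which leaves room for the degenerate case. *)
have lower eta a' : 0 < eta -> a <= a' -> _ := fun eta0 aa' =>
  free_energyN_lower mom om1 omi om_P2 WE WpG WmG Wp_sym Wm_sym Wp_pos Wm_pos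
    delta01 eta0 (le_trans a0 aa') alpha0 beta0 hF
    (fun f fd => le_trans (energyK fd) (ler_wpM2r (entropy_ge0 fd) (ler_wpM2l (ler0n R 2) aa')))
    varianceK n0 nu_om.
(* If [a = 0] the choice [eta = eps * delta / a] is impossible; [eta = 1] with [a' = eps * delta]
   gives the same coefficient, and [alpha] and [beta] vanish because [MW] and [LW / rho] do. *)
have [az|an] := eqVneq a 0.
  have lz : LW / rho = 0 by move: az MW0 l0; rewrite /a; lra.
  have mz : MW = 0 by move: az MW0 l0; rewrite /a; lra.
  have aed : a <= eps * delta by rewrite az ltW.
  have := lower 1 _ ltr01 aed; rewrite /alpha /beta az lz mz; congr (_ <= _)%E.
  by congr (_%:E * _ - _%:E)%E; field; rewrite ?nn ?(gt_eqF e0) ?(gt_eqF d0).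
have ap : 0 < a by rewrite lt0r an.
have eta0 : 0 < eps * delta / a by rewrite divr_gt0.
have := lower _ _ eta0 (lexx a); congr (_ <= _)%E.
by congr (_%:E * _ - _%:E)%E; rewrite /alpha /beta; field;
  rewrite ?an ?nn ?(gt_eqF rho0) ?(gt_eqF e0) ?(gt_eqF d0).
Qed.

End main.

Section geometries.
Context {R : realType}.

Section torus_bound.
Context {d : nat}.
Local Notation X := (flat_space R Torus d).
Variables (m : probability X R) (W Wp Wm : X -> X -> R) (MW LW rho delta eps : R).
Hypotheses (MW0 : 0 <= MW) (LW0 : 0 <= LW) (rho0 : 0 < rho)
  (delta01 : 0 < delta <= 1) (eps01 : 0 < eps <= 1).
Hypotheses (WE : forall x y, W x y = Wp x y - Wm x y)
  (Wp_sym : symmetric_kernel Wp) (Wp_growth : quadratic_growth Wp)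
  (Wp_pos : positive_kernel Wp)
  (Wm_sym : symmetric_kernel Wm) (Wm_growth : quadratic_growth Wm)
  (Wm_pos : positive_kernel Wm)
  (W_Osc2 : (Osc2 Wp + Osc2 Wm <= (4 * MW)%:E)%E) (LWE : LW = 0).
Hypothesis hF : forall nu : probability X R, P2 nu ->
  (delta%:E * relative_entropy nu m <= free_energy W m nu)%E.

(** Since [LW = 0], the quadratic piece, the distance [r] and the dependence of [zeta] on the point
    are all trivial; the weight is 1 because the modulus is bounded on the torus. *)
Lemma torus_bound n (nuN : probability (n.-tuple X) R) : (0 < n)%N ->
  ((((1 - eps) * delta -
      (1 + (MW + LW / rho) / (eps * delta)) * (2 * (LW / rho) / n%:R))%:E *
      relative_entropy nuN (tuple_power m n) -
    (2 * (1 + (MW + LW / rho) / (eps * delta)) * (MW + LW / rho * d%:R))%:E)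
   <= free_energyN W m nuN)%E.
Proof.
move=> n0.
have om1 (x : X) : 1 <= cst (1 : R) x by [].
have WpG := torus_growth Wp_sym Wp_growth; have WmG := torus_growth Wm_sym Wm_growth.
apply: (@free_energyN_bound R Torus d (cst 1) m (measurable_cst _) om1
  (integrable_cst m 1) (fun nu _ => torus_P2 nu) W Wp Wm
  (fun x y => Wp x y + Wm x y) (fun _ _ => 0) (fun _ _ => 0) MW LW rho WE WpG WmG
  Wp_sym.2 Wm_sym.2 Wp_pos Wm_pos MW0 LW0 rho0 _ _ _ _ _ _ _
  point (cst (4 * MW)) (4 * MW)) => //.
- by apply: measurable_funD; [exact: WpG.1|exact: WmG.1].
- by move=> x y; rewrite addr0.
- exact: Osc2_rect.
- by move=> x y z w; rewrite /rect !mulr0; lra.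
(* With [r = 0] the function [k] is constant, so its integral against the mass-zero [f - 1]
   vanishes. *)
- move=> f fd k C c mk _ c0 kc; apply: (@le_trans _ _ 0); last first.
    by rewrite mulr_ge0// sqrtr_ge0.
  have := pinsker_oscillation om1 (integrable_cst m 1) fd mk (c := 0).
  by rewrite mul0r; apply => x y; have := kc x y; rewrite mulr0.
- by move=> x; rewrite /= mulr1 ger0_norm// mulr_ge0.
- by move=> x; rewrite !mulr0 addr0.
- move=> f fd; have [_ fi f1 _] := fd.
  rewrite RintegralZl//; last exact: (om_integrable_int om1 fi).
  by rewrite f1 LWE mul0r !mulr0 !mul0r !addr0 mulr1.
- rewrite (_ : (\int[nuN]_t _)%E = (n%:R)%:E) ?ltry//.
  rewrite (eq_integral (fun=> (n%:R)%:E)); last first.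
    by move=> t _; rewrite sumr_const card_ord.
  by rewrite integral_EFin ?Rintegral_cst_prob//; exact: (integrable_cst nuN n%:R).
Qed.

End torus_bound.

Section euclidean_bound.
Context {d : nat}.
Local Notation X := (flat_space R Euclidean d).
Variables (m : probability X R) (W Wp Wm : X -> X -> R) (MW LW rho delta eps : R).
Hypotheses (MW0 : 0 <= MW) (LW0 : 0 <= LW) (rho0 : 0 < rho)
  (delta01 : 0 < delta <= 1) (eps01 : 0 < eps <= 1).
Hypotheses (mP2 : P2 m) (mT : talagrand rho m).
Hypotheses (WE : forall x y, W x y = Wp x y - Wm x y)
  (Wp_sym : symmetric_kernel Wp) (Wp_growth : quadratic_growth Wp)
  (Wp_pos : positive_kernel Wp)
  (Wm_sym : symmetric_kernel Wm) (Wm_growth : quadratic_growth Wm)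
  (Wm_pos : positive_kernel Wm).
Hypothesis W_dec : exists Wpb Wpq Wmb Wmq : X -> X -> R,
  [/\ (forall x y, Wp x y = Wpb x y + Wpq x y) /\
      (forall x y, Wm x y = Wmb x y + Wmq x y),
      [/\ symmetric_kernel Wpb, symmetric_kernel Wpq,
          symmetric_kernel Wmb & symmetric_kernel Wmq],
      (Osc2 Wpb + Osc2 Wmb <= (4 * MW)%:E)%E,
      mixed_differentiable (lifted Wpq) /\ mixed_differentiable (lifted Wmq) &
      (mixed_hessian_Linf (lifted Wpq) + mixed_hessian_Linf (lifted Wmq) <= LW%:E)%E].
Hypothesis hF : forall nu : probability X R, P2 nu ->
  (delta%:E * relative_entropy nu m <= free_energy W m nu)%E.

Lemma rect_Linf_sum (U U' : X -> X -> R) L :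
  mixed_differentiable (lifted U) -> mixed_differentiable (lifted U') ->
  (mixed_hessian_Linf (lifted U) + mixed_hessian_Linf (lifted U') <= L%:E)%E ->
  forall x y z w, rect (fun x y => U x y + U' x y) x y z w <=
    L * space_dist x y * space_dist z w.
Proof.
move=> dU dU' hL x y z w.
(* Nonnegativity of both terms makes each of them finite, so the rectangle bound applies to each
   piece with its own norm. *)
have := mixed_hessian_Linf_ge0 (lifted U); have := mixed_hessian_Linf_ge0 (lifted U').
have := @rect_Linf R d U; have := @rect_Linf R d U'; move: hL.
case: (mixed_hessian_Linf (lifted U)) => [l| |] //;
  case: (mixed_hessian_Linf (lifted U')) => [l'| |] //.
rewrite -EFinD !lee_fin => ll /(_ l' dU' (lexx _) x y z w) h' /(_ l dU (lexx _) x y z w) h _ _.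
have -> : rect (fun x y => U x y + U' x y) x y z w = rect U x y z w + rect U' x y z w.
  by rewrite /rect; ring.
apply: le_trans (lerD h h') _; rewrite -!mulrDl.
by rewrite !ler_wpM2r// space_dist_ge0.
Qed.

Lemma euclidean_bound n (nuN : probability (n.-tuple X) R) : (0 < n)%N -> P2N nuN ->
  ((((1 - eps) * delta -
      (1 + (MW + LW / rho) / (eps * delta)) * (2 * (LW / rho) / n%:R))%:E *
      relative_entropy nuN (tuple_power m n) -
    (2 * (1 + (MW + LW / rho) / (eps * delta)) * (MW + LW / rho * d%:R))%:E)
   <= free_energyN W m nuN)%E.
Proof.
move=> n0 nuP2.
have [Wpb [Wpq [Wmb [Wmq
  [[WpE WmE] [[mWpb _] [mWpq _] [mWmb _] [mWmq _]] hOsc [dp dm] hL]]]]] := W_dec.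
have mom := @measurable_moment_weight R d; have om1 := @moment_weight_ge1 R d.
have omi : m.-integrable setT (EFin \o @moment_weight R d) by exact/P2_weight.
have WpG := quadratic_growth_weight Wp_sym Wp_growth.
have WmG := quadratic_growth_weight Wm_sym Wm_growth.
pose e := barycenter m.
have mD : measurable_fun setT (fun x : X => space_dist x e ^+ 2).
  apply: measurable_funX; apply: (@measurable_pairr _ _ X X R (@space_dist R Euclidean d)).
  exact: measurable_space_dist.
have De x : space_dist x e ^+ 2 <= (2 + 2 * modulus e ^+ 2) * moment_weight x.
  apply: le_trans (space_dist_sqr_triangle x (covering _ 0) e) _.
  rewrite -/(modulus x) /moment_weight.
  have -> : space_dist (covering Euclidean 0) e ^+ 2 = modulus e ^+ 2.
    rewrite modulus_sqr space_dist_sqr; apply: eq_bigr => i _.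
    by rewrite tnth_mktuple mxE sub0r sqrrN.
  have := sqr_ge0 (modulus x); have := sqr_ge0 (modulus e); nra.
(* [zeta] dominates the rectangle with corners [(x, e, x, e)]: [4 * MW] from the bounded piece, the
   squared distance from the quadratic one. Centring at the barycenter brings in the coordinate
   variances. *)
pose zeta (x : X) := 4 * MW + LW * space_dist x e ^+ 2.
have mzeta : measurable_fun setT zeta.
  by apply: measurable_funD => //; exact: measurable_funM.
have zeta_om x : `|zeta x| <= (4 * MW + LW * (2 + 2 * modulus e ^+ 2)) * moment_weight x.
  rewrite ger0_norm; last by apply: addr_ge0; rewrite mulr_ge0 ?sqr_ge0.
  rewrite mulrDl; apply: lerD; first by rewrite ler_peMr// mulr_ge0.
  by rewrite -mulrA ler_wpM2l.
apply: (@free_energyN_bound R Euclidean d (@moment_weight R d) m mom om1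
  omi (fun nu => proj2 (P2_weight nu)) W Wp Wm
  (fun x y => Wpb x y + Wmb x y) (fun x y => Wpq x y + Wmq x y)
  (@space_dist R Euclidean d) MW LW rho WE WpG WmG
  Wp_sym.2 Wm_sym.2 Wp_pos Wm_pos MW0 LW0 rho0 _ _ _ _ _ _ _ e zeta _ mzeta zeta_om) => //.
- exact: measurable_funD.
- exact: measurable_funD.
- by move=> x y; rewrite WpE WmE addrACA.
- exact: Osc2_rect.
- exact: rect_Linf_sum.
- exact: space_dist_ge0.
- by move=> f fd k C c; exact: talagrand_lipschitz.
- by move=> x; rewrite /zeta expr2 mulrA.
- move=> f fd; have [_ fi f1 _] := fd.
  have fint := om_integrable_int om1 fi.
  have iD : m.-integrable setT (EFin \o (fun x => space_dist x e ^+ 2 * f x)).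
    apply: (om_integrableM om1 fi mD (C := 2 + 2 * modulus e ^+ 2)) => x.
    by rewrite ger0_norm ?sqr_ge0.
  under eq_Rintegral => x _.
    rewrite (_ : zeta x * f x = 4 * MW * f x + LW * (space_dist x e ^+ 2 * f x)); last first.
      by rewrite mulrDl mulrA.
    over.
  rewrite RintegralD//; [|exact: integrable_Z..].
  rewrite !RintegralZl// f1 mulr1 -addrA lerD2l.
  (* [LW * (4 / rho * H + 2 * (2 / rho * d))] yields both the entropy term and the dimensional term
     of the variance bound. *)
  have := talagrand_second_moment rho0 mP2 mT e fd.
  have := talagrand_variance rho0 mP2 mT; rewrite -/e => hv hm.
  have {hm} hm := le_trans hm (lerD (lexx _) (ler_wpM2l (ler0n R 2) hv)).
  apply: le_trans (ler_wpM2l LW0 hm) _.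
  by rewrite le_eqVlt; apply/orP; left; apply/eqP; field; rewrite gt_eqF.
- apply: (@le_lt_trans _ _ (\int[nuN]_t ((n%:R)%:E +
      (\sum_(i < n) modulus (tnth t i) ^+ 2)%:E))%E).
    rewrite le_eqVlt; apply/orP; left; apply/eqP; apply: eq_integral => t _.
    by rewrite -EFinD /moment_weight big_split/= sumr_const card_ord.
  rewrite ge0_integralD//.
  + rewrite (_ : (\int[nuN]_t (n%:R)%:E)%E = (n%:R)%:E); last first.
      by rewrite integral_EFin ?Rintegral_cst_prob//; exact: (integrable_cst nuN n%:R).
    by rewrite lte_add_pinfty// ltry.
  + by move=> t _; rewrite lee_fin sumr_ge0// => i _; rewrite sqr_ge0.
  + apply/measurable_EFinP; apply: measurable_sum => i.
    have mm : measurable_fun setT (fun x : X => modulus x ^+ 2).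
      under eq_fun do rewrite modulus_sqr.
      by apply: measurable_sum => j; apply: measurable_funX; exact: measurable_coord.
    exact: (measurableT_comp mm (measurable_tnth i)).
Qed.

End euclidean_bound.
End geometries.

Theorem theorem1 (R : realType) (g : geometry) (d : nat)
  (V : flat_space R g d -> R) (W : flat_space R g d -> flat_space R g d -> R)
  (mstar : probability (flat_space R g d) R)
  (MW LW rho delta : R) (N : nat)
  (hV : C2_potential V)
  (hW : C2_kernel W) (hWsym : symmetric_kernel W)
  (hWgrowth : quadratic_growth W)
  (hnorm : normalizable V W)
  (hmstar : P2 mstar)
  (hfix : forall A : set (flat_space R g d), measurable A ->
    mstar A = gibbs V W mstar A)
  (hMW : 0 <= MW) (hLW : 0 <= LW) (hrho : 0 < rho)
  (hdelta : 0 < delta <= 1) (hN : (1 <= N)%N)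
  (hdec : decomposable MW LW W)
  (hT : talagrand rho mstar)
  (hF : forall nu : probability (flat_space R g d) R, P2 nu ->
    (delta%:E * relative_entropy nu mstar <= free_energy W mstar nu)%E)
  (eps : R) (heps : 0 < eps <= 1)
  (nuN : probability (N.-tuple (flat_space R g d)) R) (hnuN : P2N nuN) :
  let lW := LW / rho in
  let deltaN := (1 - eps) * delta
    - (1 + (MW + lW) / (eps * delta)) * (2 * lW / N%:R) in
  let DeltaF := 2 * (1 + (MW + lW) / (eps * delta)) * (MW + lW * d%:R) in
  (deltaN%:E * relative_entropy nuN (tuple_power mstar N) - DeltaF%:E
    <= free_energyN W mstar nuN)%E.
Proof.
cbv zeta; clear hV hW hWsym hWgrowth hnorm hfix.
case: g V W mstar hmstar hdec hT hF nuN hnuN =>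
    V W mstar hmstar [Wp [Wm [WE [Wps Wpg Wpp] [Wms Wmg Wmp] hdec]]] hT hF nuN hnuN.
- exact: (torus_bound hMW hLW hrho hdelta heps WE Wps Wpg Wpp Wms Wmg Wmp hdec.1 hdec.2 hF nuN hN).
- exact: (euclidean_bound hMW hLW hrho hdelta heps hmstar hT WE Wps Wpg Wpp Wms Wmg Wmp
    hdec hF hN hnuN).
Qed.
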